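(* Let $\alpha\in(0,1)$, $\overline{\delta}>\underline{\delta}>0$, let $C:[0,1]\to\mathbb{R}^{D\times D}$ be $\alpha$-H\''older continuous with $\overline{\delta}|y|^2\ge y^TC(t)C(t)^Ty\ge\underline{\delta}|y|^2$ for all $y\in\mathbb{R}^D$, $t\in[0,1]$, and let $g^{(1)},\dots,g^{(I)}\in C^{2+\alpha}(\mathbb{R}^D)$. Then there exists $T_0\in(0,1]$ such that for every $T<T_0$ the nonlinear PDE system, for $i=1,\dots,I$, $$\partial_tu^{(i)}+\tfrac1{2a_i}|\lambda|^2-\lambda^T\bar C^T\partial_yu^{(i)}+\tfrac{a_i}2\big(|\bar C^T\partial_yu^{(i)}|^2-|C^T\partial_yu^{(i)}|^2\big)+\tfrac12\mathrm{tr}\big(\partial_{yy}u^{(i)}CC^T\big)=0,\qquad u^{(i)}(T,y)=g^{(i)}(y),$$ with coupling function $$\lambda(t,y):=\frac1{\tau_\Sigma}\bar C(t)^T\sum_{j=1}^I\partial_yu^{(j)}(t,y),$$ has a unique solution $(u^{(i)})_{i=1}^I\subset C^{2+\alpha}([0,T]\times\mathbb{R}^D)$.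
   Context: $1\le N\le D$, $I\ge1$; $\bar C(t)$ is the $D\times N$ matrix formed by the first $N$ columns of $C(t)$; $a_1,\dots,a_I>0$ and $\tau_\Sigma:=\sum_{i=1}^I 1/a_i$. $C^{2+\alpha}(\mathbb{R}^D)$ is the set of $C^2$ functions $g$ with $|g|_0+|\partial_yg|_0+|\partial_{yy}g|_0+[\partial_{yy}g]_\alpha<\infty$ ($|\cdot|_0$ sup norm, $[h]_\alpha=\sup_{x\ne y}|h(x)-h(y)|/|x-y|^\alpha$). $C^{2+\alpha}([0,T]\times\mathbb{R}^D)$ is the set of $C^{1,2}$ functions $u$ with $|\partial_tu|_0+[\partial_tu]_\alpha+|u|_0+|\partial_yu|_0+|\partial_{yy}u|_0+[\partial_{yy}u]_\alpha<\infty$, where $[h]_\alpha=\sup_{(t,x)\ne(s,y)}|h(t,x)-h(s,y)|/(\sqrt{|t-s|}+|x-y|)^\alpha$. *)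

(* Defs.v *)
From HB Require Import structures.
From mathcomp Require Import all_boot all_order all_algebra.
From mathcomp Require Import all_classical all_reals all_analysis.
Set Implicit Arguments. Unset Strict Implicit. Unset Printing Implicit Defensive.
Import Order.TTheory GRing.Theory Num.Theory.
Import numFieldNormedType.Exports.
Local Open Scope classical_set_scope.
Local Open Scope ring_scope.

Section Defs.
Variable R : realType.
Variable D : nat.
Local Notation V := 'cV[R]_D.

Definition sqnorm m (y : 'cV[R]_m) : R := \sum_(i < m) y i 0 ^+ 2.
Definition enorm (y : V) : R := Num.sqrt (sqnorm y).

Definition ecoord (k : 'I_D) : V := delta_mx k 0.
Definition pd (f : V -> R) (k : 'I_D) (y : V) : R := 'D_(ecoord k) f y.
Definition grad (f : V -> R) (y : V) : V := \col_k pd f k y.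
Definition hess (f : V -> R) (y : V) : 'M[R]_D :=
  \matrix_(k, l) pd (pd f l) k y.

Definition C2 (f : V -> R) : Prop :=
  [/\ continuous f,
      forall k y, derivable f y (ecoord k),
      forall k, continuous (pd f k),
      forall k l y, derivable (pd f l) y (ecoord k) &
      forall k l, continuous (pd (pd f l) k)].

Definition bounded_on {T : Type} (A : set T) (h : T -> R) : Prop :=
  exists M : R, forall x, A x -> `|h x| <= M.

Definition C2alpha (alpha : R) (g : V -> R) : Prop :=
  [/\ C2 g,
      bounded_on setT g,
      forall k, bounded_on setT (pd g k),
      forall k l, bounded_on setT (fun y => hess g y k l) &
      forall k l, exists K : R, forall x y,
        `|hess g x k l - hess g y k l| <= K * (enorm (x - y)) `^ alpha].

Definition strip (T : R) : set (R * V) := [set p | 0 <= p.1 <= T].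

(* difference quotient in time, restricted to [0,T] (one-sided at endpoints) *)
Definition tfilter (T t : R) := within [set h : R | h != 0 /\ 0 <= t + h <= T] (nbhs (0 : R)).
Definition tquot (u : R -> V -> R) (t : R) (y : V) := fun h : R => h^-1 * (u (t + h) y - u t y).
Definition tderivable (T : R) (u : R -> V -> R) (t : R) (y : V) : Prop :=
  exists l : R, tquot u t y @ tfilter T t --> l.
Definition dt (T : R) (u : R -> V -> R) (t : R) (y : V) : R :=
  lim (tquot u t y @ tfilter T t).

Definition cont_on_strip (T : R) (h : R -> V -> R) : Prop :=
  {within strip T, continuous (fun p : R * V => h p.1 p.2)}.

Definition par_holder (alpha T : R) (h : R -> V -> R) : Prop :=
  exists K : R, forall t s x y, 0 <= t <= T -> 0 <= s <= T ->
    `|h t x - h s y| <= K * (Num.sqrt `|t - s| + enorm (x - y)) `^ alpha.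

Definition C12 (T : R) (u : R -> V -> R) : Prop :=
  [/\ forall t y, 0 <= t <= T -> tderivable T u t y,
      forall t k y, 0 <= t <= T -> derivable (u t) y (ecoord k),
      forall t k l y, 0 <= t <= T -> derivable (pd (u t) l) y (ecoord k),
      cont_on_strip T u /\ cont_on_strip T (dt T u) &
      (forall k, cont_on_strip T (fun t y => pd (u t) k y)) /\
      (forall k l, cont_on_strip T (fun t y => hess (u t) y k l))].

Definition C2alpha_par (alpha T : R) (u : R -> V -> R) : Prop :=
  [/\ C12 T u,
      bounded_on (strip T) (fun p => dt T u p.1 p.2) /\ par_holder alpha T (dt T u),
      bounded_on (strip T) (fun p => u p.1 p.2),
      forall k, bounded_on (strip T) (fun p => pd (u p.1) k p.2) &
      forall k l, bounded_on (strip T) (fun p => hess (u p.1) p.2 k l) /\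
                  par_holder alpha T (fun t y => hess (u t) y k l)].

Definition firstcols (N : nat) (hND : (N <= D)%N) (M : 'M[R]_D) : 'M[R]_(D, N) :=
  \matrix_(i < D, j < N) M i (widen_ord hND j).

Definition scal11 (M : 'M[R]_1) : R := M 0 0.

Definition lambda_fun (I N : nat) (hND : (N <= D)%N) (a : 'I_I -> R)
  (C : R -> 'M[R]_D) (u : 'I_I -> R -> V -> R) (t : R) (y : V) : 'cV[R]_N :=
  ((\sum_(i < I) (a i)^-1)^-1) *:
    ((firstcols hND (C t))^T *m (\sum_(j < I) grad (u j t) y)).

Definition is_solution (I N : nat) (hND : (N <= D)%N) (a : 'I_I -> R)
  (C : R -> 'M[R]_D) (g : 'I_I -> V -> R) (alpha T : R)
  (u : 'I_I -> R -> V -> R) : Prop :=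
  [/\ forall i, C2alpha_par alpha T (u i),
      forall i y, u i T y = g i y &
      forall i t y, 0 <= t <= T ->
        let lam := lambda_fun hND a C u t y in
        let Cb := firstcols hND (C t) in
        let p := grad (u i t) y in
        dt T (u i) t y
        + (2 * a i)^-1 * sqnorm lam
        - scal11 (lam^T *m Cb^T *m p)
        + a i / 2 * (sqnorm (Cb^T *m p) - sqnorm ((C t)^T *m p))
        + 2^-1 * \tr (hess (u i t) y *m C t *m (C t)^T) = 0].

End Defs.

(* Main.v *)
(** Everything is done with finite differences instead of derivatives.  The heat
operator [exp (s D_d^2)] in a direction [d] is the limit of simple random walks
on finer and finer lattices; discrete Gaussian integration by parts gives its
smoothing estimate.  Near time 0 the matrix [C C^T / 2] is a combination, with
nonnegative Hoelder weights, of [d d^T] for fixed directions [d], so the product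
of the corresponding (commuting) heat operators is an evolution family [P t s]
with generator [tr (C C^T D^2) / 2].  The Duhamel term [int_t^T P t s (f s) ds],
defined as a limit of dyadic Riemann sums, gains two derivatives up to the
Hoelder exponent.  For small [T], Picard iteration contracts in the Lipschitz
seminorm and preserves bounds on first and second differences; its fixed point
[u = P g + int P F(grad u)] has the required regularity and solves the system.
Conversely, Taylor expansion in time shows that a classical solution satisfies
the same integral equation up to errors that sum to zero over fine partitions,
and two solutions of the integral equation agree on successive short time
intervals. *)

Require Import Defs.
From HB Require Import structures.
From mathcomp Require Import all_boot all_order all_algebra.
From mathcomp Require Import all_classical all_reals all_analysis.
From mathcomp Require Import ring lra zify.
Import Order.TTheory GRing.Theory Num.Theory.
Import numFieldNormedType.Exports.
Local Open Scope classical_set_scope.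
Local Open Scope ring_scope.
Set Implicit Arguments.
Unset Strict Implicit.
Unset Printing Implicit Defensive.

(** * Random walks *)

Section RealWalk.
Context {R : realType}.
Implicit Types (F G : R -> R) (k : nat) (x : R).

Definition rwalk F x : R := 2^-1 * (F (x + 1) + F (x - 1)).
Definition rdiff F x : R := 2^-1 * (F (x + 1) - F (x - 1)).

Lemma rwalk_le F G k x :
  (forall z, F z <= G z) -> iter k rwalk F x <= iter k rwalk G x.
Proof.
move=> FG; elim: k x => [|k IH] x //=.
by rewrite /rwalk ler_pM2l ?invr_gt0 ?ltr0n// lerD.
Qed.

Lemma rwalk_lin a b F G k x :
  iter k rwalk (fun z => a * F z + b * G z) x =
  a * iter k rwalk F x + b * iter k rwalk G x.
Proof. by elim: k x => [|k IH] x //=; rewrite /rwalk !IH; ring. Qed.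

Lemma rwalk_cst c k x : iter k rwalk (fun=> c) x = c.
Proof. by elim: k x => [|k IH] x //=; rewrite /rwalk !IH; field. Qed.

Lemma rwalk_id k x : iter k rwalk id x = x.
Proof. by elim: k x => [|k IH] x //=; rewrite /rwalk !IH; field. Qed.

Lemma rwalk_sq k x : iter k rwalk (fun z => z ^+ 2) x = x ^+ 2 + k%:R.
Proof.
elim: k x => [|k IH] x /=; first by rewrite addr0.
by rewrite /rwalk !IH -natr1; field.
Qed.

Lemma rwalk_quartic k x : iter k rwalk (fun z => z ^+ 4) x =
  x ^+ 4 + 6 * k%:R * x ^+ 2 + 3 * k%:R ^+ 2 - 2 * k%:R.
Proof.
elim: k x => [|k IH] x /=; first by ring.
by rewrite /rwalk !IH -natr1; field.
Qed.

Lemma rwalk_norm F k x :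
  `|iter k rwalk F x| <= iter k rwalk (fun z => `|F z|) x.
Proof.
rewrite ler_norml; apply/andP; split.
  have := rwalk_lin (-1) 0 (fun z => `|F z|) (fun=> 0) k x.
  rewrite mulN1r [0 * iter _ _ _ _]mul0r addr0 => <-; apply: rwalk_le => z.
  by rewrite mul0r addr0 mulN1r lerNl ler_normr lexx orbT.
by apply: rwalk_le => z; rewrite ler_norm.
Qed.

Lemma rwalk_rdiff F k x : iter k rwalk (rdiff F) x = rdiff (iter k rwalk F) x.
Proof.
elim: k x => [|k IH] x //=.
rewrite /rwalk !IH /rdiff /rwalk.
have -> : x + 1 - 1 = x - 1 + 1 by ring.
ring.
Qed.

(* Discrete Gaussian integration by parts. *)
Lemma rwalk_stein F k x : iter k.+1 rwalk (fun z => z * F z) x =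
  x * iter k.+1 rwalk F x + k.+1%:R * iter k rwalk (rdiff F) x.
Proof.
elim: k x => [|k IH] x; first by rewrite /= /rwalk /rdiff; field.
have rwE H z : rwalk H z = 2^-1 * (H (z + 1) + H (z - 1)) by [].
have : iter k.+1 rwalk (rdiff F) x = 2^-1 * (iter k.+1 rwalk F (x + 1) - iter k.+1 rwalk F (x - 1)).
  exact: rwalk_rdiff.
rewrite iterS rwE (iterS k.+1 rwalk (fun z => _)) rwE !IH.
rewrite (iterS k.+1 rwalk F) [rwalk _ x]rwE -(natr1 k.+1) => e.
set A := iter k.+1 rwalk F in e *.
set B := iter k rwalk (rdiff F) in e *.
move: (A (x + 1)) (A (x - 1)) (B (x + 1)) (B (x - 1)) e => a a' b b' e.
transitivity (x * (2^-1 * (a + a')) + 2^-1 * (a - a') + k.+1%:R * (2^-1 * (b + b'))).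
  ring.
by rewrite -e; ring.
Qed.

Lemma rwalk_rdiff_le F k M : (forall z, `|F z| <= M) ->
  `|iter k rwalk (rdiff F) 0| <= M / Num.sqrt k.+1%:R.
Proof.
move=> FM; have M0 : 0 <= M by apply: le_trans (FM 0).
have k0 : 0 < k.+1%:R :> R by rewrite ltr0n.
have s0 : 0 < Num.sqrt k.+1%:R :> R by rewrite sqrtr_gt0.
have s2 : Num.sqrt k.+1%:R ^+ 2 = k.+1%:R :> R by rewrite sqr_sqrtr// ltW.
rewrite -(@ler_pM2l _ k.+1%:R)//.
rewrite -{1}(ger0_norm (ltW k0)) -normrM.
have := rwalk_stein F k 0; rewrite mul0r add0r => <-.
apply: (le_trans (rwalk_norm _ _ _)).
set s := Num.sqrt _ in s0 s2 *.
apply: (@le_trans _ _ (iter k.+1 rwalk (fun z => (M / s / 2) * z ^+ 2 + (M * s / 2) * 1) 0)).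
  apply: rwalk_le => z; rewrite normrM mulr1.
  have -> : M / s / 2 * z ^+ 2 + M * s / 2 = (2 * s)^-1 * (z ^+ 2 + s ^+ 2) * M.
    by field; rewrite gt_eqF.
  apply: ler_pM => //.
  rewrite mulrC ler_pdivlMr ?mulr_gt0//.
  rewrite -(real_normK (num_real z)).
  by have := sqr_ge0 (`|z| - s); nra.
rewrite rwalk_lin rwalk_sq rwalk_cst -s2 expr0n/= add0r le_eqVlt; apply/orP; left; apply/eqP.
by field; rewrite gt_eqF.
Qed.

End RealWalk.

Section Powers.
Context {R : realType}.
Implicit Types (a r b : R).

Lemma powR1D r b : 0 < r -> r `^ (1 + b) = r * r `^ b.
Proof. by move=> r0; rewrite powRD ?powRr1 ?(ltW r0)// (gt_eqF r0) implybT. Qed.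

Lemma powRB1M r b : 0 < r -> r `^ (b - 1) * r = r `^ b.
Proof. by move=> r0; rewrite mulrC -powR1D// addrC subrK. Qed.

Lemma powR_exprn r n b : 0 <= r -> (r ^+ n) `^ b = (r `^ b) ^+ n.
Proof.
move=> r0; elim: n => [|n IH]; first by rewrite !expr0 powR1.
by rewrite !exprS powRM ?exprn_ge0// IH.
Qed.

Lemma powR_half_sq r b : 0 <= r -> (r ^+ 2) `^ (b / 2) = r `^ b.
Proof.
move=> r0; rewrite -powR_mulrn// -powRrM; congr (_ `^ _).
by rewrite mulrC divfK// pnatr_eq0.
Qed.

Lemma powR_lt1 r b : 0 <= r < 1 -> 0 < b -> r `^ b < 1.
Proof.
move=> /andP[r0 r1] b0; have -> : 1 = 1 `^ b by rewrite powR1.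
by rewrite gt0_ltr_powR ?nnegrE.
Qed.

Lemma powR_ge1 r b : 1 <= r -> 0 <= b -> 1 <= r `^ b.
Proof.
move=> r1 b0; have {1}-> : 1 = 1 `^ b by rewrite powR1.
by rewrite ge0_ler_powR ?nnegrE// (le_trans ler01).
Qed.

Lemma powR_le1 r b : 0 <= r <= 1 -> 0 <= b -> r `^ b <= 1.
Proof.
move=> /andP[r0 r1] b0; have -> : 1 = 1 `^ b by rewrite powR1.
by rewrite ge0_ler_powR ?nnegrE.
Qed.

Lemma powR_pred_le r a b : 0 < r -> r <= a -> b <= 1 -> a `^ (b - 1) <= r `^ (b - 1).
Proof.
move=> r0 ra b1; have a0 : 0 < a by exact: lt_le_trans ra.
have e c : 0 < c -> c `^ (b - 1) = (c^-1) `^ (1 - b).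
  by move=> c0; rewrite -[c in RHS]powRr1 ?ltW// -powRN -powRrM mulN1r opprB.
rewrite !e//; apply: ge0_ler_powR; rewrite ?subr_ge0// ?nnegrE ?invr_ge0 ?(ltW r0) ?(ltW a0)//.
by rewrite lef_pV2.
Qed.

Lemma powR_le_quad a r b : 0 <= a -> 0 < r -> 0 <= b <= 1 ->
  a `^ b <= r `^ b + r `^ (b - 1) * a.
Proof.
move=> a0 r0 /andP[b0 b1]; have [ar|ra] := leP a r.
  rewrite -[leLHS]addr0; apply: lerD; last by rewrite mulr_ge0 ?powR_ge0.
  by apply: ge0_ler_powR => //; rewrite nnegrE// ltW.
rewrite -[leLHS]add0r; apply: lerD; first exact: powR_ge0.
have a1 : 0 < a by apply: lt_trans ra.
rewrite -(powRB1M b a1); apply: ler_wpM2r => //.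
by apply: powR_pred_le => //; exact: ltW.
Qed.

End Powers.

Definition bnd {R : realType} {V : Type} (phi : V -> R) (M : R) :=
  forall y, `|phi y| <= M.

Definition transl {R : realType} {V : normedModType R} (v : V) (phi : V -> R) (y : V) :=
  phi (y + v).

Definition dif {R : realType} {V : normedModType R} (v : V) (phi : V -> R) (y : V) :=
  phi (y + v) - phi y.

Definition hol {R : realType} {V : normedModType R} (a : R) (phi : V -> R) (K : R) :=
  forall v, bnd (dif v phi) (K * `|v| `^ a).

Section Walk.
Context {R : realType} {V : normedModType R}.
Implicit Types (phi psi : V -> R) (v d y : V) (k : nat) (M K : R).

Definition walk v phi y : R := 2^-1 * (phi (y + v) + phi (y - v)).
Definition sdif v phi y : R := 2^-1 * (phi (y + v) - phi (y - v)).

Lemma iter_walkE k v phi y x :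
  iter k (walk v) phi (y + x *: v) = iter k rwalk (fun z => phi (y + z *: v)) x.
Proof.
elim: k x => [|k IH] x //=; rewrite /walk /rwalk -!IH.
by rewrite scalerDl scalerBl scale1r !addrA.
Qed.

Lemma iter_walk0 k v phi y :
  iter k (walk v) phi y = iter k rwalk (fun z => phi (y + z *: v)) 0.
Proof. by rewrite -iter_walkE scale0r addr0. Qed.

Lemma iter_walk_lin a b phi psi k v y :
  iter k (walk v) (fun z => a * phi z + b * psi z) y =
  a * iter k (walk v) phi y + b * iter k (walk v) psi y.
Proof. by elim: k y => [|k IH] y //=; rewrite /walk !IH; ring. Qed.

Lemma iter_walk_bnd phi M k v : bnd phi M -> bnd (iter k (walk v) phi) M.
Proof.
move=> bM y; rewrite iter_walk0; apply: le_trans (rwalk_norm _ _ _) _.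
by rewrite -[leRHS](rwalk_cst M k 0); apply: rwalk_le => z; exact: bM.
Qed.

Lemma iter_walkC j k v d phi y :
  iter j (walk v) (iter k (walk d) phi) y = iter k (walk d) (iter j (walk v) phi) y.
Proof.
elim: j y => [|j IH] y //=; rewrite /walk !IH.
have := iter_walk_lin 2^-1 2^-1 (transl v (iter j (walk v) phi)) (transl (-v) (iter j (walk v) phi)) k d y.
have sh w psi : iter k (walk d) (transl w psi) y = iter k (walk d) psi (y + w).
  elim: k {IH} y => [|k IH] y //=; rewrite /walk !IH.
  by rewrite ![_ + w + _]addrAC.
rewrite !sh => e; rewrite mulrDr -e; congr (iter _ _ _ _).
by apply/funext => z; rewrite /transl mulrDr.
Qed.

Lemma iter_walk_sdif k v phi y :
  iter k (walk v) (sdif v phi) y = sdif v (iter k (walk v) phi) y.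
Proof.
elim: k y => [|k IH] y //=; rewrite /walk !IH /sdif /walk.
by rewrite addrK subrK; ring.
Qed.

Lemma iter_walk_sdif_bnd phi M k v : bnd phi M ->
  bnd (iter k (walk v) (sdif v phi)) (M / Num.sqrt k.+1%:R).
Proof.
move=> bM y; rewrite iter_walk0.
rewrite (_ : (fun z => _) = rdiff (fun z => phi (y + z *: v))).
  by apply: rwalk_rdiff_le => z; exact: bM.
by apply/funext => z; rewrite /rdiff /sdif scalerDl scalerBl scale1r !addrA.
Qed.

Lemma iter_walk_moment a phi K k v : 0 < a <= 2 -> hol a phi K ->
  bnd (fun y => iter k (walk v) phi y - phi y) (2 * K * (`|v| ^+ 2 * k%:R) `^ (a / 2)).
Proof.
move=> /andP[a0 a2] hK y.
have b01 : 0 <= a / 2 <= 1 by apply/andP; split; lra.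
have [kv0|kv] := eqVneq (`|v| ^+ 2 * k%:R) 0.
  rewrite kv0 powR0 ?mulr0; last by apply/eqP; lra.
  move/eqP: kv0; rewrite mulf_eq0 expf_eq0/= normr_eq0 pnatr_eq0 => /orP[/eqP->|/eqP->/=].
    rewrite iter_walk0 (_ : (fun z => _) = (fun=> phi y)); last first.
      by apply/funext => z; rewrite scaler0 addr0.
    by rewrite rwalk_cst subrr normr0.
  by rewrite subrr normr0.
set r := `|v| ^+ 2 * k%:R in kv *.
have r0 : 0 < r by rewrite lt0r kv mulr_ge0.
have K0 : 0 <= K.
  have v0 : v != 0 by apply: contra_neq kv => v0; rewrite /r v0 normr0 expr0n mul0r.
  have := le_trans (normr_ge0 _) (hK v 0).
  by rewrite pmulr_lge0 ?powR_gt0 ?normr_gt0.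
rewrite iter_walk0 -[X in _ - X](rwalk_cst (phi y) k 0).
have := rwalk_lin 1 (-1) (fun z => phi (y + z *: v)) (fun=> phi y) k 0.
rewrite [1 * iter _ _ _ _]mul1r [-1 * iter _ _ _ _]mulN1r => <-.
apply: le_trans (rwalk_norm _ _ _) _.
apply: (@le_trans _ _ (iter k rwalk (fun z => (K * r `^ (a / 2)) * 1 + (K * r `^ (a / 2 - 1) * `|v| ^+ 2) * z ^+ 2) 0)).
  apply: rwalk_le => z; rewrite mul1r mulN1r mulr1.
  apply: (le_trans (hK (z *: v) y)).
  have -> : `|z *: v| `^ a = (z ^+ 2 * `|v| ^+ 2) `^ (a / 2).
    rewrite normrZ -(real_normK (num_real z)) -exprMn.
    rewrite -powR_mulrn ?mulr_ge0// -powRrM; congr (_ `^ _).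
    by field.
  rewrite -mulrA -mulrA -mulrDr; apply: ler_wpM2l => //.
  rewrite [`|v| ^+ 2 * _]mulrC; apply: powR_le_quad => //.
  by rewrite mulr_ge0 ?sqr_ge0.
rewrite rwalk_lin rwalk_cst rwalk_sq expr0n/= add0r mulr1.
have -> : K * r `^ (a / 2 - 1) * `|v| ^+ 2 * k%:R = K * (r `^ (a / 2 - 1) * r) by rewrite /r; ring.
rewrite powRB1M//.
by rewrite le_eqVlt; apply/orP; left; apply/eqP; ring.
Qed.

Lemma iter_walk_taylor a phi K k v y b h : 0 < a <= 2 -> 0 <= K ->
  (forall r, `|phi (y + r *: v) - phi y - r * b - 2^-1 * r ^+ 2 * h| <= K * `|r| `^ (2 + a)) ->
  `|iter k (walk v) phi y - phi y - 2^-1 * k%:R * h| <= 4 * K * k%:R `^ (1 + a / 2).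
Proof.
move=> /andP[a0 a2] K0 hK.
have b01 : 0 <= a / 2 <= 1 by apply/andP; split; lra.
have [->|k0] := posnP k.
  by rewrite /= subrr mulr0 mul0r subrr normr0 !mulr_ge0 ?powR_ge0.
set r : R := k%:R; have r0 : 0 < r by rewrite ltr0n.
have -> : iter k (walk v) phi y - phi y - 2^-1 * r * h =
  iter k rwalk (fun z => phi (y + z *: v) - phi y - z * b - 2^-1 * z ^+ 2 * h) 0.
  have := rwalk_lin 1 (-1) (fun z => phi (y + z *: v) - phi y) (fun z => b * z + (2^-1 * h) * z ^+ 2) k 0.
  rewrite (rwalk_lin b (2^-1 * h) id (fun z => z ^+ 2)) rwalk_sq rwalk_id.
  have := rwalk_lin 1 (-1) (fun z => phi (y + z *: v)) (fun z => phi y) k 0.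
  rewrite rwalk_cst -iter_walk0 => e1.
  rewrite (_ : iter k rwalk (fun z => phi (y + z *: v) - phi y) 0 = iter k (walk v) phi y - phi y); last first.
    transitivity (1 * iter k (walk v) phi y + -1 * phi y); last by ring.
    by rewrite -e1; congr (iter _ _ _ _); apply/funext => z; ring.
  move=> e2; transitivity (1 * (iter k (walk v) phi y - phi y) + -1 * (b * 0 + 2^-1 * h * (0 ^+ 2 + r))); first by ring.
  by rewrite -e2; congr (iter _ _ _ _); apply/funext => z; ring.
apply: le_trans (rwalk_norm _ _ _) _.
apply: (@le_trans _ _ (iter k rwalk (fun z => (K * r `^ (1 + a / 2)) * 1 + (K * r `^ (a / 2 - 1)) * z ^+ 4) 0)).
  apply: rwalk_le => z; apply: le_trans (hK z) _.
  rewrite mulr1 -mulrA -mulrDr; apply: ler_wpM2l => //.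
  have -> : `|z| `^ (2 + a) = z ^+ 2 * (z ^+ 2) `^ (a / 2).
    rewrite powRD ?powR_mulrn// ?real_normK ?num_real//; last first.
      by apply/implyP => /eqP ?; exfalso; lra.
    congr (_ * _); rewrite -(real_normK (num_real z)) -powR_mulrn// -powRrM.
    by congr (_ `^ _); field.
  have e1 : r `^ (1 + a / 2) = r * r `^ (a / 2) by exact: powR1D.
  have q0 := powR_ge0 r (a / 2 - 1).
  have z0 : 0 <= z ^+ 2 by rewrite sqr_ge0.
  have z4 : z ^+ 4 = (z ^+ 2) ^+ 2 by rewrite -exprM.
  rewrite e1; have [zr|rz] := leP (z ^+ 2) r.
    rewrite -[leLHS]addr0; apply: lerD; last by rewrite z4 mulr_ge0// sqr_ge0.
    apply: ler_pM => //; first exact: powR_ge0.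
    by apply: ge0_ler_powR => //; [case/andP: b01|rewrite nnegrE ltW].
  rewrite -[leLHS]add0r; apply: lerD; first by rewrite mulr_ge0 ?powR_ge0 ?ltW.
  rewrite z4 expr2 mulrCA ler_wpM2l//.
  have rz0 : 0 < z ^+ 2 by exact: lt_trans rz.
  rewrite -(powRB1M (a / 2) rz0) mulrC [_ * z ^+ 2]mulrC ler_wpM2l//.
  by apply: powR_pred_le => //; [exact: ltW|case/andP: b01].
rewrite rwalk_lin rwalk_cst rwalk_quartic -/r !mulr1 expr0n/= expr0n/=.
have -> : r `^ (1 + a / 2) = r `^ (a / 2 - 1) * r ^+ 2.
  by rewrite powR1D// -powRB1M// expr2; ring.
have q0 := powR_ge0 r (a / 2 - 1).
have := mulr_ge0 (mulr_ge0 K0 q0) (ltW r0).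
nra.
Qed.

End Walk.

Section WalkRefinement.
Context {R : realType} {V : normedModType R}.
Implicit Types (phi psi : V -> R) (v d y : V) (k : nat) (M K : R).

Definition nonexp (A : (V -> R) -> V -> R) := forall phi psi e,
  bnd (fun y => phi y - psi y) e -> bnd (fun y => A phi y - A psi y) e.

Lemma nonexp_iter k A : nonexp A -> nonexp (iter k A).
Proof. by move=> hA; elim: k => // k IH phi psi e /IH /hA. Qed.

Lemma nonexp_walk v : nonexp (walk v).
Proof.
move=> phi psi e h y; have := iter_walk_bnd 1 v h y.
rewrite (_ : (fun y => _ - _) = (fun z => 1 * phi z + -1 * psi z)); last first.
  by apply/funext => z; ring.
by rewrite iter_walk_lin mul1r mulN1r.
Qed.

Lemma iter_telescope (A B : (V -> R) -> V -> R) phi e k :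
  nonexp A -> nonexp B -> (forall psi, A (B psi) = B (A psi)) ->
  bnd (fun y => A phi y - B phi y) e ->
  bnd (fun y => iter k A phi y - iter k B phi y) (k%:R * e).
Proof.
move=> hA hB AB; elim: k phi => [|k IH] phi h y.
  by rewrite /= subrr normr0 mul0r.
rewrite !iterSr -natr1 mulrDl mul1r [_ + e]addrC.
rewrite -(subrKA (iter k A (B phi) y)).
apply: le_trans (ler_normD _ _) _; apply: lerD.
  by apply: nonexp_iter.
by apply: IH => {}y; rewrite AB; exact: hB.
Qed.

Lemma iter_walk_sub k v phi psi y :
  iter k (walk v) (fun z => phi z - psi z) y = iter k (walk v) phi y - iter k (walk v) psi y.
Proof.
rewrite (_ : (fun y => _ - _) = (fun z => 1 * phi z + -1 * psi z)); last first.
  by apply/funext => z; ring.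
by rewrite iter_walk_lin mul1r mulN1r.
Qed.

(* With [W = walk v] and [S = sdif v], [S ^ 2 = W ^ 2 - 1] and
   [walk (2 v) = 2 W ^ 2 - 1], so that
   [W ^ 8 - walk (2 v) ^ 2 = (W ^ 4 + 2 W ^ 2 - 1) S ^ 4]. *)
Lemma walk_double_defect v psi y :
  let X := sdif v (sdif v (sdif v (sdif v psi))) in
  iter 8 (walk v) psi y - iter 2 (walk (v + v)) psi y =
  iter 4 (walk v) X y + 2 * iter 2 (walk v) X y - X y.
Proof.
have E1 f z : sdif v (sdif v f) z = iter 2 (walk v) f z - f z.
  by rewrite /= /sdif /walk addrK subrK; field.
have E2 f z : walk (v + v) f z = 2 * iter 2 (walk v) f z - f z.
  by rewrite /= /walk addrK subrK opprD !addrA; field.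
pose W k := iter k (walk v) psi.
have XE z : sdif v (sdif v (sdif v (sdif v psi))) z = W 4 z - W 2 z - (W 2 z - psi z).
  rewrite E1 (_ : sdif v (sdif v psi) = fun z => W 2 z - psi z).
    by rewrite iter_walk_sub.
  by apply/funext => t; rewrite E1.
move=> X; have IX k : iter k (walk v) X y = W (k + 4)%N y - W (k + 2)%N y - (W (k + 2)%N y - W k y).
  rewrite (_ : X = fun z => W 4 z - W 2 z - (W 2 z - psi z)).
    by rewrite !iter_walk_sub /W !iterD.
  by apply/funext => z; exact: XE.
rewrite [X in _ - X](_ : _ = 4 * W 4 y - 4 * W 2 y + W 0 y); last first.
  rewrite [LHS]/= E2.
  rewrite (_ : walk (v + v) psi = fun z => 2 * W 2 z + -1 * psi z); last first.
    by apply/funext => z; rewrite E2 mulN1r.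
  by rewrite iter_walk_lin -/(W 2) /W -iterD /=; ring.
by rewrite !IX [X y]XE /W /=; ring.
Qed.

Lemma iter_walk_refine a phi M K v k q : 0 < a <= 2 -> bnd phi M -> hol a phi K ->
  bnd (fun y => iter (k * 8) (walk v) phi y - iter (k * 2) (walk (v + v)) phi y)
    (4 * K * (`|v| ^+ 2 * (4 * q)%:R) `^ (a / 2) + k%:R * (4 * (M / q.+1%:R ^+ 2))).
Proof.
move=> a02 bM hK y.
pose psi := iter (4 * q) (walk v) phi.
have s0 : 0 <= q.+1%:R :> R by rewrite ler0n.
pose s : R := Num.sqrt q.+1%:R.
pose X j := iter j (fun f => iter q (walk v) (sdif v f)) phi.
have bX j : bnd (X j) (M / s ^+ j).
  elim: j => [|j IH]; first by move=> z; rewrite expr0 divr1; exact: bM.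
  by rewrite exprSr invfM mulrA; exact: iter_walk_sdif_bnd.
have XE : sdif v (sdif v (sdif v (sdif v psi))) = X 4.
  have c k' f : iter k' (walk v) (sdif v f) = sdif v (iter k' (walk v) f).
    by apply/funext => z; rewrite iter_walk_sdif.
  rewrite /X /psi /= !c -!iterD; congr (sdif _ (sdif _ (sdif _ (sdif _ (iter _ _ _))))).
  by rewrite !mulSn addn0 !addnA.
have b4 : bnd (X 4) (M / q.+1%:R ^+ 2).
  have := bX 4; rewrite (exprM s 2 2) /s sqr_sqrtr//.
have step : bnd (fun y => iter 8 (walk v) psi y - iter 2 (walk (v + v)) psi y) (4 * (M / q.+1%:R ^+ 2)).
  move=> z; rewrite walk_double_defect XE.
  move: b4; set m := M / _ => b4.
  have := iter_walk_bnd 4 v b4 z; have := iter_walk_bnd 2 v b4 z; have := b4 z.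
  rewrite !ler_norml => /andP[? ?] /andP[? ?] /andP[? ?]; apply/andP; split; lra.
have tel : bnd (fun y => iter k (iter 8 (walk v)) psi y - iter k (iter 2 (walk (v + v))) psi y)
    (k%:R * (4 * (M / q.+1%:R ^+ 2))).
  apply: iter_telescope => //; try by apply: nonexp_iter; exact: nonexp_walk.
  by move=> f; apply/funext => z; rewrite iter_walkC.
have mom := iter_walk_moment (4 * q) v a02 hK.
rewrite !iterM.
have t1 : `|iter k (iter 8 (walk v)) psi y - iter k (iter 8 (walk v)) phi y| <= 2 * K * (`|v| ^+ 2 * (4 * q)%:R) `^ (a / 2).
  exact: (@nonexp_iter k _ (@nonexp_iter 8 _ (nonexp_walk v)) _ _ _ mom).
have t2 : `|iter k (iter 2 (walk (v + v))) psi y - iter k (iter 2 (walk (v + v))) phi y| <= 2 * K * (`|v| ^+ 2 * (4 * q)%:R) `^ (a / 2).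
  exact: (@nonexp_iter k _ (@nonexp_iter 2 _ (nonexp_walk _)) _ _ _ mom).
have t3 := tel y.
set m := M / _ in t3 *; set p := _ `^ _ in t1 t2 *.
move: t1 t2 t3; rewrite !ler_norml => /andP[? ?] /andP[? ?] /andP[? ?]; apply/andP; split; lra.
Qed.

End WalkRefinement.

Section Limits.
Context {R : realType}.

Lemma geo_cvg (x : nat -> R) B rho : 0 <= rho < 1 ->
  (forall n, `|x n.+1 - x n| <= B * rho ^+ n) ->
  cvgn x /\ forall n, `|x n - limn x| <= B * rho ^+ n / (1 - rho).
Proof.
move=> /andP[r0 r1] h.
have B0 : 0 <= B by have := le_trans (normr_ge0 _) (h 0%N); rewrite expr0 mulr1.
have cx : cvgn x.
  rewrite (_ : x = fun n => x 0%N + series (telescope x) n); last first.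
    by apply/funext => n; rewrite -eq_sum_telescope.
  apply: is_cvgD; first exact: is_cvg_cst.
  apply: normed_cvg.
  apply: (@series_le_cvg _ _ (geometric B rho)) => [n|n|n|].
  - exact: normr_ge0.
  - exact: geometric_ge0.
  - exact: h.
  - by apply: is_cvg_geometric_series; rewrite ger0_norm.
split=> // n.
have d0 : 0 < 1 - rho by rewrite subr_gt0.
have hm m : `|x n - x (m + n)%N| <= B * rho ^+ n * (1 - rho ^+ m) / (1 - rho).
  elim: m => [|m IH]; first by rewrite add0n !subrr normr0 mulr0 mul0r.
  rewrite -(subrKA (x (m + n)%N)); apply: le_trans (ler_normD _ _) _.
  apply: le_trans (lerD IH (_ : _ <= B * rho ^+ (m + n))) _.
    by rewrite distrC addSn.
  rewrite le_eqVlt exprD exprS; apply/orP; left; apply/eqP; field.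
  by rewrite gt_eqF.
have cxn : (fun m => `|x n - x (m + n)%N|) @ \oo --> `|x n - limn x|.
  apply: cvg_norm; apply: cvgB; first exact: cvg_cst.
  by rewrite (cvg_shiftn n x).
apply: (ler_cvg_to cxn (@cvg_cst _ _ _ _ _)).
near=> m; apply: le_trans (hm m) _; rewrite ler_pM2r ?invr_gt0//.
rewrite ler_piMr ?mulr_ge0 ?exprn_ge0//.
by rewrite gerBl exprn_ge0.
Unshelve. all: by end_near. Qed.

Lemma le_limP (x : nat -> R) l c (e : nat -> R) :
  x @ \oo --> l -> e @ \oo --> 0 -> (forall n, x n <= c + e n) -> l <= c.
Proof.
move=> xl e0 h.
have ce : (fun n => c + e n) @ \oo --> c.
  by rewrite -[X in _ --> X]addr0; apply: cvgD => //; exact: cvg_cst.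
by apply: (ler_cvg_to xl ce); near=> n; exact: h.
Unshelve. all: by end_near. Qed.

Lemma norm_lim_le (x : nat -> R) l c (e : nat -> R) :
  x @ \oo --> l -> e @ \oo --> 0 -> (forall n, `|x n| <= c + e n) -> `|l| <= c.
Proof.
by move=> xl e0 h; apply: (le_limP (x := fun n => `|x n|)) e0 h; exact: cvg_norm.
Qed.

Lemma norm_lim_le0 (x : nat -> R) l c :
  x @ \oo --> l -> (forall n, `|x n| <= c) -> `|l| <= c.
Proof.
move=> xl h; apply: (norm_lim_le xl (cvg_cst 0)) => n.
by rewrite addr0.
Qed.

Lemma cvg_norm_le (x : nat -> R) l (e : nat -> R) :
  e @ \oo --> 0 -> (forall n, `|x n - l| <= e n) -> x @ \oo --> l.
Proof.
move=> e0 h; apply/subr_cvg0; apply/norm_cvg0P.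
apply: (squeeze_cvgr _ (cvg_cst 0) e0).
by near=> n; rewrite normr_ge0 /=; exact: h.
Unshelve. all: by end_near. Qed.

Lemma cvg_geo (B rho : R) : 0 <= rho < 1 -> (fun n => B * rho ^+ n) @ \oo --> 0.
Proof.
by move=> /andP[r0 r1]; apply: cvg_geometric; rewrite ger0_norm.
Qed.

Lemma norm_eq0P (x : R) (e : nat -> R) :
  e @ \oo --> 0 -> (forall n, `|x| <= e n) -> x = 0.
Proof.
move=> e0 h; apply/eqP; rewrite -normr_le0.
by apply: (norm_lim_le (cvg_cst x) e0) => n; rewrite add0r.
Qed.

End Limits.

(** * Heat operators and evolution families *)

Lemma nat_split8 k k' : (k * 4 <= k' -> k' * 2 = k * 8 + (k' - k * 4) * 2)%N.
Proof. lia. Qed.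

Lemma nat_between m l : (m <= l -> l <= m + 1 -> l = m \/ l = m + 1)%N.
Proof. lia. Qed.

Section Heat.
Context {R : realType} {V : normedModType R} (a : R) (a01 : 0 < a < 1).
Implicit Types (phi psi : V -> R) (v d y : V) (k n : nat) (M K s t : R).

Definition reg phi := exists M K, [/\ 0 <= M, 0 <= K, bnd phi M & hol a phi K].

Definition heatn n d s phi :=
  iter (Num.truncn (s * 4 ^+ n) * 2) (walk (2^-1 ^+ n *: d)) phi.

(* The operator [exp (s D_d^2)], where [D_d] is the derivative in direction [d]:
   the walk in [heatn] has variance 2 s. *)
Definition heat d s phi y : R := limn (fun n => heatn n d s phi y).

Let rho : R := (3 / 4) `^ (a / 2).

Let a02 : 0 < a <= 2. Proof. by case/andP: a01 => ? ?; apply/andP; split; lra. Qed.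

Let a2_ge0 : 0 <= a / 2. Proof. by case/andP: a01 => ? ?; lra. Qed.

Let rho01 : 0 <= rho < 1.
Proof.
rewrite powR_ge0 /= /rho; case/andP: a01 => a0 _.
by apply: powR_lt1; [apply/andP; split|]; lra.
Qed.

Let rho_ge : 3 / 4 <= rho.
Proof.
by rewrite /rho; apply: ger1_powR; [apply/andP; split; lra | case/andP: a01 => ? ?; lra].
Qed.

Let truncn_norm s : (Num.truncn s)%:R <= `|s|.
Proof.
have [s0|s0] := leP 0 s; first by rewrite ger0_norm// truncn_le.
rewrite (_ : Num.truncn s = 0%N) ?normr_ge0//.
apply/truncn0Pn; rewrite -ltNge; lra.
Qed.

Definition heat_const d s M K : R :=
  4 * K * (`|d| ^+ 2) `^ (a / 2) + 2 * K * (2 * `|d| ^+ 2) `^ (a / 2) + 4 * `|s| * M.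

Lemma heatn_step n d s phi M K : 0 <= K -> bnd phi M -> hol a phi K ->
  bnd (fun y => heatn n.+1 d s phi y - heatn n d s phi y) (heat_const d s M K * rho ^+ n).
Proof.
move=> K0 bM hK y.
have M0 : 0 <= M by exact: le_trans (bM 0).
pose v := 2^-1 ^+ n.+1 *: d.
have v2 : 2^-1 ^+ n *: d = v + v.
  by rewrite /v -scalerDl exprS; congr (_ *: _); field.
pose k := Num.truncn (s * 4 ^+ n); pose k' := Num.truncn (s * 4 ^+ n.+1).
have [k4 k4'] : (k * 4 <= k')%N /\ (k' <= k * 4 + 3)%N.
  have [s0|s0] := leP 0 s; last first.
    have -> : k = 0%N by apply/truncn0Pn; rewrite -ltNge (lt_trans _ (ltr01))// nmulr_rlt0// exprn_gt0.
    have -> // : k' = 0%N by apply/truncn0Pn; rewrite -ltNge (lt_trans _ (ltr01))// nmulr_rlt0// exprn_gt0.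
  have x0 : 0 <= s * 4 ^+ n by rewrite mulr_ge0 ?exprn_ge0.
  have x1 : 0 <= s * 4 ^+ n.+1 by rewrite mulr_ge0 ?exprn_ge0.
  have e : s * 4 ^+ n.+1 = s * 4 ^+ n * 4 by rewrite exprSr mulrA.
  have /andP[h1 h2] := truncn_itv x0; rewrite -/k in h1 h2.
  split; first by rewrite truncn_ge_nat// natrM e ler_pM2r.
  rewrite -ltnS truncn_lt_nat// e (_ : (k * 4 + 3).+1 = k.+1 * 4)%N; last by rewrite -addnS addnC mulSn.
  by rewrite natrM ltr_pM2r.
pose i := (k' - k * 4)%N.
have k'E : (k' * 2 = k * 8 + i * 2)%N.
  exact: nat_split8.
have i3 : (i <= 3)%N by rewrite /i leq_subLR.
have vE : `|v| ^+ 2 = `|d| ^+ 2 * (4^-1 * 4^-1 ^+ n).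
  rewrite /v normrZ normrX gtr0_norm ?invr_gt0// exprMn mulrC; congr (_ * _).
  by rewrite -exprM mulnC exprM exprS; congr (_ * _ ^+ n); field.
have q34 : (3 / 4 : R) ^+ n = 3 ^+ n * 4^-1 ^+ n by rewrite exprMn.
have rhoE : ((3 / 4 : R) ^+ n) `^ (a / 2) = rho ^+ n.
  by rewrite powR_exprn// divr_ge0.
have T1 : `|heatn n.+1 d s phi y - iter (k * 8) (walk v) phi y| <=
    2 * K * (2 * `|d| ^+ 2) `^ (a / 2) * rho ^+ n.
  rewrite /heatn -/k' -/v k'E iterD.
  apply: (@nonexp_iter _ _ _ _ (nonexp_walk v)) => z.
  apply: le_trans (iter_walk_moment _ _ a02 hK z) _.
  rewrite -[leRHS]mulrA; apply: ler_wpM2l; first by rewrite mulr_ge0.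
  rewrite -rhoE -powRM ?mulr_ge0 ?exprn_ge0 ?divr_ge0//.
  apply: ge0_ler_powR => //; rewrite ?nnegrE ?mulr_ge0 ?exprn_ge0 ?divr_ge0//.
  rewrite vE -[leLHS]mulrA [2 * _]mulrC -[leRHS]mulrA; apply: ler_wpM2l; first exact: exprn_ge0.
  have : (i * 2)%:R <= 6 :> R by rewrite (ler_nat R _ (3 * 2)%N) leq_mul2r i3 orbT.
  have : (4^-1 : R) ^+ n <= (3 / 4) ^+ n by apply: lerXn2r; rewrite ?nnegrE//; lra.
  have : 0 <= (4^-1 : R) ^+ n by rewrite exprn_ge0.
  move: ((i * 2)%:R) (4^-1 ^+ n) ((3 / 4) ^+ n) => I p q p0 pq I6; nra.
have T2 := iter_walk_refine v k (3 ^ n) a02 bM hK y; move: T2.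
have -> : `|v| ^+ 2 * (4 * 3 ^ n)%:R = `|d| ^+ 2 * (3 / 4) ^+ n.
  by rewrite vE q34 natrM natrX; field.
rewrite powRM ?exprn_ge0 ?divr_ge0// rhoE => T2.
have T3 : k%:R * (4 * (M / (3 ^ n).+1%:R ^+ 2)) <= 4 * `|s| * M * rho ^+ n.
  have h1 : k%:R <= `|s| * 4 ^+ n.
    by apply: le_trans (truncn_norm _) _; rewrite normrM normrX (ger0_norm (ler0n R 4)).
  have h2 : ((3 ^ n).+1%:R ^+ 2)^-1 <= 9^-1 ^+ n :> R.
    rewrite exprVn lef_pV2 ?posrE ?exprn_gt0 ?ltr0n//.
    rewrite -[9]/((3 ^ 2)%:R) natrX exprAC lerXn2r ?nnegrE ?exprn_ge0//.
    by rewrite -natrX ler_nat.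
  have h3 : (4 : R) ^+ n * 9^-1 ^+ n <= rho ^+ n.
    rewrite -exprMn; apply: lerXn2r; rewrite ?nnegrE ?divr_ge0//.
      by case/andP: rho01.
    by apply: le_trans rho_ge; lra.
  apply: le_trans (_ : `|s| * 4 ^+ n * (4 * (M * 9^-1 ^+ n)) <= _).
    apply: ler_pM => //; rewrite ?ler_wpM2l// !mulr_ge0// invr_ge0 exprn_ge0//.
  rewrite (_ : _ * _ = 4 * `|s| * M * (4 ^+ n * 9^-1 ^+ n)); last by ring.
  by apply: ler_wpM2l => //; rewrite !mulr_ge0.
have -> : heatn n.+1 d s phi y - heatn n d s phi y =
  (heatn n.+1 d s phi y - iter (k * 8) (walk v) phi y) +
  (iter (k * 8) (walk v) phi y - iter (k * 2) (walk (v + v)) phi y).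
  by rewrite {2}/heatn -/k v2; ring.
apply: le_trans (ler_normD _ _) _; apply: le_trans (lerD T1 T2) _.
have -> : heat_const d s M K * rho ^+ n = 2 * K * (2 * `|d| ^+ 2) `^ (a / 2) * rho ^+ n +
    (4 * K * ((`|d| ^+ 2) `^ (a / 2) * rho ^+ n) + 4 * `|s| * M * rho ^+ n).
  by rewrite /heat_const; ring.
by rewrite lerD2l lerD2l.
Qed.

Lemma heatn_cvg n d s phi M K : 0 <= K -> bnd phi M -> hol a phi K ->
  bnd (fun y => heatn n d s phi y - heat d s phi y) (heat_const d s M K / (1 - rho) * rho ^+ n).
Proof.
move=> K0 bM hK y.
have [_] := @geo_cvg _ (fun n => heatn n d s phi y) _ _ rho01
  (fun n => heatn_step n d s K0 bM hK y).
by move=> /(_ n); rewrite mulrAC.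
Qed.

Lemma heatn_cvg_uniform d s phi : reg phi ->
  exists2 e : nat -> R, e @ \oo --> 0 &
    forall n, bnd (fun y => heatn n d s phi y - heat d s phi y) (e n).
Proof.
move=> [M [K [M0 K0 bM hK]]].
exists (fun n => heat_const d s M K / (1 - rho) * rho ^+ n); first exact: cvg_geo.
by move=> n; exact: heatn_cvg.
Qed.

Lemma heatn_to d s phi y : reg phi -> heatn n d s phi y @[n --> \oo] --> heat d s phi y.
Proof.
move=> /(heatn_cvg_uniform d s)[e e0 h]; apply: (cvg_norm_le e0) => n; exact: h.
Qed.

Lemma heatn_bnd n d s phi M : bnd phi M -> bnd (heatn n d s phi) M.
Proof. exact: iter_walk_bnd. Qed.

Lemma heat_bnd d s phi M : reg phi -> bnd phi M -> bnd (heat d s phi) M.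
Proof.
by move=> rp bM y; apply: (norm_lim_le0 (@heatn_to d s _ y rp)) => n; exact: heatn_bnd.
Qed.

Lemma reg_lin b c phi psi : reg phi -> reg psi -> reg (fun y => b * phi y + c * psi y).
Proof.
move=> [M [K [M0 K0 bM hK]]] [M' [K' [M0' K0' bM' hK']]].
exists (`|b| * M + `|c| * M'), (`|b| * K + `|c| * K').
have gen (f g : R) (F G : R) : `|f| <= F -> `|g| <= G -> `|b * f + c * g| <= `|b| * F + `|c| * G.
  move=> fF gG; apply: le_trans (ler_normD _ _) _; rewrite !normrM.
  by apply: lerD; apply: ler_wpM2l.
split; try by rewrite addr_ge0 ?mulr_ge0.
  by move=> y; exact: gen.
move=> v y; rewrite mulrDl -!mulrA.
rewrite (_ : dif _ _ _ = b * dif v phi y + c * dif v psi y); last by rewrite /dif; ring.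
by apply: gen; [exact: hK|exact: hK'].
Qed.

Lemma reg_shift v phi : reg phi -> reg (transl v phi).
Proof.
move=> [M [K [M0 K0 bM hK]]]; exists M, K; split=> //.
  by move=> y; exact: bM.
by move=> w y; rewrite /dif /transl addrAC; exact: hK.
Qed.

Lemma difE v phi : dif v phi = fun y => 1 * transl v phi y + -1 * phi y.
Proof. by apply/funext => y; rewrite /dif mul1r mulN1r. Qed.

Lemma reg_dif v phi : reg phi -> reg (dif v phi).
Proof. by move=> h; rewrite difE; apply: reg_lin => //; exact: reg_shift. Qed.

Lemma heat_lin d s b c phi psi y : reg phi -> reg psi ->
  heat d s (fun y => b * phi y + c * psi y) y = b * heat d s phi y + c * heat d s psi y.
Proof.
move=> rp rq; apply: cvg_lim => //.
rewrite (_ : (fun n => _) = fun n => b * heatn n d s phi y + c * heatn n d s psi y); last first.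
  by apply/funext => n; rewrite /heatn iter_walk_lin.
by apply: cvgD; apply: cvgM; try exact: cvg_cst; exact: heatn_to.
Qed.

Lemma heat_shift d s v phi y : reg phi -> heat d s (transl v phi) y = heat d s phi (y + v).
Proof.
move=> rp; apply: cvg_lim => //.
rewrite (_ : (fun n => _) = fun n => heatn n d s phi (y + v)); first exact: heatn_to.
apply/funext => n; rewrite /heatn.
elim: (_ * 2)%N y => // k IH y /=; rewrite /walk !IH.
by rewrite ![_ + v + _]addrAC.
Qed.

Lemma heat_dif d s v phi y : reg phi -> heat d s (dif v phi) y = dif v (heat d s phi) y.
Proof.
move=> rp; rewrite difE heat_lin ?heat_shift ?mul1r ?mulN1r//.
exact: reg_shift.
Qed.

Lemma heat_hol d s phi K : reg phi -> hol a phi K -> hol a (heat d s phi) K.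
Proof.
move=> rp hK v y; rewrite -heat_dif//; apply: heat_bnd; first exact: reg_dif.
exact: hK.
Qed.

Lemma reg_heat d s phi : reg phi -> reg (heat d s phi).
Proof.
move=> rp; have [M [K [M0 K0 bM hK]]] := rp; exists M, K; split=> //.
  exact: heat_bnd.
exact: heat_hol.
Qed.

Lemma heat_le0 d s phi : s <= 0 -> heat d s phi = phi.
Proof.
move=> s0; apply/funext => y; apply: cvg_lim => //.
rewrite (_ : (fun n => _) = fun=> phi y); first exact: cvg_cst.
apply/funext => n; rewrite /heatn (_ : Num.truncn _ = 0%N)//.
by apply/truncn0Pn; rewrite -ltNge (le_lt_trans _ (ltr01))// mulr_le0_ge0// exprn_ge0.
Qed.

Lemma heatn2_to d d' s s' phi y : reg phi ->
  heatn n d s (heatn n d' s' phi) y @[n --> \oo] --> heat d s (heat d' s' phi) y.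
Proof.
move=> rp; have [e e0 he] := heatn_cvg_uniform d' s' rp.
have [f f0 hf] := heatn_cvg_uniform d s (reg_heat d' s' rp).
apply: (@cvg_norm_le _ _ _ (fun n => e n + f n)).
  by rewrite -[X in _ --> X]addr0; apply: cvgD.
move=> n; rewrite -(subrKA (heatn n d s (heat d' s' phi) y)).
apply: le_trans (ler_normD _ _) _; apply: lerD; last exact: hf.
exact: (@nonexp_iter _ _ _ _ (nonexp_walk _) _ _ _ (he n)).
Qed.

Lemma heatC d d' s s' phi : reg phi ->
  heat d s (heat d' s' phi) = heat d' s' (heat d s phi).
Proof.
move=> rp; apply/funext => y.
apply: (@cvg_unique _ _ (heatn n d s (heatn n d' s' phi) y @[n --> \oo])) => //.
  exact: heatn2_to.
rewrite (_ : (fun n => _) = fun n => heatn n d' s' (heatn n d s phi) y).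
  exact: heatn2_to.
by apply/funext => n; rewrite /heatn iter_walkC.
Qed.

Lemma cvg_walk_moment d K c : 0 <= c -> (fun n => 2 * K * (`|2^-1 ^+ n *: d| ^+ 2 * c) `^ (a / 2)) @ \oo --> 0.
Proof.
move=> c0.
pose r : R := (4^-1) `^ (a / 2).
rewrite (_ : (fun n => _) = fun n => (2 * K * (`|d| ^+ 2 * c) `^ (a / 2)) * r ^+ n).
  apply: cvg_geo; rewrite powR_ge0 /= /r; case/andP: a01 => a0 _.
  by apply: powR_lt1; [apply/andP; split|]; lra.
apply/funext => n; rewrite -[in RHS]mulrA; congr (_ * _).
rewrite /r -powR_exprn ?invr_ge0//.
rewrite -powRM ?mulr_ge0 ?exprn_ge0//; congr (_ `^ _).
rewrite normrZ normrX gtr0_norm ?invr_gt0// exprMn -exprM mulnC exprM.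
rewrite (_ : 2^-1 ^+ 2 = 4^-1 :> R); last by field.
by ring.
Qed.

Lemma heat_semi d s t phi : 0 <= s -> 0 <= t -> reg phi ->
  heat d s (heat d t phi) = heat d (s + t) phi.
Proof.
move=> s0 t0 rp; apply/funext => y; have [M [K [M0 K0 bM hK]]] := rp.
apply: (@cvg_unique _ _ (heatn n d s (heatn n d t phi) y @[n --> \oo])) => //.
  exact: heatn2_to.
suff : (heatn n d s (heatn n d t phi) y - heatn n d (s + t) phi y) @[n --> \oo] --> 0.
  have -> : (fun n => heatn n d s (heatn n d t phi) y) =
      (fun n => (heatn n d s (heatn n d t phi) y - heatn n d (s + t) phi y) + heatn n d (s + t) phi y).
    by apply/funext => n; rewrite subrK.
  move=> h; rewrite /= -[X in _ --> X]add0r; apply: cvgD => //; exact: heatn_to.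
apply: (cvg_norm_le (@cvg_walk_moment d K 2 (ler0n _ 2))) => n.
rewrite subr0 /heatn -iterD -mulnDl.
set k := Num.truncn _; set k' := Num.truncn _; set l := Num.truncn _.
have p0 : 0 <= 4 ^+ n :> R by rewrite exprn_ge0.
have x0 : 0 <= s * 4 ^+ n by rewrite mulr_ge0.
have x1 : 0 <= t * 4 ^+ n by rewrite mulr_ge0.
have x2 : 0 <= (s + t) * 4 ^+ n by rewrite mulr_ge0 ?addr_ge0.
have /andP[h1 h2] := truncn_itv x0; have /andP[h3 h4] := truncn_itv x1.
have lb : (k + k' <= l)%N by rewrite truncn_ge_nat// natrD mulrDl lerD.
have ub : (l <= k + k' + 1)%N.
  rewrite -ltnS truncn_lt_nat// -[(k + k' + 1).+1]addn1 !natrD mulrDl.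
  rewrite -(natr1 k) in h2; rewrite -(natr1 k') in h4; lra.
have [->|lk] : (l = k + k')%N \/ (l = k + k' + 1)%N by exact: nat_between.
  by rewrite subrr normr0 !mulr_ge0 ?powR_ge0.
rewrite lk [in X in _ - X]mulnDl iterD distrC.
apply: (@nonexp_iter _ _ _ _ (nonexp_walk _)) => z.
exact: (iter_walk_moment _ _ a02 hK z).
Qed.

Lemma heat_moment d s phi K : 0 <= s -> reg phi -> 0 <= K -> hol a phi K ->
  bnd (fun y => heat d s phi y - phi y) (2 * K * (2 * `|d| ^+ 2) `^ (a / 2) * s `^ (a / 2)).
Proof.
move=> s0 rp K0 hK y.
have h : heatn n d s phi y - phi y @[n --> \oo] --> heat d s phi y - phi y.
  by apply: cvgB; [exact: heatn_to|exact: cvg_cst].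
apply: (norm_lim_le0 h) => n.
apply: le_trans (iter_walk_moment _ _ a02 hK y) _.
rewrite -[leRHS]mulrA; apply: ler_wpM2l; first by rewrite mulr_ge0.
rewrite -powRM ?mulr_ge0 ?exprn_ge0//.
apply: ge0_ler_powR => //; rewrite ?nnegrE ?mulr_ge0 ?exprn_ge0//.
rewrite normrZ normrX gtr0_norm ?invr_gt0// exprMn -exprM mulnC exprM.
rewrite (_ : 2^-1 ^+ 2 = 4^-1 :> R); last by field.
have x0 : 0 <= s * 4 ^+ n by rewrite mulr_ge0 ?exprn_ge0.
have : (Num.truncn (s * 4 ^+ n))%:R <= s * 4 ^+ n by rewrite truncn_le.
rewrite natrM exprVn; have p0 : 0 < 4 ^+ n :> R by rewrite exprn_gt0.
move: (4 ^+ n) p0 => p p0; set k := _%:R => kx.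
rewrite [2 * _]mulrC -[leRHS]mulrA [_ * `|d| ^+ 2]mulrC -[leLHS]mulrA; apply: ler_wpM2l; first exact: exprn_ge0.
by rewrite [p^-1 * _]mulrC ler_pdivrMr// mulrC -mulrA ler_wpM2l.
Qed.

Lemma heat_smooth d s r phi M : 0 < s -> reg phi -> bnd phi M ->
  bnd (dif (r *: d) (heat d s phi)) (M * `|r| / Num.sqrt s).
Proof.
move=> s0 rp bM.
have ss0 : 0 < Num.sqrt s by rewrite sqrtr_gt0.
have M0 : 0 <= M by exact: le_trans (bM 0).
wlog r0 : r / 0 <= r.
  move=> hw; have [|r0] := leP 0 r; first exact: hw.
  move=> y; have r0' : 0 <= - r by lra.
  have := hw _ r0' (y + r *: d); rewrite /dif scaleNr addrK normrN distrC.
  by [].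
have [M' [K [M0' K0 bM' hK]]] := rp.
have hH := heat_hol d s rp hK.
move=> y.
(* the shift is rounded to the lattice of the approximating walk *)
pose j n := Num.truncn (r * 2 ^+ n / 2).
have jle n : (j n)%:R * (2 / 2 ^+ n) <= r.
  have : (j n)%:R <= r * 2 ^+ n / 2 by rewrite truncn_le !mulr_ge0 ?exprn_ge0.
  have p0 : 0 < 2 ^+ n :> R by rewrite exprn_gt0.
  by rewrite ler_pdivlMr// mulrA ler_pdivrMr.
have jge n : r <= (j n)%:R * (2 / 2 ^+ n) + 2 / 2 ^+ n.
  have : r * 2 ^+ n / 2 < (j n).+1%:R by rewrite truncnS_gt.
  have p0 : 0 < 2 ^+ n :> R by rewrite exprn_gt0.
  rewrite ltr_pdivrMr// -(natr1 (j n)) => /ltW h.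
  by rewrite -[X in _ + X]mul1r -mulrDl mulrA ler_pdivlMr.
have p2 n : 2^-1 ^+ n = (2 ^+ n)^-1 :> R by rewrite exprVn.
have B1 n : `|heatn n d s phi (y + ((j n)%:R * (2 / 2 ^+ n)) *: d) - heatn n d s phi y| <= M * `|r| / Num.sqrt s.
  set k := (Num.truncn (s * 4 ^+ n) * 2)%N.
  pose v := 2^-1 ^+ n *: d.
  have st z : `|heatn n d s phi (z + (v + v)) - heatn n d s phi z| <= 2 * (M / Num.sqrt k.+1%:R).
    have := iter_walk_sdif_bnd k v bM (z + v); rewrite iter_walk_sdif /sdif addrK -addrA.
    by rewrite normrM ger0_norm ?invr_ge0// [2^-1 * _]mulrC ler_pdivrMr// [_ * 2]mulrC.
  have ind m z : `|heatn n d s phi (z + m%:R *: (v + v)) - heatn n d s phi z| <= m%:R * (2 * (M / Num.sqrt k.+1%:R)).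
    elim: m => [|m IH]; first by rewrite scale0r addr0 subrr normr0 mul0r.
    rewrite -(natr1 m) scalerDl scale1r addrA -(subrKA (heatn n d s phi (z + m%:R *: (v + v)))).
    rewrite [leRHS]mulrDl mul1r [leRHS]addrC; apply: le_trans (ler_normD _ _) _.
    exact: lerD.
  have := ind (j n) y; rewrite (_ : (j n)%:R *: (v + v) = ((j n)%:R * (2 / 2 ^+ n)) *: d); last first.
    by rewrite /v -scalerDl scalerA p2; congr (_ *: _); congr (_ * _); ring.
  move=> h; apply: le_trans h _.
  have sk : Num.sqrt s * 2 ^+ n <= Num.sqrt k.+1%:R.
    have p0 : 0 <= 2 ^+ n :> R by rewrite exprn_ge0.
    rewrite -{1}[2 ^+ n](ger0_norm p0) -sqrtr_sqr -sqrtrM ?(ltW s0)//.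
    rewrite ler_wsqrtr//.
    have -> : (2 ^+ n) ^+ 2 = 4 ^+ n :> R by rewrite exprAC; congr (_ ^+ n); ring.
    apply: le_trans (ltW (truncnS_gt _)) _.
    by rewrite ler_nat ltnS /k leq_pmulr.
  have sk0 : 0 < Num.sqrt k.+1%:R :> R by rewrite sqrtr_gt0 ltr0n.
  have p0 : 0 < 2 ^+ n :> R by rewrite exprn_gt0.
  rewrite (ger0_norm r0).
  have -> : (j n)%:R * (2 * (M / Num.sqrt k.+1%:R)) = M * ((j n)%:R * (2 / 2 ^+ n)) * (2 ^+ n / Num.sqrt k.+1%:R).
    by field; rewrite !gt_eqF.
  apply: ler_pM; rewrite ?mulr_ge0 ?invr_ge0 ?(ltW p0) ?(ltW sk0) ?ler0n//.
    exact: ler_wpM2l.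
  by rewrite ler_pdivrMr// mulrC ler_pdivlMr// mulrC.
have [e e0 he] := heatn_cvg_uniform d s rp.
have e3 : (fun n => e n + e n + 2 * K * (`|2^-1 ^+ n *: d| ^+ 2 * 4) `^ (a / 2)) @ \oo --> 0.
  rewrite -[X in _ --> X]addr0; apply: cvgD; last exact: cvg_walk_moment.
  by rewrite -[X in _ --> X]addr0; apply: cvgD.
apply: (norm_lim_le (cvg_cst _) e3) => n.
pose w : R := (j n)%:R * (2 / 2 ^+ n).
have B2 : `|heat d s phi (y + r *: d) - heat d s phi (y + w *: d)| <= 2 * K * (`|2^-1 ^+ n *: d| ^+ 2 * 4) `^ (a / 2).
  have := hH ((r - w) *: d) (y + w *: d); rewrite /dif -addrA -scalerDl (addrC w) subrK.
  move=> h; apply: le_trans h _.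
  rewrite [2 * K]mulrC -mulrA; apply: ler_wpM2l => //.
  apply: (@le_trans _ _ ((`|2^-1 ^+ n *: d| ^+ 2 * 4) `^ (a / 2))).
    have -> : `|2^-1 ^+ n *: d| ^+ 2 * 4 = (2 * `|2^-1 ^+ n *: d|) ^+ 2 by ring.
    rewrite powR_half_sq ?mulr_ge0//.
    apply: ge0_ler_powR; rewrite ?nnegrE ?mulr_ge0//; first by case/andP: a01 => /ltW.
    rewrite !normrZ mulrA; apply: ler_wpM2r => //.
    rewrite ger0_norm ?subr_ge0 ?jle// ger0_norm ?exprn_ge0 ?invr_ge0// p2.
    by rewrite lerBlDl; exact: jge.
  by rewrite ler_peMl ?powR_ge0// ler1n.
have := B1 n; have := he n y; have := he n (y + w *: d); move: B2.
rewrite -/w /dif; move: (M * `|r| / Num.sqrt s) (2 * K * _) (e n) => A1 A2 A3.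
rewrite !ler_norml => /andP[? ?] /andP[? ?] /andP[? ?] /andP[? ?]; apply/andP; split; lra.
Qed.

Lemma heat_taylor d s phi K y b h : 0 <= s -> reg phi -> 0 <= K ->
  (forall r, `|phi (y + r *: d) - phi y - r * b - 2^-1 * r ^+ 2 * h| <= K * `|r| `^ (2 + a)) ->
  `|heat d s phi y - phi y - s * h| <= 4 * K * (2 * s) `^ (1 + a / 2).
Proof.
move=> s0 rp K0 hK.
pose k n := (Num.truncn (s * 4 ^+ n) * 2)%N.
have ks n : (k n)%:R * 4^-1 ^+ n <= 2 * s.
  rewrite /k natrM exprVn ler_pdivrMr ?exprn_gt0// mulrAC -mulrA mulrC.
  have : (Num.truncn (s * 4 ^+ n))%:R <= s * 4 ^+ n by rewrite truncn_le mulr_ge0 ?exprn_ge0.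
  lra.
have ks' n : 2 * s <= (k n)%:R * 4^-1 ^+ n + 2 * 4^-1 ^+ n.
  rewrite -mulrDl /k natrM exprVn ler_pdivlMr ?exprn_gt0//.
  by have := truncnS_gt (s * 4 ^+ n); rewrite -(natr1 (Num.truncn _)); lra.
have q4 n : (2^-1 ^+ n) ^+ 2 = 4^-1 ^+ n :> R.
  by rewrite exprAC; congr (_ ^+ n); field.
have t0 n : 0 <= 2^-1 ^+ n :> R by rewrite exprn_ge0 ?invr_ge0.
have c1 : heatn n d s phi y - phi y - s * h @[n --> \oo] --> heat d s phi y - phi y - s * h.
  by apply: cvgB; [apply: cvgB; [exact: heatn_to|exact: cvg_cst]|exact: cvg_cst].
have c2 : (fun n => `|h| * 4^-1 ^+ n) @ \oo --> 0 by apply: cvg_geo; apply/andP; split; lra.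
apply: (norm_lim_le c1 c2) => n.
have hv r : `|phi (y + r *: (2^-1 ^+ n *: d)) - phi y - r * (2^-1 ^+ n * b) - 2^-1 * r ^+ 2 * (4^-1 ^+ n * h)|
    <= K * (2^-1 ^+ n) `^ (2 + a) * `|r| `^ (2 + a).
  have := hK (r * 2^-1 ^+ n); rewrite scalerA normrM (ger0_norm (t0 n)) powRM//.
  by rewrite exprMn q4 !mulrA; congr (`|_| <= _); ring.
have K0' : 0 <= K * (2^-1 ^+ n) `^ (2 + a) by rewrite mulr_ge0 ?powR_ge0.
have := iter_walk_taylor (k n) a02 K0' hv; rewrite -/(heatn n d s phi) => H.
have {H} H : `|heatn n d s phi y - phi y - 2^-1 * (k n)%:R * (4^-1 ^+ n * h)| <= 4 * K * (2 * s) `^ (1 + a / 2).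
  apply: le_trans H _; rewrite -!mulrA; do 2 (apply: ler_wpM2l => //).
  have -> : (2^-1 ^+ n) `^ (2 + a) = (4^-1 ^+ n) `^ (1 + a / 2) :> R.
    by rewrite -q4 -powR_half_sq//; congr (_ `^ _); field.
  rewrite -powRM ?exprn_ge0//; apply: ge0_ler_powR.
  - by rewrite addr_ge0.
  - by rewrite nnegrE mulr_ge0 ?exprn_ge0.
  - by rewrite nnegrE mulr_ge0.
  - by rewrite mulrC.
have E : `|2^-1 * (k n)%:R * (4^-1 ^+ n * h) - s * h| <= `|h| * 4^-1 ^+ n.
  rewrite (_ : _ - _ = h * (2^-1 * ((k n)%:R * 4^-1 ^+ n) - s)); last by ring.
  rewrite normrM ler_wpM2l// ler_norml; have := ks n; have := ks' n.
  have : 0 <= 4^-1 ^+ n :> R by rewrite exprn_ge0.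
  by move=> *; apply/andP; split; lra.
rewrite -(subrKA (2^-1 * (k n)%:R * (4^-1 ^+ n * h))).
by apply: le_trans (ler_normD _ _) _; exact: lerD.
Qed.

End Heat.

Section Evolution.
Context {R : realType} {V : normedModType R} (a : R).
Implicit Types (phi psi : V -> R) (v y : V) (M K s t r : R).

(* [P t s] carries terminal data at time [s] back to time [t <= s]. *)
Record evolution (P : R -> R -> (V -> R) -> V -> R) (C1 C2 : R) : Prop := {
  ev_C1 : 0 <= C1;
  ev_C2 : 0 <= C2;
  ev_bnd : forall t s phi M, reg a phi -> bnd phi M -> bnd (P t s phi) M;
  ev_lin : forall t s b c phi psi, reg a phi -> reg a psi ->
    P t s (fun y => b * phi y + c * psi y) = fun y => b * P t s phi y + c * P t s psi y;
  ev_shift : forall t s v phi, reg a phi -> P t s (transl v phi) = transl v (P t s phi);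
  ev_semi : forall t r s phi, t <= r -> r <= s -> reg a phi -> P t r (P r s phi) = P t s phi;
  ev_le : forall t s phi, s <= t -> P t s phi = phi;
  ev_smooth : forall t s v phi M, t < s -> reg a phi -> bnd phi M ->
    bnd (dif v (P t s phi)) (C1 * M * `|v| / Num.sqrt (s - t));
  ev_moment : forall t s phi K, t <= s -> reg a phi -> 0 <= K -> hol a phi K ->
    bnd (fun y => P t s phi y - phi y) (C2 * K * (s - t) `^ (a / 2)) }.

End Evolution.

Section Flow.
Context {R : realType} {V : normedModType R} (a : R) (a01 : 0 < a < 1).
Context {J : finType} (d : J -> V) (S : J -> R -> R) (L : R) (L0 : 0 <= L).
Hypothesis S_incr : forall j t s, t <= s -> 0 <= S j s - S j t <= L * (s - t).
Implicit Types (phi psi : V -> R) (v y : V) (M K s t r : R) (js : seq J).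

Definition flow_seq js t s phi :=
  foldr (fun j f => heat (d j) (S j s - S j t) f) phi js.

Lemma flow_bnd js t s phi M : reg a phi -> bnd phi M ->
  reg a (flow_seq js t s phi) /\ bnd (flow_seq js t s phi) M.
Proof.
move=> rp bM; elim: js => [|j js [IH1 IH2]]; first by split.
by split=> /=; [exact: (reg_heat a01)|by apply: (heat_bnd a01)].
Qed.

Lemma reg_flow js t s phi : reg a phi -> reg a (flow_seq js t s phi).
Proof. by move=> rp; have [M [K [_ _ bM _]]] := rp; have [] := flow_bnd js t s rp bM. Qed.

Lemma flow_lin js t s b c phi psi : reg a phi -> reg a psi ->
  flow_seq js t s (fun y => b * phi y + c * psi y) =
  fun y => b * flow_seq js t s phi y + c * flow_seq js t s psi y.
Proof.
move=> rp rq; elim: js => [//|j js /= ->].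
by apply/funext => y; rewrite (heat_lin a01)//; exact: reg_flow.
Qed.

Lemma flow_shift js t s v phi : reg a phi ->
  flow_seq js t s (transl v phi) = transl v (flow_seq js t s phi).
Proof.
move=> rp; elim: js => [//|j js /= ->].
by apply/funext => y; rewrite (heat_shift a01)//; exact: reg_flow.
Qed.

Lemma flow_dif js t s v phi : reg a phi ->
  flow_seq js t s (dif v phi) = dif v (flow_seq js t s phi).
Proof.
move=> rp; rewrite difE flow_lin ?flow_shift ?difE//.
exact: reg_shift.
Qed.

Lemma flow_heat js t s d' r phi : reg a phi ->
  flow_seq js t s (heat d' r phi) = heat d' r (flow_seq js t s phi).
Proof.
move=> rp; elim: js => [//|j js /= ->].
by rewrite (heatC a01)//; exact: reg_flow.
Qed.

Lemma flow_semi js t r s phi : t <= r -> r <= s -> reg a phi ->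
  flow_seq js t r (flow_seq js r s phi) = flow_seq js t s phi.
Proof.
move=> tr rs rp; elim: js => [//|j js /= IH].
rewrite flow_heat; last exact: reg_flow.
rewrite IH (heat_semi a01).
- by congr (heat _ _ _); ring.
- by case/andP: (S_incr j tr).
- by case/andP: (S_incr j rs).
- exact: reg_flow.
Qed.

Lemma flow_le js t s phi : s <= t -> flow_seq js t s phi = phi.
Proof.
move=> st; elim: js => [//|j js /= ->]; apply: heat_le0.
by case/andP: (S_incr j st); rewrite subr_ge0 subr_le0.
Qed.

Lemma flow_hol js t s phi K : reg a phi -> hol a phi K -> hol a (flow_seq js t s phi) K.
Proof.
move=> rp hK v; rewrite -flow_dif//.
by have [] := flow_bnd js t s (reg_dif v rp) (hK v).
Qed.

Lemma flow_moment js : exists2 C : R, 0 <= C & forall t s phi K,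
  t <= s -> reg a phi -> 0 <= K -> hol a phi K ->
  bnd (fun y => flow_seq js t s phi y - phi y) (C * K * (s - t) `^ (a / 2)).
Proof.
have a20 : 0 <= a / 2 by case/andP: a01 => ? ?; lra.
elim: js => [|j js [C C0 IH]].
  by exists 0 => // t s phi K ts rp K0 hK y; rewrite /= subrr normr0 !mul0r.
pose C' := 2 * (2 * `|d j| ^+ 2) `^ (a / 2) * L `^ (a / 2).
have C'0 : 0 <= C' by rewrite !mulr_ge0 ?powR_ge0.
exists (C' + C); first exact: addr_ge0.
move=> t s phi K ts rp K0 hK y /=.
have /andP[S0 SL] := S_incr j ts.
have st0 : 0 <= s - t by rewrite subr_ge0.
rewrite -(subrKA (flow_seq js t s phi y)) 2!mulrDl.
apply: le_trans (ler_normD _ _) _; apply: lerD; last exact: IH.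
apply: le_trans (heat_moment a01 (d j) S0 (reg_flow js t s rp) K0 (@flow_hol js t s phi K rp hK) y) _.
rewrite /C' [leRHS](_ : _ = 2 * K * (2 * `|d j| ^+ 2) `^ (a / 2) * (L `^ (a / 2) * (s - t) `^ (a / 2))); last by ring.
apply: ler_wpM2l; first by rewrite !mulr_ge0 ?powR_ge0.
rewrite -powRM//; apply: ge0_ler_powR => //.
by rewrite nnegrE mulr_ge0.
Qed.

Lemma flow_smooth js j t s r phi M : j \in js -> 0 < S j s - S j t -> reg a phi -> bnd phi M ->
  bnd (dif (r *: d j) (flow_seq js t s phi)) (M * `|r| / Num.sqrt (S j s - S j t)).
Proof.
move=> + s0 rp bM; elim: js => [//|i js IH]; rewrite inE => /orP[/eqP <-|jjs] /=.
  apply: (heat_smooth a01) => //; first exact: reg_flow.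
  by have [] := flow_bnd js t s rp bM.
move=> y; rewrite -(heat_dif a01); last exact: reg_flow.
apply: (heat_bnd a01); last exact: IH.
by apply: reg_dif; exact: reg_flow.
Qed.

Lemma bnd_dif_sum (I : Type) (r : seq I) (w : I -> V) (B : I -> R) psi :
  (forall i, bnd (dif (w i) psi) (B i)) ->
  bnd (dif (\sum_(i <- r) w i) psi) (\sum_(i <- r) B i).
Proof.
move=> h; elim: r => [|i r IH] y.
  by rewrite !big_nil /dif addr0 subrr normr0.
rewrite !big_cons /dif addrA -(subrKA (psi (y + w i))) [leRHS]addrC.
apply: le_trans (ler_normD _ _) _; apply: lerD; first exact: IH.
exact: h.
Qed.

Lemma flow_taylor js : exists2 C : R, 0 <= C &
  forall t s phi (b h : J -> V -> R) K, t <= s -> reg a phi -> 0 <= K ->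
  (forall j y r, `|phi (y + r *: d j) - phi y - r * b j y - 2^-1 * r ^+ 2 * h j y|
     <= K * `|r| `^ (2 + a)) ->
  (forall j, reg a (h j)) -> (forall j, hol a (h j) K) ->
  bnd (fun y => flow_seq js t s phi y - phi y - \sum_(j <- js) (S j s - S j t) * h j y)
    (C * K * (s - t) `^ (1 + a / 2)).
Proof.
have a20 : 0 <= a / 2 by case/andP: a01 => ? ?; lra.
elim: js => [|j js [C C0 IH]].
  exists 0 => // t s phi b h K ts rp K0 _ _ _ y /=.
  by rewrite big_nil subrr subr0 normr0 !mul0r.
pose A1 := (size js)%:R * L * (2 * (2 * `|d j| ^+ 2) `^ (a / 2) * L `^ (a / 2)).
pose A2 := 4 * (2 * L) `^ (1 + a / 2).
have A10 : 0 <= A1 by rewrite !mulr_ge0 ?powR_ge0.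
have A20 : 0 <= A2 by rewrite !mulr_ge0 ?powR_ge0.
exists (C + A1 + A2); first by rewrite !addr_ge0.
move=> t s phi b h K ts rp K0 tay rh hh y.
have /andP[S0 SL] := S_incr j ts.
have st0 : 0 <= s - t by rewrite subr_ge0.
pose Sig := fun y => \sum_(j <- js) (S j s - S j t) * h j y.
have [rS hS] : reg a Sig /\ hol a Sig ((size js)%:R * (L * (s - t)) * K).
  rewrite /Sig; elim: js {IH A1 A10 Sig} => [|i js [IHr IHh]] /=.
    rewrite (_ : (fun y => _) = fun=> 0); last by apply/funext => z; rewrite big_nil.
    split; last by move=> v z; rewrite /dif subrr normr0 !mul0r.
    exists 0, 0; split=> // [z|v z]; first by rewrite normr0.
    by rewrite /dif subrr normr0 mul0r.
  rewrite (_ : (fun y => _) = fun z => (S i s - S i t) * h i z + 1 * \sum_(j <- js) (S j s - S j t) * h j z); last first.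
    by apply/funext => z; rewrite big_cons mul1r.
  split; first exact: reg_lin.
  move=> v z.
  rewrite (_ : dif _ _ _ = (S i s - S i t) * dif v (h i) z + dif v (fun z => \sum_(j <- js) (S j s - S j t) * h j z) z); last by rewrite /dif; ring.
  have /andP[Si0 SiL] := S_incr i ts.
  rewrite -(natr1 (size js)) [leRHS](_ : _ = L * (s - t) * (K * `|v| `^ a) +
    (size js)%:R * (L * (s - t)) * K * `|v| `^ a); last by ring.
  apply: le_trans (ler_normD _ _) _.
  apply: lerD; last exact: IHh.
  rewrite normrM (ger0_norm Si0); apply: ler_pM => //; exact: hh.
have [M [_ [_ _ bM _]]] := rp.
have rf := reg_flow js t s rp.
have T1 : `|heat (d j) (S j s - S j t) (flow_seq js t s phi) y - heat (d j) (S j s - S j t) phi y - heat (d j) (S j s - S j t) Sig y|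
   <= C * K * (s - t) `^ (1 + a / 2).
  have := IH _ _ _ _ _ _ ts rp K0 tay rh hh.
  rewrite (_ : (fun y => _ - _ - _) = fun z => 1 * (1 * flow_seq js t s phi z + -1 * phi z) + -1 * Sig z); last first.
    by apply/funext => z; rewrite /Sig; ring.
  move=> bb; have := @heat_bnd _ _ _ a01 (d j) (S j s - S j t) _ _ _ bb y.
  rewrite (heat_lin a01)//; last by apply: reg_lin.
  rewrite (heat_lin a01)// !mul1r !mulN1r; apply.
  by apply: reg_lin => //; apply: reg_lin.
have T2 : `|heat (d j) (S j s - S j t) Sig y - Sig y| <= A1 * K * (s - t) `^ (1 + a / 2).
  apply: le_trans (heat_moment a01 (d j) S0 rS _ hS y) _; first by rewrite !mulr_ge0.
  have [st|st] := eqVneq (s - t) 0; first by rewrite st !(mulr0, mul0r, powR_ge0, mulr_ge0).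
  rewrite powR1D; last by rewrite lt0r st.
  rewrite /A1 [leRHS](_ : _ = 2 * ((size js)%:R * (L * (s - t)) * K) * (2 * `|d j| ^+ 2) `^ (a / 2) * (L `^ (a / 2) * (s - t) `^ (a / 2))); last by ring.
  apply: ler_wpM2l; first by rewrite !mulr_ge0 ?powR_ge0.
  by rewrite -powRM//; apply: ge0_ler_powR => //; rewrite nnegrE mulr_ge0.
have T3 : `|heat (d j) (S j s - S j t) phi y - phi y - (S j s - S j t) * h j y| <= A2 * K * (s - t) `^ (1 + a / 2).
  apply: le_trans (heat_taylor a01 S0 rp K0 (tay j y)) _.
  rewrite /A2 [leRHS](_ : _ = 4 * K * ((2 * L) `^ (1 + a / 2) * (s - t) `^ (1 + a / 2))); last by ring.
  apply: ler_wpM2l; first by rewrite mulr_ge0.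
  have a21 : 0 <= 1 + a / 2 by lra.
  rewrite -powRM ?mulr_ge0//; apply: ge0_ler_powR; rewrite ?nnegrE ?a21 ?mulr_ge0//.
  by rewrite -mulrA ler_wpM2l.
rewrite big_cons /= -/(Sig y) 4!mulrDl; move: T1 T2 T3.
rewrite !ler_norml => /andP[? ?] /andP[? ?] /andP[? ?]; apply/andP; split; lra.
Qed.

End Flow.

Section Duhamel.
Context {R : realType} {V : normedModType R} (a : R) (a01 : 0 < a < 1).
Context (P : R -> R -> (V -> R) -> V -> R) (C1 C2 : R) (ev : evolution a P C1 C2).
Implicit Types (phi psi : V -> R) (v y : V) (M K N s t r : R) (f : R -> V -> R).

Lemma ev_hol t s phi K : reg a phi -> hol a phi K -> hol a (P t s phi) K.
Proof.
move=> rp hK v y; have := ev_bnd ev t s (reg_dif v rp) (hK v) y.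
rewrite difE (ev_lin ev)//; last exact: reg_shift.
by rewrite (ev_shift ev)// /transl /dif mul1r mulN1r.
Qed.

Lemma reg_ev t s phi : reg a phi -> reg a (P t s phi).
Proof.
move=> rp; have [M [K [M0 K0 bM hK]]] := rp; exists M, K; split=> //.
  exact: (ev_bnd ev).
exact: ev_hol.
Qed.

Lemma ev_dif t s v phi : reg a phi -> P t s (dif v phi) = dif v (P t s phi).
Proof.
move=> rp; rewrite !difE (ev_lin ev) ?(ev_shift ev)//; exact: reg_shift.
Qed.

Lemma reg_sub phi psi : reg a phi -> reg a psi -> reg a (fun y => phi y - psi y).
Proof.
move=> rp rq; have := reg_lin 1 (-1) rp rq.
by congr reg; apply/funext => y; rewrite mul1r mulN1r.
Qed.

Lemma ev_sub t s phi psi : reg a phi -> reg a psi ->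
  P t s (fun y => phi y - psi y) = fun y => P t s phi y - P t s psi y.
Proof.
move=> rp rq.
rewrite (_ : (fun y => phi y - psi y) = fun y => 1 * phi y + -1 * psi y); last first.
  by apply/funext => y; rewrite mul1r mulN1r.
by rewrite (ev_lin ev)//; apply/funext => y; rewrite mul1r mulN1r.
Qed.

Lemma ev_nonexp t s phi psi e : reg a phi -> reg a psi ->
  bnd (fun y => phi y - psi y) e -> bnd (fun y => P t s phi y - P t s psi y) e.
Proof.
move=> rp rq h; have := ev_bnd ev t s (reg_sub rp rq) h.
by rewrite ev_sub.
Qed.

Definition tame f M K N := [/\ 0 <= M, 0 <= K, 0 <= N,
  forall s, bnd (f s) M /\ hol a (f s) K &
  forall s t, bnd (fun y => f s y - f t y) (N * `|s - t| `^ (a / 2))].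

Lemma tame_reg f M K N s : tame f M K N -> reg a (f s).
Proof. by case=> M0 K0 _ h _; have [? ?] := h s; exists M, K. Qed.

Lemma tame_lin b c f g M K N M' K' N' : tame f M K N -> tame g M' K' N' ->
  tame (fun s y => b * f s y + c * g s y)
    (`|b| * M + `|c| * M') (`|b| * K + `|c| * K') (`|b| * N + `|c| * N').
Proof.
move=> [M0 K0 N0 h1 h2] [M0' K0' N0' h1' h2'].
have gen (p q : R) (F G : R) : `|p| <= F -> `|q| <= G -> `|b * p + c * q| <= `|b| * F + `|c| * G.
  move=> pF qG; apply: le_trans (ler_normD _ _) _; rewrite !normrM.
  by apply: lerD; apply: ler_wpM2l.
split; try by rewrite addr_ge0 ?mulr_ge0.
  move=> s; have [b1 k1] := h1 s; have [b2 k2] := h1' s; split.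
    by move=> y; exact: gen.
  move=> v y; rewrite mulrDl -!mulrA.
  rewrite (_ : dif _ _ _ = b * dif v (f s) y + c * dif v (g s) y); last by rewrite /dif; ring.
  by apply: gen; [exact: k1|exact: k2].
move=> s t y; rewrite mulrDl -!mulrA.
rewrite (_ : _ - _ = b * (f s y - f t y) + c * (g s y - g t y)); last by ring.
by apply: gen; [exact: h2|exact: h2'].
Qed.

Lemma tame_shift v f M K N : tame f M K N -> tame (fun s => transl v (f s)) M K N.
Proof.
move=> [M0 K0 N0 h1 h2]; split=> // s; last by move=> t y; exact: h2.
have [b1 k1] := h1 s; split; first by move=> y; exact: b1.
by move=> w y; rewrite /dif /transl addrAC; exact: k1.
Qed.

Lemma tame_dif v f M K N : tame f M K N -> exists M' K' N', tame (fun s => dif v (f s)) M' K' N'.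
Proof.
move=> tf; have := tame_lin 1 (-1) (tame_shift v tf) tf => h.
do 3 eexists; rewrite (_ : (fun s => _) = fun s y => 1 * transl v (f s) y + -1 * f s y).
  exact: h.
by apply/funext => s; rewrite difE.
Qed.

Let b20 : 0 <= a / 2. Proof. by case/andP: a01 => ? ?; lra. Qed.

Lemma ev_tame_modulus0 f M K N r s t : tame f M K N -> s <= r -> r <= t ->
  bnd (fun y => f s y - P r t (f t) y) ((C2 * K + N) * (t - s) `^ (a / 2)).
Proof.
move=> tf sr rt y; have [M0 K0 N0 h1 h2] := tf.
rewrite -(subrKA (f t y)); apply: le_trans (ler_normD _ _) _.
rewrite addrC mulrDl; apply: lerD; last first.
  by have := h2 s t y; rewrite [`|s - t|]distrC (ger0_norm (_ : 0 <= t - s))//; lra.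
rewrite distrC; apply: le_trans (ev_moment ev rt (tame_reg t tf) K0 (proj2 (h1 t)) y) _.
apply: ler_wpM2l; first by rewrite mulr_ge0// (ev_C2 ev).
by apply: ge0_ler_powR; rewrite ?nnegrE//; lra.
Qed.

Lemma ev_tame_modulus f M K N r s t : tame f M K N ->
  bnd (fun y => P r s (f s) y - P r t (f t) y) ((C2 * K + N) * `|s - t| `^ (a / 2)).
Proof.
move=> tf; wlog st : s t / s <= t.
  move=> hw; have [|/ltW ts] := leP s t; first exact: hw.
  by move=> y; have := hw _ _ ts y; rewrite distrC -[`|t - s|]normrN opprB.
rewrite -normrN opprB ger0_norm ?subr_ge0//.
have [rs|/ltW sr] := leP r s.
  rewrite -(ev_semi ev rs st (tame_reg t tf)).
  apply: ev_nonexp; [exact: tame_reg tf|exact: reg_ev (tame_reg t tf)|].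
  exact: (ev_tame_modulus0 tf).
rewrite (ev_le ev)//; have [rt|/ltW tr] := leP r t; first exact: (ev_tame_modulus0 tf).
rewrite (ev_le ev)//.
have [M0 K0 N0 h1 h2] := tf => y; apply: le_trans (h2 s t y) _.
rewrite -normrN opprB ger0_norm ?subr_ge0//.
by rewrite ler_wpM2r ?powR_ge0// lerDr mulr_ge0// (ev_C2 ev).
Qed.

Definition duhn n r s f y : R := 2 ^- n *
  \sum_(Num.truncn (r * 2 ^+ n) <= i < Num.truncn (s * 2 ^+ n)) P r (i.+1%:R / 2 ^+ n) (f (i.+1%:R / 2 ^+ n)) y.

(* The Duhamel integral: [int_r^s P r q (f q) dq]. *)
Definition duh r s f y : R := limn (fun n => duhn n r s f y).

Let two_gt0 n : 0 < 2 ^+ n :> R. Proof. by rewrite exprn_gt0. Qed.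

Lemma grid_le n r s : r <= s -> (Num.truncn (r * 2 ^+ n) <= Num.truncn (s * 2 ^+ n))%N.
Proof. by move=> rs; apply: le_truncn; rewrite ler_pM2r. Qed.

Lemma grid_count n r s : 0 <= r -> r <= s ->
  `|2 ^- n * (Num.truncn (s * 2 ^+ n) - Num.truncn (r * 2 ^+ n))%:R - (s - r)| <= 2^-1 ^+ n.
Proof.
move=> r0 rs; rewrite natrB ?grid_le// exprVn; have p0 := two_gt0 n.
move: (2 ^+ n) p0 => p p0.
have x0 : 0 <= r * p by rewrite mulr_ge0// ltW.
have x1 : 0 <= s * p by rewrite mulr_ge0 ?(ltW p0)// (le_trans r0).
have /andP[h1 h2] := truncn_itv x0; have /andP[h3 h4] := truncn_itv x1.
move: h1 h2 h3 h4; rewrite -!(natr1 (Num.truncn _)).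
move: (Num.truncn (r * p))%:R (Num.truncn (s * p))%:R => k k' h1 h2 h3 h4.
rewrite (_ : p^-1 * _ - _ = (k' - s * p - (k - r * p)) / p); last by field; rewrite gt_eqF.
rewrite normrM (gtr0_norm (_ : 0 < p^-1)) ?invr_gt0// ler_piMl ?invr_ge0 ?ltW//.
by rewrite ltr_norml; apply/andP; split; lra.
Qed.

Lemma duhn_sum_le n r s (F : nat -> R) B : 0 <= r -> r <= s -> 0 <= B ->
  (forall i, r <= i.+1%:R / 2 ^+ n <= s -> `|F i| <= B) ->
  `|2 ^- n * \sum_(Num.truncn (r * 2 ^+ n) <= i < Num.truncn (s * 2 ^+ n)) F i| <= (s - r) * B + B * 2^-1 ^+ n.
Proof.
move=> r0 rs B0 h; have p0 := two_gt0 n.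
have x1 : 0 <= s * 2 ^+ n by rewrite mulr_ge0 ?(ltW p0)// (le_trans r0).
rewrite normrM ger0_norm ?invr_ge0 ?(ltW p0)//.
apply: (@le_trans _ _ (2 ^- n * ((Num.truncn (s * 2 ^+ n) - Num.truncn (r * 2 ^+ n))%:R * B))).
  rewrite ler_pM2l ?invr_gt0//; apply: le_trans (ler_norm_sum _ _ _) _.
  rewrite mulr_natl -(sumr_const_nat _ _ B); apply: ler_sum_nat => i /andP[i1 i2]; apply: h.
  rewrite ler_pdivlMr// ler_pdivrMr//; apply/andP; split.
    by apply: le_trans (ltW (truncnS_gt _)) _; rewrite ler_nat ltnS.
  by rewrite -truncn_ge_nat.
have := grid_count n r0 rs; rewrite ler_norml => /andP[_ h2].
rewrite mulrA [B * _]mulrC -mulrDl; apply: ler_wpM2r => //; lra.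
Qed.

Let rho : R := 2^-1 `^ (a / 2).

Let rho01 : 0 <= rho < 1.
Proof.
rewrite powR_ge0 /=; apply: powR_lt1; last by case/andP: a01 => ? ?; lra.
by apply/andP; split; lra.
Qed.

Lemma duhn_step n r s f M K N : tame f M K N -> 0 <= r -> r <= s -> s <= 1 ->
  bnd (fun y => duhn n.+1 r s f y - duhn n r s f y) ((C2 * K + N + 2 * M) * rho ^+ n).
Proof.
move=> tf r0 rs s1 y; have [M0 K0 N0 h1 h2] := tf.
pose F q := P r q (f q) y.
have FM q : `|F q| <= M.
  by apply: (ev_bnd ev); [exact: tame_reg tf|exact: (proj1 (h1 q))].
have s0 := le_trans r0 rs; have p0 := two_gt0 n.
pose G i := F (i.+1%:R / 2 ^+ n); pose G' i := F (i.+1%:R / 2 ^+ n.+1).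
pose ia := Num.truncn (r * 2 ^+ n); pose ib := Num.truncn (s * 2 ^+ n).
pose ja := Num.truncn (r * 2 ^+ n.+1); pose jb := Num.truncn (s * 2 ^+ n.+1).
have iab : (ia <= ib)%N by exact: grid_le.
have jab : (ja <= jb)%N by exact: grid_le.
have dbl (q : R) : 0 <= q -> (Num.truncn (q * 2 ^+ n) * 2 <= Num.truncn (q * 2 ^+ n.+1))%N /\
    (Num.truncn (q * 2 ^+ n.+1) <= Num.truncn (q * 2 ^+ n) * 2 + 1)%N.
  move=> q0; have x0 : 0 <= q * 2 ^+ n by rewrite mulr_ge0// ltW.
  have x1 : 0 <= q * 2 ^+ n.+1 by rewrite mulr_ge0// ltW.
  have /andP[g1 g2] := truncn_itv x0.
  have e : q * 2 ^+ n.+1 = q * 2 ^+ n * 2 by rewrite exprSr mulrA.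
  split; first by rewrite truncn_ge_nat// natrM e ler_pM2r.
  rewrite -ltnS truncn_lt_nat// e -addnS -[2%N in X in (_ + X)%N]mul1n -mulnDl addn1.
  by rewrite natrM ltr_pM2r.
pose X m := \sum_(0 <= i < m) G i; pose X' m := \sum_(0 <= i < m) G' i.
have rangeE (H : nat -> R) m k : (m <= k)%N ->
  \sum_(m <= i < k) H i = \sum_(0 <= i < k) H i - \sum_(0 <= i < m) H i.
  by move=> mk; apply/eqP; rewrite eq_sym subr_eq addrC -big_cat_nat.
pose w := (C2 * K + N) * (2 ^- n.+1) `^ (a / 2).
have C20 : 0 <= C2 * K + N by rewrite addr_ge0// mulr_ge0// (ev_C2 ev).
have w0 : 0 <= w by rewrite mulr_ge0 ?powR_ge0.
have GG i : G i = G' (i * 2).+1.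
  rewrite /G /G'; congr F; rewrite -[(i * 2).+2]/(i.+1 * 2)%N natrM exprSr -mulf_div divff ?mulr1//.
have GG' i : `|G' (i * 2)%N - G' (i * 2).+1| <= w.
  apply: le_trans (ev_tame_modulus _ _ _ tf y) _.
  rewrite -mulrBl -(natr1 (i * 2).+1) opprD addNKr normrM normrN1 mul1r.
  by rewrite ger0_norm ?invr_ge0 ?(ltW (two_gt0 _)).
have XS m : X m.+1 = X m + G m by rewrite /X big_nat_recr.
have X'S m : X' m.+1 = X' m + G' m by rewrite /X' big_nat_recr.
have pair k : `|X' ((ia + k) * 2)%N - X' (ia * 2)%N - 2 * (X (ia + k)%N - X ia)| <= k%:R * w.
  elim: k => [|k IH]; first by rewrite addn0 !subrr mulr0 subr0 normr0 mul0r.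
  rewrite addnS mulSn add2n !X'S XS GG (_ : k.+1%:R * w = k%:R * w + w); last first.
    by rewrite -(natr1 k) mulrDl mul1r.
  have := GG' (ia + k)%N; move: IH.
  rewrite !ler_norml => /andP[? ?] /andP[? ?]; apply/andP; split; lra.
have edge m k : (m * 2 <= k)%N -> (k <= m * 2 + 1)%N -> `|X' k - X' (m * 2)%N| <= M.
  move=> mk km; case: (nat_between mk km) => ->; first by rewrite subrr normr0.
  by rewrite addn1 X'S addrC addKr; exact: FM.
have [a1 a2] := dbl r r0; have [b1 b2] := dbl s s0.
have ea := edge _ _ a1 a2; have eb := edge _ _ b1 b2.
have pp := pair (ib - ia)%N; rewrite subnKC// in pp.
have -> : duhn n.+1 r s f y - duhn n r s f y = 2 ^- n.+1 *
  ((X' jb - X' (ib * 2)%N) - (X' ja - X' (ia * 2)%N) + (X' (ib * 2)%N - X' (ia * 2)%N - 2 * (X ib - X ia))).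
  have -> : duhn n r s f y = 2 ^- n * (X ib - X ia).
    by congr (_ * _); exact: rangeE.
  have -> : duhn n.+1 r s f y = 2 ^- n.+1 * (X' jb - X' ja).
    by congr (_ * _); exact: rangeE.
  have -> : 2 ^- n = 2 ^- n.+1 * 2 :> R by rewrite exprS invfM mulrAC mulVf// mul1r.
  ring.
rewrite normrM ger0_norm ?invr_ge0 ?(ltW (two_gt0 _))//.
apply: (@le_trans _ _ (2 ^- n.+1 * ((ib - ia)%:R * w + 2 * M))).
  rewrite ler_pM2l ?invr_gt0//; move: pp ea eb; rewrite -/ja -/jb -/ia -/ib.
  rewrite !ler_norml => /andP[? ?] /andP[? ?] /andP[? ?]; apply/andP; split; lra.
have q01 : 0 < (2^-1 : R) ^+ n <= 1.
  by rewrite exprn_gt0 ?invr_gt0//= exprn_ile1//; lra.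
have cnt : (2 ^- n.+1 : R) * (ib - ia)%:R <= 1.
  have := grid_count n r0 rs; rewrite ler_norml -/ia -/ib exprS invfM => /andP[_ g].
  case/andP: q01 => _ q1; rewrite -mulrA; move: g q1; set p := _ * _ => g q1; lra.
have qrho : (2^-1 : R) ^+ n.+1 <= rho ^+ n.
  apply: (@le_trans _ _ (2^-1 ^+ n)); first by rewrite exprS ler_piMl ?exprn_ge0//; lra.
  rewrite -powR_exprn ?invr_ge0//; by apply: ger1_powR => //; case/andP: a01 => ? ?; lra.
have qrho' : (2 ^- n.+1 : R) `^ (a / 2) <= rho ^+ n.
  rewrite -exprVn powR_exprn ?invr_ge0// -/rho exprS ler_piMl ?exprn_ge0//; first by case/andP: rho01.
  by case/andP: rho01 => _ /ltW.
rewrite mulrDr [leRHS]mulrDl; apply: lerD.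
  rewrite mulrA; apply: le_trans (ler_wpM2r w0 cnt) _; rewrite mul1r.
  exact: ler_wpM2l.
by rewrite mulrC -exprVn ler_wpM2l// mulr_ge0.
Qed.

Lemma duhn_cvg r s f M K N : tame f M K N -> 0 <= r -> r <= s -> s <= 1 ->
  exists2 e : nat -> R, e @ \oo --> 0 &
  forall n, bnd (fun y => duhn n r s f y - duh r s f y) (e n).
Proof.
move=> tf r0 rs s1.
exists (fun n => (C2 * K + N + 2 * M) / (1 - rho) * rho ^+ n); first exact: cvg_geo.
move=> n y; have [_] := @geo_cvg _ (fun n => duhn n r s f y) _ _ rho01
  (fun n => duhn_step n tf r0 rs s1 y).
by move=> /(_ n); rewrite mulrAC.
Qed.

Lemma duhn_to r s f M K N y : tame f M K N -> 0 <= r -> r <= s -> s <= 1 ->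
  duhn n r s f y @[n --> \oo] --> duh r s f y.
Proof.
move=> tf r0 rs s1; have [e e0 h] := duhn_cvg tf r0 rs s1.
by apply: (cvg_norm_le e0) => n; exact: h.
Qed.

Lemma duh_bnd r s f M K N M' : tame f M K N -> 0 <= r -> r <= s -> s <= 1 ->
  0 <= M' -> (forall q, r <= q <= s -> bnd (f q) M') -> bnd (duh r s f) ((s - r) * M').
Proof.
move=> tf r0 rs s1 M0' h y.
have e0 : (fun n => M' * 2^-1 ^+ n) @ \oo --> 0 by apply: cvg_geo; apply/andP; split; lra.
apply: (norm_lim_le (@duhn_to r s f M K N y tf r0 rs s1) e0) => n.
apply: duhn_sum_le => // i hi.
by apply: (ev_bnd ev); [exact: tame_reg tf|exact: h].
Qed.

Lemma duh_lin r s b c f g M K N M' K' N' y : tame f M K N -> tame g M' K' N' ->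
  0 <= r -> r <= s -> s <= 1 ->
  duh r s (fun q y => b * f q y + c * g q y) y = b * duh r s f y + c * duh r s g y.
Proof.
move=> tf tg r0 rs s1; apply: cvg_lim => //.
rewrite (_ : (fun n => _) = fun n => b * duhn n r s f y + c * duhn n r s g y); last first.
  apply/funext => n; rewrite /duhn.
  rewrite (eq_bigr (fun i => b * P r (i.+1%:R / 2 ^+ n) (f (i.+1%:R / 2 ^+ n)) y +
    c * P r (i.+1%:R / 2 ^+ n) (g (i.+1%:R / 2 ^+ n)) y)); last first.
    by move=> i _; rewrite (ev_lin ev)//; [exact: tame_reg tf|exact: tame_reg tg].
  by rewrite big_split /= -!mulr_sumr; ring.
apply: cvgD; apply: cvgM; try exact: cvg_cst.
  exact: (@duhn_to r s f M K N y tf).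
exact: (@duhn_to r s g M' K' N' y tg).
Qed.

Lemma duh_shift r s v f M K N y : tame f M K N -> 0 <= r -> r <= s -> s <= 1 ->
  duh r s (fun q => transl v (f q)) y = duh r s f (y + v).
Proof.
move=> tf r0 rs s1; apply: cvg_lim => //.
rewrite (_ : (fun n => _) = fun n => duhn n r s f (y + v)); first exact: (@duhn_to r s f M K N _ tf).
apply/funext => n; rewrite /duhn; congr (_ * _); apply: eq_bigr => i _.
by rewrite (ev_shift ev)//; exact: tame_reg tf.
Qed.

Lemma duh_dif r s v f M K N y : tame f M K N -> 0 <= r -> r <= s -> s <= 1 ->
  duh r s (fun q => dif v (f q)) y = dif v (duh r s f) y.
Proof.
move=> tf r0 rs s1; rewrite /dif -(duh_shift v y tf)//.
rewrite (_ : (fun q => _) = fun q y => 1 * transl v (f q) y + -1 * f q y); last first.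
  by apply/funext => q; apply/funext => z; rewrite mul1r mulN1r.
by rewrite (duh_lin _ _ _ (tame_shift v tf) tf)// mul1r mulN1r.
Qed.

Lemma reg_duh r s f M K N : tame f M K N -> 0 <= r -> r <= s -> s <= 1 -> reg a (duh r s f).
Proof.
move=> tf r0 rs s1; have [M0 K0 N0 h1 h2] := tf.
have sr : 0 <= s - r by rewrite subr_ge0.
exists ((s - r) * M), ((s - r) * K); split; rewrite ?mulr_ge0//.
  by apply: (duh_bnd tf) => // q _; exact: (proj1 (h1 q)).
move=> v y; rewrite -(duh_dif v y tf)// -mulrA.
have [M' [K' [N' tv]]] := tame_dif v tf.
by apply: (duh_bnd tv) => //; [rewrite mulr_ge0 ?powR_ge0|move=> q _; exact: (proj2 (h1 q))].
Qed.

Lemma ev_scale_sum t s c (I : Type) (l : seq I) (F : I -> V -> R) :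
  (forall i, reg a (F i)) ->
  reg a (fun y => c * \sum_(i <- l) F i y) /\
  P t s (fun y => c * \sum_(i <- l) F i y) = fun y => c * \sum_(i <- l) P t s (F i) y.
Proof.
move=> rF; elim: l => [|i l [IHr IHe]].
  rewrite (_ : (fun y => _) = fun y => 0); last by apply/funext => y; rewrite big_nil mulr0.
  have r0 : reg a (fun _ : V => 0).
    exists 0, 0; split=> // [z|v z]; first by rewrite normr0.
    by rewrite /dif subrr normr0 mul0r.
  split=> //; apply/funext => y; rewrite big_nil mulr0; apply/eqP; rewrite -normr_le0.
  by apply: (ev_bnd ev t s r0) => z; rewrite normr0.
rewrite (_ : (fun y => c * _) = fun y => c * F i y + 1 * (c * \sum_(i <- l) F i y)); last first.
  by apply/funext => y; rewrite big_cons mulrDr mul1r.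
split; first exact: reg_lin.
by rewrite (ev_lin ev)// IHe; apply/funext => y; rewrite big_cons mulrDr mul1r.
Qed.

Lemma duh_flow r q s f M K N y : tame f M K N -> 0 <= r -> r <= q -> q <= s -> s <= 1 ->
  duh r s f y = duh r q f y + P r q (duh q s f) y.
Proof.
move=> tf r0 rq qs s1.
have rs := le_trans rq qs; have q1 := le_trans qs s1; have q0 := le_trans r0 rq.
have rn n : reg a (duhn n q s f).
  rewrite /duhn.
  by have [] := @ev_scale_sum 0 0 (2 ^- n) _ (index_iota (Num.truncn (q * 2 ^+ n)) (Num.truncn (s * 2 ^+ n)))
    (fun i => P q (i.+1%:R / 2 ^+ n) (f (i.+1%:R / 2 ^+ n))) (fun i => reg_ev _ _ (tame_reg _ tf)).
apply: (@cvg_unique _ _ (duhn n r s f y @[n --> \oo])) => //; first exact: (@duhn_to r s f M K N y tf).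
rewrite /= (_ : (fun n => duhn n r s f y) = fun n => duhn n r q f y + P r q (duhn n q s f) y); last first.
  apply/funext => n; rewrite /duhn (big_cat_nat (n := Num.truncn (q * 2 ^+ n))) ?grid_le//= mulrDr.
  congr (_ + _).
  rewrite (proj2 (@ev_scale_sum r q (2 ^- n) _ (index_iota (Num.truncn (q * 2 ^+ n)) (Num.truncn (s * 2 ^+ n)))
    (fun i => P q (i.+1%:R / 2 ^+ n) (f (i.+1%:R / 2 ^+ n))) (fun i => reg_ev _ _ (tame_reg _ tf)))).
  congr (_ * _); apply: eq_big_nat => i /andP[i1 i2].
  rewrite (ev_semi ev)//; last exact: tame_reg tf.
  rewrite ler_pdivlMr//; apply: le_trans (ltW (truncnS_gt _)) _.
  by rewrite ler_nat ltnS.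
apply: cvgD; first exact: (@duhn_to r q f M K N y tf).
have [e e0 he] := duhn_cvg tf q0 qs s1.
apply: (cvg_norm_le e0) => n; apply: ev_nonexp => //.
exact: (reg_duh tf).
Qed.

Lemma duh_small r s f M K N : tame f M K N -> 0 <= r -> r <= s -> s <= 1 ->
  bnd (fun y => duh r s f y - (s - r) * f s y) (2 * (C2 * K + N) * (s - r) `^ (1 + a / 2)).
Proof.
move=> tf r0 rs s1 y; have [M0 K0 N0 h1 h2] := tf.
have CK : 0 <= C2 * K + N by rewrite addr_ge0// mulr_ge0// (ev_C2 ev).
have sr : 0 <= s - r by rewrite subr_ge0.
pose B := 2 * (C2 * K + N) * (s - r) `^ (a / 2).
have B0 : 0 <= B by rewrite !mulr_ge0 ?powR_ge0.
have a21 : 1 + a / 2 != 0 by rewrite gt_eqF// ltr_wpDr.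
have -> : 2 * (C2 * K + N) * (s - r) `^ (1 + a / 2) = (s - r) * B.
  have [->|sr1] := eqVneq (s - r) 0; first by rewrite mul0r powR0 ?mulr0.
  by rewrite powR1D ?lt0r ?sr1// /B; ring.
have e0 : (fun n => (B + M) * 2^-1 ^+ n) @ \oo --> 0 by apply: cvg_geo; apply/andP; split; lra.
have c1 : duhn n r s f y - (s - r) * f s y @[n --> \oo] --> duh r s f y - (s - r) * f s y.
  by apply: cvgB; [exact: (@duhn_to r s f M K N y tf)|exact: cvg_cst].
apply: (norm_lim_le c1 e0) => n.
pose F i := P r (i.+1%:R / 2 ^+ n) (f (i.+1%:R / 2 ^+ n)) y - f s y.
have -> : duhn n r s f y - (s - r) * f s y =
  2 ^- n * \sum_(Num.truncn (r * 2 ^+ n) <= i < Num.truncn (s * 2 ^+ n)) F i +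
  (2 ^- n * (Num.truncn (s * 2 ^+ n) - Num.truncn (r * 2 ^+ n))%:R - (s - r)) * f s y.
  rewrite /F sumrB sumr_const_nat -[_ *+ (_ - _)]mulr_natl /duhn; set c := 2 ^- n; ring.
apply: le_trans (ler_normD _ _) _; rewrite [(B + M) * _]mulrDl addrA; apply: lerD.
  apply: duhn_sum_le => // i /andP[i1 i2].
  set q := _ / _ in i1 i2; rewrite /F -/q -(subrKA (P r s (f s) y)).
  apply: le_trans (ler_normD _ _) _.
  have m1 := ev_tame_modulus r q s tf y.
  have m2 := ev_moment ev rs (tame_reg s tf) K0 (proj2 (h1 s)) y.
  have le1 : `|q - s| `^ (a / 2) <= (s - r) `^ (a / 2).
    apply: ge0_ler_powR; rewrite ?nnegrE//.
    by rewrite -normrN opprB ger0_norm; lra.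
  have := ler_wpM2l CK le1; have : 0 <= N * (s - r) `^ (a / 2) by rewrite mulr_ge0 ?powR_ge0.
  by rewrite /B; move: m1 m2; rewrite !mulrDl; lra.
rewrite normrM mulrC; apply: ler_pM => //; first exact: (proj1 (h1 s)).
exact: grid_count.
Qed.

End Duhamel.

Section DuhamelSmoothing.
Context {R : realType} {V : normedModType R} (a : R) (a01 : 0 < a < 1).
Context (P : R -> R -> (V -> R) -> V -> R) (C1 C2 : R) (ev : evolution a P C1 C2).
Implicit Types (phi psi : V -> R) (v w z y : V) (M K N s t r : R) (f : R -> V -> R).

(* Splitting [r, s] dyadically towards [r] leaves on each piece a smoothing
   over a time comparable to its length. *)
Lemma duh_functional (lam : (V -> R) -> R) (c B b : R) r s f M K N M' :
  0 <= c -> 0 <= B -> 0 < b -> 0 <= M' ->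
  (forall phi psi, lam (fun y => phi y + psi y) = lam phi + lam psi) ->
  (forall phi M, 0 <= M -> bnd phi M -> `|lam phi| <= c * M) ->
  (forall t s phi M, t < s -> 0 <= M -> reg a phi -> bnd phi M ->
     `|lam (P t s phi)| <= B * M * (s - t) `^ (b - 1)) ->
  tame a f M K N -> 0 <= r -> r <= s -> s <= 1 ->
  (forall q, r <= q <= s -> bnd (f q) M') ->
  `|lam (duh P r s f)| <= (2^-1 `^ b / (1 - 2^-1 `^ b)) * B * M' * (s - r) `^ b.
Proof.
move=> c0 B0 b0 M0' lamD lamb lamP tf r0 rs s1 fM.
pose rho : R := 2^-1 `^ b.
have rho0 : 0 <= rho by exact: powR_ge0.
have rho1 : rho < 1 by apply: powR_lt1 => //; apply/andP; split; lra.
have rho'0 : 0 <= 2^-1 `^ b / (1 - 2^-1 `^ b) by rewrite divr_ge0// subr_ge0 ltW.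
have [srE|sr] := eqVneq (s - r) 0.
  have := lamb _ _ _ (duh_bnd a01 ev tf r0 rs s1 M0' fM).
  rewrite srE mul0r mulr0 => /(_ (lexx _)) h; apply: le_trans h _.
  by apply: mulr_ge0 (powR_ge0 _ _); do 2 (apply: mulr_ge0 => //).
have {sr} sr : 0 < s - r by rewrite lt0r sr subr_ge0.
pose h j : R := (s - r) * 2^-1 ^+ j.
have hS j : h j = h j.+1 + h j.+1 by rewrite /h exprS; field.
have h0 j : 0 < h j by rewrite mulr_gt0// exprn_gt0 invr_gt0.
have hs j : r + h j <= s.
  have : h j <= s - r by rewrite /h ler_piMr ?(ltW sr)// exprn_ile1//; lra.
  lra.
have step j : `|lam (duh P r (r + h j) f) - lam (duh P r (r + h j.+1) f)| <=
    B * M' * (s - r) `^ b * rho ^+ j.+1.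
  have rq : r <= r + h j.+1 by rewrite lerDl ltW.
  have qp : r + h j.+1 <= r + h j by rewrite lerD2l [leRHS]hS lerDl ltW.
  have q0 := le_trans r0 rq; have p1 := le_trans (hs j) s1.
  have -> : duh P r (r + h j) f = fun y => duh P r (r + h j.+1) f y + P r (r + h j.+1) (duh P (r + h j.+1) (r + h j) f) y.
    by apply/funext => y; rewrite (duh_flow a01 ev y tf r0 rq qp p1).
  rewrite lamD addrAC subrr add0r.
  have lth : r < r + h j.+1 by rewrite ltrDl.
  have bq q : r + h j.+1 <= q <= r + h j -> bnd (f q) M'.
    by move=> /andP[q1 q2]; apply: fM; rewrite (le_trans rq q1) (le_trans q2).
  have := duh_bnd a01 ev tf q0 qp p1 M0' bq.
  rewrite (_ : r + h j - (r + h j.+1) = h j.+1); last by rewrite [h j]hS; ring.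
  move=> bb; have := lamP _ _ _ _ lth _ (reg_duh a01 ev tf q0 qp p1) bb.
  rewrite mulr_ge0 ?(ltW (h0 _))// => /(_ isT) hh; apply: le_trans hh _.
  rewrite (_ : r + h j.+1 - r = h j.+1); last by ring.
  rewrite (_ : _ * _ * _ = B * M' * (h j.+1 `^ (b - 1) * h j.+1)); last by ring.
  rewrite powRB1M// /h powRM ?(ltW sr) ?exprn_ge0 ?invr_ge0// powR_exprn ?invr_ge0//.
  by rewrite mulrA.
have tot n : `|lam (duh P r s f) - lam (duh P r (r + h n) f)| <=
    B * M' * (s - r) `^ b * (rho / (1 - rho)) * (1 - rho ^+ n).
  have d0 : 0 < 1 - rho by rewrite subr_gt0.
  elim: n => [|n IH].
    by rewrite /h !expr0 mulr1 (addrC r) subrK !subrr normr0 mulr0.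
  rewrite -(subrKA (lam (duh P r (r + h n) f))); apply: le_trans (ler_normD _ _) _.
  apply: le_trans (lerD IH (step n)) _.
  rewrite le_eqVlt; apply/orP; left; apply/eqP; rewrite exprS; field.
  by rewrite gt_eqF.
have e0 : (fun n => c * (s - r) * M' * 2^-1 ^+ n) @ \oo --> 0.
  by apply: cvg_geo; apply/andP; split; lra.
apply: (norm_lim_le (cvg_cst _) e0) => n.
have d0 : 0 < 1 - rho by rewrite subr_gt0.
have t1 := tot n.
have t2 : `|lam (duh P r (r + h n) f)| <= c * (s - r) * M' * 2^-1 ^+ n.
  have rq : r <= r + h n by rewrite lerDl ltW.
  have bq q : r <= q <= r + h n -> bnd (f q) M'.
    by move=> /andP[q1 q2]; apply: fM; rewrite q1 (le_trans q2).
  have := duh_bnd a01 ev tf r0 rq (le_trans (hs n) s1) M0' bq.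
  rewrite (_ : r + h n - r = h n); last by ring.
  move=> /lamb; rewrite mulr_ge0 ?(ltW (h0 _))// => /(_ isT) hh; apply: le_trans hh _.
  by rewrite /h le_eqVlt; apply/orP; left; apply/eqP; ring.
rewrite -[lam _](subrK (lam (duh P r (r + h n) f))).
apply: le_trans (ler_normD _ _) _; apply: lerD => //; apply: le_trans t1 _.
rewrite (_ : _ / _ * B * M' * _ = B * M' * (s - r) `^ b * (rho / (1 - rho))); last by rewrite /rho; ring.
rewrite ler_piMr//; first by apply: mulr_ge0 => //; rewrite !mulr_ge0 ?powR_ge0.
by rewrite gerBl exprn_ge0.
Qed.

Lemma invr_sqrt_powR (x : R) : 0 < x -> (Num.sqrt x)^-1 = x `^ (2^-1 - 1).
Proof.
move=> x0; have s0 : 0 < Num.sqrt x by rewrite sqrtr_gt0.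
apply: (mulIf (lt0r_neq0 x0)); rewrite powRB1M// powR12_sqrt ?ltW//.
by rewrite -{2}(sqr_sqrtr (ltW x0)) expr2 mulrA mulVf ?mul1r// gt_eqF.
Qed.

Lemma duh_smooth : exists2 C3 : R, 0 <= C3 &
  forall r s f M K N M', tame a f M K N -> 0 <= r -> r <= s -> s <= 1 -> 0 <= M' ->
  (forall q, r <= q <= s -> bnd (f q) M') ->
  (forall w, bnd (dif w (duh P r s f)) (C3 * M' * `|w| * Num.sqrt (s - r))) /\
  (forall w z, bnd (dif z (dif w (duh P r s f))) (C3 * M' * `|w| * `|z| `^ a)).
Proof.
case/andP: (a01) => a0 a1; have C10 := ev_C1 ev.
pose b := (1 - a) / 2; have b0 : 0 < b by rewrite /b; lra.
pose rho1 : R := 2^-1 `^ 2^-1; pose rho2 : R := 2^-1 `^ b.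
have r1 : rho1 < 1 by apply: powR_lt1; [apply/andP; split|]; lra.
have r2 : rho2 < 1 by apply: powR_lt1 => //; apply/andP; split; lra.
have q1 : 0 <= rho1 / (1 - rho1) by rewrite divr_ge0 ?powR_ge0// subr_ge0 ltW.
have q2 : 0 <= rho2 / (1 - rho2) by rewrite divr_ge0 ?powR_ge0// subr_ge0 ltW.
pose B := 4 * C1 * C1 `^ a.
have B0 : 0 <= B by rewrite !mulr_ge0 ?powR_ge0.
exists (rho1 / (1 - rho1) * C1 + rho2 / (1 - rho2) * B).
  by rewrite addr_ge0// mulr_ge0.
move=> r s f M K N M' tf r0 rs s1 M0' fM; have sr : 0 <= s - r by rewrite subr_ge0.
split=> [w y|w z y].
  apply: le_trans (@duh_functional (fun phi => dif w phi y) 2 (C1 * `|w|) 2^-1 r s f M K N M' _ _ _ _ _ _ _ tf r0 rs s1 fM) _ => //.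
  - by rewrite mulr_ge0.
  - by move=> phi psi; rewrite /dif; ring.
  - move=> phi A A0 bA; rewrite /dif; apply: le_trans (ler_normB _ _) _.
    by have := bA y; have := bA (y + w); lra.
  - move=> p q phi A pq A0 rp bA; apply: le_trans (ev_smooth ev w pq rp bA y) _.
    rewrite invr_sqrt_powR ?subr_gt0//.
    by rewrite le_eqVlt; apply/orP; left; apply/eqP; ring.
  rewrite [(s - r) `^ _]powR12_sqrt// -/rho1.
  rewrite (_ : _ / _ * _ * _ * _ = rho1 / (1 - rho1) * C1 * (M' * `|w| * Num.sqrt (s - r))); last by ring.
  rewrite (_ : _ * M' * _ * _ = (rho1 / (1 - rho1) * C1 + rho2 / (1 - rho2) * B) * (M' * `|w| * Num.sqrt (s - r))); last by ring.
  by apply: ler_wpM2r; [rewrite !mulr_ge0 ?sqrtr_ge0|rewrite lerDl; exact: mulr_ge0].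
apply: le_trans (@duh_functional (fun phi => dif z (dif w phi) y) 4 (B * `|w| * `|z| `^ a) b r s f M K N M' _ _ _ _ _ _ _ tf r0 rs s1 fM) _ => //.
- by rewrite !mulr_ge0 ?powR_ge0.
- by move=> phi psi; rewrite /dif; ring.
- move=> phi A A0 bA; rewrite /dif.
  have := bA y; have := bA (y + w); have := bA (y + z + w); have := bA (y + z).
  by rewrite !ler_norml => /andP[? ?] /andP[? ?] /andP[? ?] /andP[? ?]; apply/andP; split; lra.
- move=> p q phi A pq A0 rp bA.
  pose m := (p + q) / 2; pose h := (q - p) / 2.
  have h0 : 0 < h by rewrite /h; lra.
  have pm : p < m by rewrite /m; lra.
  have mq : m < q by rewrite /m; lra.
  have mp : m - p = h by rewrite /m /h; field.
  have qm : q - m = h by rewrite /m /h; field.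
  have rm := reg_ev ev m q rp.
  have -> : dif z (dif w (P p q phi)) y = dif w (P p m (dif z (P m q phi))) y.
    rewrite (ev_dif ev)// (ev_semi ev (ltW pm) (ltW mq) rp) /dif.
    by rewrite [y + z + w]addrAC; ring.
  have s0 : 0 < Num.sqrt h by rewrite sqrtr_gt0.
  have bz : bnd (dif z (P m q phi)) (2 * A * (C1 * `|z| / Num.sqrt h) `^ a).
    set x := C1 * `|z| / Num.sqrt h.
    have x0 : 0 <= x by rewrite /x !mulr_ge0// invr_ge0 ltW.
    move=> u; have [x1|x1] := leP x 1.
      have := ev_smooth ev z mq rp bA u; rewrite qm.
      rewrite (_ : C1 * A * `|z| / _ = A * x); last by rewrite /x; ring.
      move=> hx; apply: le_trans hx _; rewrite [2 * A]mulrC -mulrA; apply: ler_wpM2l => //.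
      have [->|xn] := eqVneq x 0; first by rewrite mulr_ge0 ?powR_ge0.
      have : x <= x `^ a by apply: ger1_powR; [rewrite lt0r xn x0|exact: ltW].
      by have := powR_ge0 x a; lra.
    have bP := ev_bnd ev m q rp bA.
    apply: (@le_trans _ _ (2 * A)).
      rewrite /dif; apply: le_trans (ler_normB _ _) _.
      by have := bP u; have := bP (u + z); lra.
    by rewrite ler_peMr ?mulr_ge0//; apply: powR_ge1; exact: ltW.
  apply: le_trans (ev_smooth ev w pm (reg_dif z rm) bz y) _; rewrite mp.
  have E : (q - p) `^ (b - 1) = (h `^ (b - 1)) * 2 `^ (b - 1).
    by rewrite -powRM ?(ltW h0)// /h divfK.
  have E2 : (Num.sqrt h)^-1 `^ a / Num.sqrt h = h `^ (b - 1).
    rewrite invr_sqrt_powR// -powRrM -powRD; last by rewrite (gt_eqF h0) implybT.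
    by congr (_ `^ _); rewrite /b; field.
  have E3 : 2^-1 <= (2 : R) `^ (b - 1).
    rewrite -(powR_inv1 (ler0n R 2)); apply: ler_powR; rewrite ?ler1n//; lra.
  rewrite powRM ?mulr_ge0 ?invr_ge0 ?(ltW s0)// powRM//.
  rewrite (_ : _ / Num.sqrt h = 2 * C1 * C1 `^ a * `|w| * `|z| `^ a * A * ((Num.sqrt h)^-1 `^ a / Num.sqrt h)); last by ring.
  rewrite E2 E (_ : _ * (h `^ _ * _) = 2 * C1 * C1 `^ a * `|w| * `|z| `^ a * A * h `^ (b - 1) * (2 * 2 `^ (b - 1))); last by rewrite /B; ring.
  rewrite ler_peMr//; first by rewrite !mulr_ge0 ?powR_ge0.
  by move: E3; lra.
rewrite -/rho2 (_ : _ / _ * _ * _ * _ = rho2 / (1 - rho2) * B * (M' * `|w| * `|z| `^ a) * (s - r) `^ b); last by ring.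
rewrite (_ : _ * M' * _ * _ = (rho1 / (1 - rho1) * C1 + rho2 / (1 - rho2) * B) * (M' * `|w| * `|z| `^ a)); last by ring.
apply: (@le_trans _ _ (rho2 / (1 - rho2) * B * (M' * `|w| * `|z| `^ a))).
  rewrite ler_piMr//; first by apply: mulr_ge0; [exact: mulr_ge0|rewrite !mulr_ge0 ?powR_ge0].
  by apply: powR_le1; [rewrite sr /=; lra|exact: ltW].
by apply: ler_wpM2r; [rewrite !mulr_ge0 ?powR_ge0|rewrite lerDr; exact: mulr_ge0].
Qed.

End DuhamelSmoothing.

(** * Differences and derivatives *)

Section DirectionalCalculus.
Context {R : realType} {V : normedModType R} (a : R) (a01 : 0 < a < 1).
Implicit Types (phi psi : V -> R) (u v w z y : V) (M K L q r : R).

Let a_gt0 : 0 < a. Proof. by case/andP: a01. Qed.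

Lemma quot_is_derive phi y v q K : 0 <= K ->
  (forall r, `|phi (y + r *: v) - phi y - r * q| <= K * `|r| `^ (1 + a)) ->
  is_derive y v phi q.
Proof.
move=> K0 h.
suff c : h^-1 *: ((phi \o shift y) (h *: v) - phi y) @[h --> 0^'] --> q.
  by apply: DeriveDef; [exact: cvgP c|exact: cvg_lim c].
apply/cvgrPdist_le => e e0; have K1 : 0 < K + 1 by lra.
near=> r.
have r0 : r != 0 by near: r; exact: nbhs_dnbhs_neq.
have rn0 : 0 < `|r| by rewrite normr_gt0.
have := h r; rewrite powR1D// => hr.
have -> : q - r^-1 *: ((phi \o shift y) (r *: v) - phi y) =
  - (r^-1 * (phi (y + r *: v) - phi y - r * q)).
  by rewrite /= /GRing.scale /= [r *: v + y]addrC; field.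
rewrite normrN normrM normfV ler_pdivrMl//; apply: le_trans hr _.
rewrite mulrCA ler_pM2l//.
apply: (@le_trans _ _ (K * (e / (K + 1)))); last first.
  by rewrite mulrA ler_pdivrMr// mulrC ler_pM2l//; lra.
apply: ler_wpM2l => //.
have -> : e / (K + 1) = ((e / (K + 1)) `^ a^-1) `^ a.
  by rewrite -powRrM mulVf ?gt_eqF// powRr1// divr_ge0 ?ltW.
apply: ge0_ler_powR; rewrite ?nnegrE ?powR_ge0 ?(ltW a_gt0)//.
near: r; apply: dnbhs0_le; apply: powR_gt0; exact: divr_gt0.
Unshelve. all: by end_near. Qed.

Lemma line_is_derive phi y d r : derivable phi (y + r *: d) d ->
  is_derive (r : R) 1 (fun x => phi (y + x *: d)) ('D_d phi (y + r *: d)).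
Proof.
move=> h.
have e : (fun h : R => h^-1 *: (((fun x => phi (y + x *: d)) \o shift r) (h *: 1) - phi (y + r *: d))) =
         (fun h : R => h^-1 *: ((phi \o shift (y + r *: d)) (h *: d) - phi (y + r *: d))).
  apply/funext => x /=; congr (_ *: (phi _ - _)).
  by rewrite [x *: 1]mulr1 scalerDl addrCA.
by apply: DeriveDef; rewrite /derivable /derive e.
Qed.

Lemma mvt_bound (f df : R -> R) r M : 0 <= M ->
  (forall x : R, is_derive x 1 f (df x)) ->
  (forall x : R, `|x| <= `|r| -> `|df x| <= M) -> `|f r - f 0| <= M * `|r|.
Proof.
move=> M0 hf hM.
have cf (p q : R) : {within `[p, q], continuous f}.
  by apply: derivable_within_continuous => x _; have [] := hf x.
have [r0|r0] := leP 0 r.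
  have [c /andP[c1 c2] ->] := MVT_segment r0 (fun x _ => hf x) (cf 0 r).
  rewrite subr0 normrM; apply: ler_wpM2r => //; apply: hM.
  by move: c1 c2; rewrite !bnd_simp => c1 c2; rewrite !ger0_norm.
have [c /andP[c1 c2] e] := MVT_segment (ltW r0) (fun x _ => hf x) (cf r 0).
rewrite distrC e sub0r normrM normrN; apply: ler_wpM2r => //; apply: hM.
by move: c1 c2; rewrite !bnd_simp => c1 c2; rewrite (ler0_norm c2) (ltr0_norm r0) lerN2.
Qed.

Lemma dif_le_derive phi d M : 0 <= M -> (forall y, derivable phi y d) ->
  (forall y, `|'D_d phi y| <= M) -> forall r, bnd (dif (r *: d) phi) (M * `|r|).
Proof.
move=> M0 hd hM r y.
have := @mvt_bound (fun x => phi (y + x *: d)) (fun x => 'D_d phi (y + x *: d)) r M M0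
  (fun x => line_is_derive (hd _)) (fun x _ => hM _).
by rewrite scale0r addr0.
Qed.

Lemma zygmund_taylor1 (f : R -> R) L K : 0 <= L -> 0 <= K ->
  (forall x w : R, `|f (x + w) - f x| <= L * `|w|) ->
  (forall x w z : R, `|f (x + z + w) - f (x + z) - (f (x + w) - f x)| <= K * `|w| * `|z| `^ a) ->
  forall x, exists q, forall r, `|f (x + r) - f x - r * q| <= 2 * K * `|r| `^ (1 + a).
Proof.
move=> L0 K0 hL hK x.
pose s n : R := 2^-1 ^+ n.
have s0 n : 0 < s n by rewrite exprn_gt0 ?invr_gt0.
pose D n := (f (x + s n) - f x) / s n.
pose rho : R := 2^-1 `^ a.
have rho01 : 0 <= rho < 1.
  by rewrite powR_ge0 /=; apply: powR_lt1 => //; apply/andP; split; lra.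
have step n : `|D n.+1 - D n| <= K * rho ^+ n.
  have sS : s n = s n.+1 + s n.+1 by rewrite /s exprS; field.
  have := hK x (s n.+1) (s n.+1); rewrite -[x + _ + _]addrA -sS (gtr0_norm (s0 _)).
  rewrite /D; have p0 := s0 n.+1.
  have -> : (f (x + s n.+1) - f x) / s n.+1 - (f (x + s n) - f x) / s n =
    - ((f (x + s n) - f (x + s n.+1) - (f (x + s n.+1) - f x)) / (2 * s n.+1)).
    move: (f (x + s n)) (f (x + s n.+1)) => A B; rewrite (_ : s n = 2 * s n.+1); last by rewrite sS; ring.
    by move: (s n.+1) p0 => p p0; field; rewrite gt_eqF.
  move=> h; rewrite normrN normrM normfV (gtr0_norm (_ : 0 < 2 * s n.+1)) ?mulr_gt0//.
  rewrite ler_pdivrMr ?mulr_gt0//; apply: le_trans h _.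
  have -> : s n.+1 `^ a = rho * rho ^+ n by rewrite /s powR_exprn ?invr_ge0// exprS.
  have rn0 : 0 <= rho ^+ n by rewrite exprn_ge0//; case/andP: rho01.
  have : K * rho ^+ n * s n.+1 * rho <= K * rho ^+ n * s n.+1 * 1.
    apply: ler_wpM2l; first by rewrite !mulr_ge0// ltW.
    by case/andP: rho01 => _ /ltW.
  have : 0 <= K * rho ^+ n * s n.+1 by rewrite !mulr_ge0// ltW.
  lra.
have [cD _] := geo_cvg rho01 step.
exists (limn D).
have main r : 0 < r -> `|f (x + r) - f x - r * limn D| <= K * r `^ (1 + a).
  move=> r0.
  have c1 : (fun n => f (x + r) - f x - r * D n) @ \oo --> f (x + r) - f x - r * limn D.
    by apply: cvgB; [exact: cvg_cst|apply: cvgM => //; exact: cvg_cst].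
  have c2 : (fun n => 2 * L * 2^-1 ^+ n) @ \oo --> 0 by apply: cvg_geo; apply/andP; split; lra.
  apply: (norm_lim_le c1 c2) => n.
  have p0 := s0 n; rewrite -/(s n).
  pose j := Num.truncn (r / s n).
  have /andP[j1 j2] := truncn_itv (ltW (divr_gt0 r0 p0)); rewrite -/j in j1 j2.
  rewrite ler_pdivlMr// in j1; rewrite ltr_pdivrMr// -(natr1 j) mulrDl mul1r in j2.
  have tel i : i%:R * s n <= r -> `|f (x + i%:R * s n) - f x - i%:R * (f (x + s n) - f x)| <= i%:R * (K * s n * r `^ a).
    elim: i => [|i IH]; first by rewrite !mul0r addr0 subrr subr0 normr0.
    rewrite -(natr1 i) !mulrDl !mul1r => ir.
    have ir' : i%:R * s n <= r by apply: le_trans ir; rewrite lerDl ltW.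
    have := hK x (s n) (i%:R * s n); have := IH ir'.
    have : `|i%:R * s n| `^ a <= r `^ a.
      rewrite ger0_norm ?mulr_ge0 ?(ltW p0)//.
      by apply: ge0_ler_powR; rewrite ?nnegrE ?mulr_ge0 ?(ltW p0) ?(ltW a_gt0) ?(ltW r0).
    rewrite (gtr0_norm p0) addrA => h1 h2 h3.
    have {h1} h1 : K * s n * `|i%:R * s n| `^ a <= K * s n * r `^ a.
      by apply: ler_wpM2l => //; rewrite mulr_ge0// ltW.
    have {h1} h3 := le_trans h3 h1; move: h2 h3; rewrite !ler_norml.
    by move=> /andP[? ?] /andP[? ?]; apply/andP; split; lra.
  have t1 := tel j j1.
  have rj : 0 <= r - j%:R * s n by rewrite subr_ge0.
  have t2 := hL (x + j%:R * s n) (r - j%:R * s n).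
  rewrite -addrA [j%:R * s n + _]addrC subrK (ger0_norm rj) in t2.
  have t3 := hL x (s n); rewrite (gtr0_norm p0) in t3.
  have rD : r * D n = (r / s n) * (f (x + s n) - f x) by rewrite /D; ring.
  have t4 : `|(r / s n - j%:R) * (f (x + s n) - f x)| <= L * s n.
    rewrite normrM -[leRHS]mul1r; apply: ler_pM => //.
    rewrite ger0_norm; last by rewrite subr_ge0 ler_pdivlMr.
    by rewrite lerBlDr ler_pdivrMr// mulrDl mul1r addrC ltW.
  have t5 : j%:R * (K * s n * r `^ a) <= K * r `^ (1 + a).
    rewrite powR1D// (_ : j%:R * _ = (j%:R * s n) * (K * r `^ a)); last by ring.
    rewrite [leRHS](_ : _ = r * (K * r `^ a)); last by ring.
    by apply: ler_wpM2r => //; rewrite mulr_ge0 ?powR_ge0.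
  have t6 : L * (r - j%:R * s n) <= L * s n by apply: ler_wpM2l => //; lra.
  rewrite rD; move: t1 (le_trans t2 t6) t4; rewrite !ler_norml => /andP[? ?] /andP[? ?] /andP[? ?].
  by apply/andP; split; lra.
move=> r; have [|r0|<-] := ltgtP 0 r.
- move=> r0; apply: le_trans (main r r0) _; rewrite (gtr0_norm r0).
  by apply: ler_wpM2r; [exact: powR_ge0|lra].
- have p0 : 0 < - r by lra.
  have := main _ p0; have := hK (x + r) (- r) (- r); rewrite addrK.
  rewrite (gtr0_norm p0) (ltr0_norm r0) (powR1D a p0) mulrA.
  rewrite !ler_norml => /andP[? ?] /andP[? ?]; apply/andP; split; lra.
- by rewrite addr0 subrr mul0r subr0 normr0 !mulr_ge0 ?powR_ge0.
Qed.

Definition zyg phi L K := [/\ 0 <= L, 0 <= K, forall w, bnd (dif w phi) (L * `|w|) &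
  forall w z, bnd (dif z (dif w phi)) (K * `|w| * `|z| `^ a)].

Lemma zyg_taylor phi L K y v : zyg phi L K ->
  is_derive y v phi ('D_v phi y) /\
  forall r, `|phi (y + r *: v) - phi y - r * 'D_v phi y| <= 2 * (K * `|v| * `|v| `^ a) * `|r| `^ (1 + a).
Proof.
move=> [L0 K0 hL hK].
have KK : 0 <= K * `|v| * `|v| `^ a by rewrite !mulr_ge0 ?powR_ge0.
have [|||q hq] := @zygmund_taylor1 (fun r => phi (y + r *: v)) (L * `|v|) _ _ KK _ _ 0.
- by rewrite mulr_ge0.
- move=> x w; have := hL (w *: v) (y + x *: v).
  by rewrite /dif normrZ scalerDl addrA (mulrC `|w|) mulrA.
- move=> x w z; have := hK (w *: v) (z *: v) (y + x *: v).
  rewrite /dif !normrZ powRM// !scalerDl !addrA.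
  rewrite (_ : K * _ * _ = K * `|v| * `|v| `^ a * `|w| * `|z| `^ a)//; ring.
have hq' r : `|phi (y + r *: v) - phi y - r * q| <= 2 * (K * `|v| * `|v| `^ a) * `|r| `^ (1 + a).
  by have := hq r; rewrite add0r scale0r addr0.
have isd : is_derive y v phi q by apply: quot_is_derive hq'; rewrite mulr_ge0.
by rewrite derive_val.
Qed.

End DirectionalCalculus.

Section SecondOrder.
Context {R : realType} {V : normedModType R} (a : R) (a01 : 0 < a < 1).
Implicit Types (phi psi : V -> R) (u v w z y : V) (M K L q r : R).

Let a_gt0 : 0 < a. Proof. by case/andP: a01. Qed.

Lemma zyg_derive_seq phi L K y v : zyg a phi L K ->
  2 ^+ n * dif (2^-1 ^+ n *: v) phi y @[n --> \oo] --> 'D_v phi y.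
Proof.
move=> zp; have [_ h] := zyg_taylor a01 y v zp; have [L0 K0 _ _] := zp.
set C := 2 * _ in h.
apply: (@cvg_norm_le _ _ _ (fun n => C * (2^-1 `^ a) ^+ n)).
  apply: cvg_geo; rewrite powR_ge0 /=; apply: powR_lt1 => //.
  by apply/andP; split; lra.
move=> n; have p0 : 0 < (2 : R) ^+ n by rewrite exprn_gt0.
pose x : R := 2^-1 ^+ n; have q0 : 0 < x by rewrite exprn_gt0 ?invr_gt0.
have px : 2 ^+ n * x = 1 by rewrite /x exprVn mulfV// expf_neq0.
have e : x `^ a = (2^-1 `^ a) ^+ n by rewrite powR_exprn ?invr_ge0.
have := h x; rewrite (gtr0_norm q0) powR1D// e => hh; rewrite /dif -/x.
have -> : 2 ^+ n * (phi (y + x *: v) - phi y) - 'D_v phi y =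
  2 ^+ n * (phi (y + x *: v) - phi y - x * 'D_v phi y).
  by rewrite [RHS]mulrBr mulrA px mul1r.
rewrite normrM (gtr0_norm p0); apply: le_trans (ler_wpM2l (ltW p0) hh) _.
by rewrite mulrCA (mulrA (2 ^+ n)) px mul1r.
Qed.

Lemma zyg_derive_seq_dif phi L K y v w : zyg a phi L K ->
  2 ^+ n * dif w (dif (2^-1 ^+ n *: v) phi) y @[n --> \oo] --> dif w ('D_v phi) y.
Proof.
move=> zp; rewrite (_ : (fun n => _) = fun n =>
  2 ^+ n * dif (2^-1 ^+ n *: v) phi (y + w) - 2 ^+ n * dif (2^-1 ^+ n *: v) phi y).
  by apply: cvgB; exact: (@zyg_derive_seq phi L K).
by apply/funext => n; rewrite -mulrBr.
Qed.

Lemma zyg_derive_le phi L K v : zyg a phi L K ->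
  bnd ('D_v phi) (L * `|v|) /\ hol a ('D_v phi) (K * `|v|).
Proof.
move=> zp; have [L0 K0 hL hK] := zp.
have nv n : 2 ^+ n * `|2^-1 ^+ n *: v| = `|v|.
  rewrite normrZ gtr0_norm ?exprn_gt0 ?invr_gt0// mulrA exprVn mulfV ?mul1r//.
have p0 n : 0 < (2 : R) ^+ n by rewrite exprn_gt0.
split=> [y|z y].
  apply: (norm_lim_le0 (@zyg_derive_seq phi L K y v zp)) => n.
  rewrite normrM (gtr0_norm (p0 n)) -(nv n) [L * _]mulrCA ler_pM2l//.
  exact: hL.
apply: (norm_lim_le0 (@zyg_derive_seq_dif phi L K y v z zp)) => n.
rewrite normrM (gtr0_norm (p0 n)) -(nv n).
rewrite (_ : K * _ * _ = 2 ^+ n * (K * `|2^-1 ^+ n *: v| * `|z| `^ a)); last by ring.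
by rewrite ler_pM2l//; exact: hK.
Qed.

Lemma zyg_deriveD phi L K y u v : zyg a phi L K -> 'D_(u + v) phi y = 'D_u phi y + 'D_v phi y.
Proof.
move=> zp; have [L0 K0 hL hK] := zp.
have [_ hu] := zyg_taylor a01 y u zp; have [_ hv] := zyg_taylor a01 y v zp.
set Cu := 2 * _ in hu; set Cv := 2 * _ in hv.
have Cu0 : 0 <= Cu by rewrite !mulr_ge0 ?powR_ge0.
have Cv0 : 0 <= Cv by rewrite !mulr_ge0 ?powR_ge0.
have Cuv0 : 0 <= K * `|v| * `|u| `^ a by rewrite !mulr_ge0 ?powR_ge0.
apply: derive_val; apply: (@quot_is_derive _ _ a a01 _ _ _ _ (Cu + Cv + K * `|v| * `|u| `^ a)).
  by rewrite !addr_ge0.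
move=> r; have := hK (r *: v) (r *: u) y; rewrite /dif !normrZ powRM//.
have [->|r0] := eqVneq r 0.
  by move=> _; rewrite !scale0r !addr0 !mul0r !subrr normr0 mulr_ge0 ?powR_ge0 ?addr_ge0.
have rp : 0 < `|r| by rewrite normr_gt0.
rewrite (_ : K * _ * _ = K * `|v| * `|u| `^ a * `|r| `^ (1 + a)); last by rewrite powR1D//; ring.
move=> h1; have h2 := hu r; have h3 := hv r.
rewrite scalerDr addrA; move: h1 h2 h3; rewrite !ler_norml => /andP[? ?] /andP[? ?] /andP[? ?].
apply/andP; split; lra.
Qed.

Lemma zyg_deriveZ phi L K y c v : zyg a phi L K -> 'D_(c *: v) phi y = c * 'D_v phi y.
Proof.
move=> zp; have [L0 K0 hL hK] := zp.
have [_ hv] := zyg_taylor a01 y v zp; set Cv := 2 * _ in hv.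
have Cv0 : 0 <= Cv by rewrite !mulr_ge0 ?powR_ge0.
apply: derive_val; apply: (@quot_is_derive _ _ a a01 _ _ _ _ (Cv * `|c| `^ (1 + a))).
  by rewrite mulr_ge0 ?powR_ge0.
move=> r; have := hv (r * c); rewrite scalerA normrM powRM//.
by rewrite [r * (c * _)]mulrA [Cv * (_ * _)]mulrA [Cv * _ * `|c| `^ _]mulrAC.
Qed.

Lemma zyg_derive_sum phi L K y (I : Type) (s : seq I) (c : I -> R) (e : I -> V) : zyg a phi L K ->
  'D_(\sum_(i <- s) c i *: e i) phi y = \sum_(i <- s) c i * 'D_(e i) phi y.
Proof.
move=> zp; elim: s => [|i s IH].
  by rewrite !big_nil -(scale0r (0 : V)) (zyg_deriveZ _ _ _ zp) mul0r.
by rewrite !big_cons (zyg_deriveD _ _ _ zp) (zyg_deriveZ _ _ _ zp) IH.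
Qed.

Lemma interp_norm (x K : R) v z : 0 <= K -> x <= K * `|v| * `|z| -> x <= 2 * (K * `|v|) ->
  x <= 2 * K * `|v| * `|z| `^ a.
Proof.
move=> K0 h1 h2; have kv : 0 <= K * `|v| by rewrite mulr_ge0.
have [z1|z1] := leP `|z| 1.
  apply: le_trans h1 _; rewrite (_ : 2 * K * _ * _ = 2 * (K * `|v| * `|z| `^ a)); last by ring.
  have [z0|z0] := eqVneq `|z| 0; first by rewrite z0 mulr0 !mulr_ge0 ?powR_ge0.
  have h : `|z| <= `|z| `^ a.
    by apply: ger1_powR; [rewrite lt0r z0 normr_ge0|case/andP: a01 => _ /ltW].
  have := ler_wpM2l kv h; have := mulr_ge0 kv (powR_ge0 `|z| a); lra.
apply: le_trans h2 _; rewrite -[2 * K * _]mulrA ler_peMr ?mulr_ge0//.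
by apply: powR_ge1; exact: ltW.
Qed.

(* [K] dominates the C^{2+a} norm of [phi], in finite-difference form. *)
Definition c2a phi K := [/\ 0 <= K, bnd phi K, forall v, bnd (dif v phi) (K * `|v|),
  forall v w, bnd (dif w (dif v phi)) (K * `|v| * `|w|) &
  forall v w z, bnd (dif z (dif w (dif v phi))) (K * `|v| * `|w| * `|z| `^ a)].

Lemma lip_zyg phi K : 0 <= K -> (forall v, bnd (dif v phi) (K * `|v|)) ->
  (forall v w, bnd (dif w (dif v phi)) (K * `|v| * `|w|)) -> zyg a phi K (2 * K).
Proof.
move=> K0 h1 h2; split=> // [|w z y]; first by rewrite mulr_ge0.
apply: interp_norm => //; first exact: h2.
rewrite {1}/dif; apply: le_trans (ler_normB _ _) _.
by have := h1 w y; have := h1 w (y + z); lra.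
Qed.

Lemma c2a_zyg phi K : c2a phi K -> zyg a phi K (2 * K).
Proof. by move=> [K0 _ h1 h2 _]; exact: lip_zyg. Qed.

Lemma difD v phi psi : dif v (fun y => phi y + psi y) = fun y => dif v phi y + dif v psi y.
Proof. by apply/funext => y; rewrite /dif; ring. Qed.

Lemma difC v w phi y : dif v (dif w phi) y = dif w (dif v phi) y.
Proof. by rewrite /dif [y + v + w]addrAC; ring. Qed.

Lemma c2a_derive_zyg phi K v : c2a phi K -> zyg a ('D_v phi) (K * `|v|) (K * `|v|).
Proof.
move=> cp; have [K0 _ h1 h2 h3] := cp; have zp := c2a_zyg cp.
have kv : 0 <= K * `|v| by rewrite mulr_ge0.
have nv n : 2 ^+ n * `|2^-1 ^+ n *: v| = `|v|.
  rewrite normrZ gtr0_norm ?exprn_gt0 ?invr_gt0// mulrA exprVn mulfV ?mul1r//.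
have p0 n : 0 < (2 : R) ^+ n by rewrite exprn_gt0.
have c w y : 2 ^+ n * dif w (dif (2^-1 ^+ n *: v) phi) y @[n --> \oo] --> dif w ('D_v phi) y.
  exact: (@zyg_derive_seq_dif phi K (2 * K)).
have c' z w y : 2 ^+ n * dif z (dif w (dif (2^-1 ^+ n *: v) phi)) y @[n --> \oo] --> dif z (dif w ('D_v phi)) y.
  rewrite [X in _ --> X](_ : _ = dif w ('D_v phi) (y + z) - dif w ('D_v phi) y)//.
  rewrite (_ : (fun n => _) = fun n => 2 ^+ n * dif w (dif (2^-1 ^+ n *: v) phi) (y + z) - 2 ^+ n * dif w (dif (2^-1 ^+ n *: v) phi) y).
    by apply: cvgB; exact: c.
  by apply/funext => n; rewrite -mulrBr.
split=> // [w y|w z y].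
  apply: (norm_lim_le0 (c w y)) => n; rewrite normrM (gtr0_norm (p0 n)) -(nv n).
  rewrite (_ : K * _ * _ = 2 ^+ n * (K * `|2^-1 ^+ n *: v| * `|w|)); last by ring.
  by rewrite ler_pM2l//; exact: h2.
apply: (norm_lim_le0 (c' z w y)) => n; rewrite normrM (gtr0_norm (p0 n)) -(nv n).
rewrite (_ : K * _ * _ * _ = 2 ^+ n * (K * `|2^-1 ^+ n *: v| * `|w| * `|z| `^ a)); last by ring.
by rewrite ler_pM2l//; exact: h3.
Qed.

Lemma c2a_taylor phi K y d : c2a phi K -> forall r,
  `|phi (y + r *: d) - phi y - r * 'D_d phi y - 2^-1 * r ^+ 2 * 'D_d ('D_d phi) y| <=
  2 * (K * `|d| * `|d| * `|d| `^ a) * `|r| `^ (2 + a).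
Proof.
move=> cp r; have [K0 _ _ _ _] := cp; have zp := c2a_zyg cp; have zb := c2a_derive_zyg d cp.
have [_ tb] := zyg_taylor a01 y d zb.
set b := 'D_d phi in zb tb *; set h := 'D_d b.
pose th x := phi (y + x *: d) - phi y - x * b y - 2^-1 * x ^+ 2 * h y.
pose dth x := b (y + x *: d) - b y - x * h y.
have hd x : is_derive (x : R) 1 th (dth x).
  have [dx _] := zyg_taylor a01 (y + x *: d) d zp.
  have dl := line_is_derive (@ex_derive _ _ _ _ _ _ _ dx).
  have -> : th = (fun x0 => phi (y + x0 *: d)) - cst (phi y) - id * cst (b y) - (id * id) * cst (2^-1 * h y).
    by apply/funext => x0; rewrite /th !fctE; ring.
  apply: is_derive_eq; rewrite /dth /=.
  rewrite -[b (y + x *: d)]/('D_d phi (y + x *: d)) !scaler0 !add0r subr0.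
  move: ('D_d phi (y + x *: d)) (b y) (h y) => A B H; rewrite /GRing.scale /= !mulr1.
  by move: A B H => A B H; field.
have th0 : th 0 = 0 by rewrite /th scale0r addr0 subrr !mul0r expr0n /= mulr0 mul0r !subr0.
have := @mvt_bound _ th dth r (2 * (K * `|d| * `|d| * `|d| `^ a) * `|r| `^ (1 + a)) _ hd _.
rewrite th0 subr0 => hh; apply: le_trans (hh _ _) _.
- by rewrite !mulr_ge0 ?powR_ge0.
- move=> x xr; apply: le_trans (tb x) _; apply: ler_wpM2l; first by rewrite !mulr_ge0 ?powR_ge0.
  by apply: ge0_ler_powR; rewrite ?nnegrE// addr_ge0// ltW.
have [->|r0] := eqVneq r 0; first by rewrite normr0 mulr0 !mulr_ge0 ?powR_ge0.
have rp : 0 < `|r| by rewrite normr_gt0.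
rewrite (_ : 2 + a = 1 + (1 + a)); last by ring.
by rewrite (powR1D (1 + a) rp) le_eqVlt; apply/orP; left; apply/eqP; ring.
Qed.

End SecondOrder.

Section LinearProblem.
Context {R : realType} {V : normedModType R} (a : R) (a01 : 0 < a < 1).
Context (P : R -> R -> (V -> R) -> V -> R) (C1 C2 : R) (ev : evolution a P C1 C2).
Context (C3 : R) (C30 : 0 <= C3).
Hypothesis smooth : forall r s f M K N M', tame a f M K N ->
  0 <= r -> r <= s -> s <= 1 -> 0 <= M' ->
  (forall q, r <= q <= s -> bnd (f q) M') ->
  (forall w, bnd (dif w (duh P r s f)) (C3 * M' * `|w| * Num.sqrt (s - r))) /\
  (forall w z, bnd (dif z (dif w (duh P r s f))) (C3 * M' * `|w| * `|z| `^ a)).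
Implicit Types (phi psi g : V -> R) (v w z y : V) (M K N s t r : R) (f : R -> V -> R).

Let b20 : 0 <= a / 2. Proof. by case/andP: a01 => ? ?; lra. Qed.

Definition mild g f T t y : R := P t T g y + duh P t T f y.

Lemma le_powR01 (x b : R) : 0 <= x <= 1 -> 0 < b <= 1 -> x <= x `^ b.
Proof.
move=> /andP[x0 x1] /andP[b0 b1].
have [->|xn] := eqVneq x 0; first exact: powR_ge0.
by apply: ger1_powR => //; rewrite lt0r xn x0.
Qed.

Lemma sqrt_le_powR (x : R) : 0 <= x <= 1 -> Num.sqrt x <= x `^ (a / 2).
Proof.
move=> /andP[x0 x1]; rewrite -powR12_sqrt//.
have [->|xn] := eqVneq x 0; first by rewrite powR0 ?powR_ge0// invr_eq0.
apply: ger_powR; first by rewrite lt0r xn x0.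
by case/andP: a01 => ? ?; lra.
Qed.

Section FixedForcing.
Context (g : V -> R) (f : R -> V -> R) (T M K N L : R) (T0 : 0 <= T) (T1 : T <= 1).
Hypothesis rg : reg a g.
Hypothesis tf : tame a f M K N.
Hypothesis L0 : 0 <= L.
Hypothesis fL : forall s v, bnd (dif v (f s)) (L * `|v|).

Lemma mild_reg t : 0 <= t -> t <= T -> reg a (mild g f T t).
Proof.
move=> t0 tT; have := reg_lin 1 1 (reg_ev ev t T rg) (reg_duh a01 ev tf t0 tT T1).
by congr reg; apply/funext => y; rewrite !mul1r.
Qed.

Lemma mild_end y : mild g f T T y = g y.
Proof.
rewrite /mild (ev_le ev)//; have [M0 K0 N0 h1 h2] := tf.
have := duh_bnd a01 ev tf T0 (lexx T) T1 M0 (fun q _ => proj1 (h1 q)) y.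
by rewrite subrr mul0r normr_le0 => /eqP ->; rewrite addr0.
Qed.

Lemma mild_flow t s y : 0 <= t -> t <= s -> s <= T ->
  mild g f T t y = P t s (mild g f T s) y + duh P t s f y.
Proof.
move=> t0 ts sT; have s0 := le_trans t0 ts.
rewrite /mild (duh_flow a01 ev y tf t0 ts sT T1).
rewrite (_ : (fun y => _ + _) = fun y => 1 * P s T g y + 1 * duh P s T f y); last first.
  by apply/funext => z; rewrite !mul1r.
rewrite (ev_lin ev); [|exact: (reg_ev ev)|exact: (reg_duh a01 ev tf)].
by rewrite !mul1r (ev_semi ev)//; ring.
Qed.

Lemma mild_dif t v y : 0 <= t -> t <= T ->
  dif v (mild g f T t) y = P t T (dif v g) y + duh P t T (fun q => dif v (f q)) y.
Proof.
move=> t0 tT; rewrite (duh_dif a01 ev v y tf)// (ev_dif ev)// /dif /mild; ring.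
Qed.

Lemma mild_dif_fun t v : 0 <= t -> t <= T ->
  dif v (mild g f T t) = fun y => P t T (dif v g) y + duh P t T (fun q => dif v (f q)) y.
Proof. by move=> t0 tT; apply/funext => y; exact: mild_dif. Qed.

Lemma mild_flow_dif t s v : 0 <= t -> t <= s -> s <= T ->
  dif v (mild g f T t) = fun y => P t s (dif v (mild g f T s)) y + duh P t s (fun q => dif v (f q)) y.
Proof.
move=> t0 ts sT; have s0 := le_trans t0 ts; apply/funext => y.
rewrite (duh_dif a01 ev v y tf)//; last exact: le_trans T1.
rewrite (ev_dif ev); last exact: mild_reg.
by rewrite /dif !(@mild_flow t s)//; ring.
Qed.

Lemma mild_bnd t Mg : 0 <= t -> t <= T -> bnd g Mg -> bnd (mild g f T t) (Mg + M).
Proof.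
move=> t0 tT bg y; have [M0 K0 N0 h1 h2] := tf.
apply: le_trans (ler_normD _ _) _; apply: lerD; first exact: (ev_bnd ev).
apply: le_trans (duh_bnd a01 ev tf t0 tT T1 M0 (fun q _ => proj1 (h1 q)) y) _.
by apply: ler_piMl => //; have := T1; lra.
Qed.

Lemma mild_dif1 t G v : 0 <= t -> t <= T -> bnd (dif v g) (G * `|v|) ->
  bnd (dif v (mild g f T t)) ((G + (T - t) * L) * `|v|).
Proof.
move=> t0 tT bg y; rewrite mild_dif//; have [M' [K' [N' tv]]] := tame_dif v tf.
apply: le_trans (ler_normD _ _) _; rewrite mulrDl; apply: lerD.
  by apply: (ev_bnd ev) => //; exact: reg_dif.
by rewrite -mulrA; apply: (duh_bnd a01 ev tv) => //; rewrite mulr_ge0.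
Qed.

Lemma mild_dif2 t G v w : 0 <= t -> t <= T -> bnd (dif w (dif v g)) (G * `|v| * `|w|) ->
  bnd (dif w (dif v (mild g f T t))) ((G + C3 * L * Num.sqrt (T - t)) * `|v| * `|w|).
Proof.
move=> t0 tT bg y; rewrite mild_dif_fun//; have [M' [K' [N' tv]]] := tame_dif v tf.
rewrite difD.
apply: le_trans (ler_normD _ _) _.
rewrite (_ : _ * `|w| = G * `|v| * `|w| + C3 * (L * `|v|) * `|w| * Num.sqrt (T - t)); last by ring.
apply: lerD.
  rewrite -(ev_dif ev); last exact: reg_dif.
  by apply: (ev_bnd ev) => //; apply: reg_dif; exact: reg_dif.
have [h _] := smooth tv t0 tT T1 (mulr_ge0 L0 (normr_ge0 v)) (fun q _ => fL q v).
exact: h.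
Qed.

Lemma mild_dif3 t G v w z : 0 <= t -> t <= T ->
  bnd (dif z (dif w (dif v g))) (G * `|v| * `|w| * `|z| `^ a) ->
  bnd (dif z (dif w (dif v (mild g f T t)))) ((G + C3 * L) * `|v| * `|w| * `|z| `^ a).
Proof.
move=> t0 tT bg y; rewrite mild_dif_fun//; have [M' [K' [N' tv]]] := tame_dif v tf.
rewrite 2!difD.
apply: le_trans (ler_normD _ _) _.
rewrite (_ : _ * `|z| `^ a = G * `|v| * `|w| * `|z| `^ a + C3 * (L * `|v|) * `|w| * `|z| `^ a); last by ring.
have rv := reg_dif v rg; have rw := reg_dif w rv.
apply: lerD.
  rewrite -(ev_dif ev)// -(ev_dif ev)//.
  by apply: (ev_bnd ev) => //; exact: reg_dif.
have [_ h] := smooth tv t0 tT T1 (mulr_ge0 L0 (normr_ge0 v)) (fun q _ => fL q v).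
exact: h.
Qed.

Lemma mild_c2a t G : 0 <= t -> t <= T -> c2a a g G -> c2a a (mild g f T t) (G + M + L + C3 * L).
Proof.
move=> t0 tT [G0 g0 g1 g2 g3]; have [M0 _ _ _ _] := tf; have l0 := L0.
have c3 : 0 <= C3 * L by rewrite mulr_ge0.
have T01 : 0 <= T - t <= 1 by have ? := T1; apply/andP; split; lra.
have wk (p q x A : R) : 0 <= x -> p <= A * x -> A <= q -> p <= q * x.
  by move=> x0 pA Aq; apply: le_trans pA _; exact: ler_wpM2r.
split; first by rewrite !addr_ge0.
- by move=> y; apply: le_trans (mild_bnd t0 tT g0 y) _; lra.
- move=> v y; apply: (wk _ _ _ _ _ (mild_dif1 t0 tT (g1 v) y)) => //.
  have : (T - t) * L <= 1 * L by apply: ler_wpM2r => //; case/andP: T01.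
  lra.
- move=> v w y; rewrite -mulrA.
  apply: (wk _ _ _ (G + C3 * L * Num.sqrt (T - t))); first by rewrite mulr_ge0.
    by rewrite mulrA; exact: mild_dif2.
  have : C3 * L * Num.sqrt (T - t) <= C3 * L * 1.
    by apply: ler_wpM2l => //; rewrite -[leRHS]sqrtr1 ler_wsqrtr//; case/andP: T01.
  lra.
- move=> v w z y; rewrite -!mulrA.
  apply: (wk _ _ _ (G + C3 * L)); first by rewrite !mulr_ge0 ?powR_ge0.
    by rewrite !mulrA; exact: mild_dif3.
  lra.
Qed.

Lemma mild_time s t G G' : 0 <= t -> t <= s -> s <= T -> 0 <= G -> 0 <= G' ->
  (forall v, bnd (dif v (mild g f T s)) (G * `|v|)) ->
  (forall v w, bnd (dif w (dif v (mild g f T s))) (G' * `|v| * `|w|)) ->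
  forall v, bnd (fun y => dif v (mild g f T t) y - dif v (mild g f T s) y)
    ((2 * C2 * (G + G') + L) * `|v| * (s - t) `^ (a / 2)).
Proof.
move=> t0 ts sT G0 G'0 h1 h2 v y; have s0 := le_trans t0 ts.
have rs := mild_reg s0 sT; have rv := reg_dif v rs.
have [M' [K' [N' tv]]] := tame_dif v tf.
rewrite (mild_flow_dif v t0 ts sT).
have hh : hol a (dif v (mild g f T s)) (2 * (G + G') * `|v|).
  move=> z x; apply: (interp_norm a01); first exact: addr_ge0.
    apply: le_trans (h2 v z x) _; apply: ler_wpM2r => //; apply: ler_wpM2r => //; lra.
  rewrite {1}/dif; apply: le_trans (ler_normB _ _) _.
  have k1 := h1 v x; have k2 := h1 v (x + z).
  have : 0 <= G' * `|v| by rewrite mulr_ge0.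
  by move: k1 k2; rewrite mulrDl; lra.
have st1 : 0 <= s - t <= 1 by have ? := T1; apply/andP; split; lra.
have m1 := ev_moment ev ts rv _ hh y.
have m2 := duh_bnd a01 ev tv t0 ts (le_trans sT T1) (mulr_ge0 L0 (normr_ge0 v)) (fun q _ => fL q v) y.
rewrite addrAC; apply: le_trans (ler_normD _ _) _.
rewrite (_ : _ * (s - t) `^ _ = C2 * (2 * (G + G') * `|v|) * (s - t) `^ (a / 2) + (s - t) `^ (a / 2) * (L * `|v|)); last by ring.
apply: lerD; first by apply: m1; rewrite !mulr_ge0 ?addr_ge0.
apply: le_trans m2 _; apply: ler_wpM2r; first by rewrite mulr_ge0.
by apply: le_powR01 => //; case/andP: a01 => ? ?; apply/andP; split; lra.
Qed.

Lemma mild_time2 s t G : 0 <= t -> t <= s -> s <= T -> c2a a (mild g f T s) G ->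
  forall v w, bnd (fun y => dif w (dif v (mild g f T t)) y - dif w (dif v (mild g f T s)) y)
    ((C2 * G + C3 * L) * `|v| * `|w| * (s - t) `^ (a / 2)).
Proof.
move=> t0 ts sT [G0 _ _ _ h3] v w y; have s0 := le_trans t0 ts; have s1 := le_trans sT T1.
have rs := mild_reg s0 sT; have rv := reg_dif v rs; have rw := reg_dif w rv.
have [M' [K' [N' tv]]] := tame_dif v tf.
rewrite (mild_flow_dif v t0 ts sT) difD -(ev_dif ev)//.
have st1 : 0 <= s - t <= 1 by have ? := T1; apply/andP; split; lra.
have m1 := ev_moment ev ts rw _ (h3 v w) y.
have [m2 _] := smooth tv t0 ts s1 (mulr_ge0 L0 (normr_ge0 v)) (fun q _ => fL q v).
rewrite addrAC; apply: le_trans (ler_normD _ _) _.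
rewrite (_ : _ * (s - t) `^ _ = C2 * (G * `|v| * `|w|) * (s - t) `^ (a / 2) + C3 * (L * `|v|) * `|w| * (s - t) `^ (a / 2)); last by ring.
apply: lerD; first by apply: m1; rewrite !mulr_ge0.
apply: le_trans (m2 w y) _; apply: ler_wpM2l; first by rewrite !mulr_ge0.
exact: sqrt_le_powR.
Qed.

Lemma c2a_hol phi G : c2a a phi G -> hol a phi (2 * G).
Proof.
move=> [G0 h0 h1 _ _] z y; have [z1|z1] := leP `|z| 1.
  apply: le_trans (h1 z y) _.
  have := ler_wpM2l G0 (@le_powR01 `|z| a _ _).
  rewrite normr_ge0 z1 => /(_ isT); case/andP: a01 => a0 a1; rewrite a0 ltW// => /(_ isT).
  have := mulr_ge0 G0 (powR_ge0 `|z| a); lra.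
apply: (@le_trans _ _ (2 * G)).
  rewrite /dif; apply: le_trans (ler_normB _ _) _.
  by have := h0 y; have := h0 (y + z); lra.
rewrite ler_peMr ?mulr_ge0//; apply: powR_ge1; first exact: ltW.
by case/andP: a01 => /ltW.
Qed.

Lemma mild_time0 s t G : 0 <= t -> t <= s -> s <= T -> c2a a (mild g f T s) G ->
  bnd (fun y => mild g f T t y - mild g f T s y) ((2 * C2 * G + M) * (s - t) `^ (a / 2)).
Proof.
move=> t0 ts sT cs y; have s0 := le_trans t0 ts; have s1 := le_trans sT T1.
have [G0 _ _ _ _] := cs; have [M0 K0 N0 h1 h2] := tf.
rewrite (@mild_flow t s)// addrAC; apply: le_trans (ler_normD _ _) _.
rewrite (_ : _ * _ `^ _ = C2 * (2 * G) * (s - t) `^ (a / 2) + (s - t) `^ (a / 2) * M); last by ring.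
have st1 : 0 <= s - t <= 1 by have ? := T1; apply/andP; split; lra.
apply: lerD.
  by apply: (ev_moment ev ts (mild_reg s0 sT) _ (c2a_hol cs)); rewrite mulr_ge0.
apply: le_trans (duh_bnd a01 ev tf t0 ts s1 M0 (fun q _ => proj1 (h1 q)) y) _.
apply: ler_wpM2r => //; apply: le_powR01 => //; case/andP: a01 => ? ?; apply/andP; split; lra.
Qed.

Lemma mild_expand s t : 0 <= t -> t <= s -> s <= T ->
  bnd (fun y => mild g f T t y - P t s (mild g f T s) y - (s - t) * f s y)
    (2 * (C2 * K + N) * (s - t) `^ (1 + a / 2)).
Proof.
move=> t0 ts sT y; rewrite (@mild_flow t s)//.
rewrite (_ : _ - _ - _ = duh P t s f y - (s - t) * f s y); last by ring.
by apply: (duh_small a01 ev tf) => //; exact: le_trans T1.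
Qed.

End FixedForcing.

Lemma mild_sub g f f' T M K N M' K' N' t D : 0 <= t -> t <= T -> T <= 1 ->
  tame a f M K N -> tame a f' M' K' N' -> 0 <= D ->
  (forall q, t <= q <= T -> bnd (fun y => f q y - f' q y) D) ->
  bnd (fun y => mild g f T t y - mild g f' T t y) ((T - t) * D) /\
  forall w, bnd (fun y => dif w (mild g f T t) y - dif w (mild g f' T t) y) (C3 * D * `|w| * Num.sqrt (T - t)).
Proof.
move=> t0 tT T1 tf tf' D0 h.
have tl := tame_lin 1 (-1) tf tf'.
have E y : mild g f T t y - mild g f' T t y = duh P t T (fun q y => 1 * f q y + -1 * f' q y) y.
  by rewrite (duh_lin a01 ev 1 (-1) y tf tf')// /mild; ring.
have hl q : t <= q <= T -> bnd (fun y => 1 * f q y + -1 * f' q y) D.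
  by move=> hq y; rewrite mul1r mulN1r; exact: h.
split=> [y|w y]; first by rewrite E; exact: (duh_bnd a01 ev tl).
have [s1 _] := smooth tl t0 tT T1 D0 hl.
have := s1 w y; congr (`|_| <= _); rewrite /dif -!E; ring.
Qed.

End LinearProblem.

Section Coordinates.
Context {R : realType} {D : nat} (a : R) (a01 : 0 < a < 1).
Local Notation V := 'cV[R]_D.
Implicit Types (phi psi : V -> R) (v w z y : V) (M K : R) (k l : 'I_D).

Lemma coord_le v k : `|v k 0| <= `|v|.
Proof.
rewrite [`|v|]mx_normrE.
by have := le_bigmax 0 (fun ij : 'I_D * 'I_1 => `|v ij.1 ij.2|) (k, 0).
Qed.

Lemma norm_le_coord v B : 0 <= B -> (forall k, `|v k 0| <= B) -> `|v| <= B.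
Proof.
move=> B0 h; rewrite [`|v|]mx_normrE; apply: bigmax_le => // -[i j] _ /=.
by rewrite (ord1 j); exact: h.
Qed.

Lemma norm_ecoord k : `|ecoord R k| <= 1.
Proof.
apply: norm_le_coord => // i; rewrite /ecoord mxE.
by case: (_ && _); rewrite ?normr1 ?normr0.
Qed.

Lemma coord_sum v : v = \sum_k v k 0 *: ecoord R k.
Proof.
rewrite {1}[v]matrix_sum_delta; apply: eq_bigr => i _.
by rewrite big_ord1.
Qed.

Lemma norm_le_enorm v : `|v| <= enorm v.
Proof.
apply: norm_le_coord => [|k]; first exact: sqrtr_ge0.
rewrite -sqrtr_sqr /enorm; apply: ler_wsqrtr; rewrite /sqnorm (bigD1 k)//=.
by rewrite lerDl sumr_ge0// => i _; exact: sqr_ge0.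
Qed.

Lemma enorm_le_norm v : enorm v <= D%:R * `|v|.
Proof.
have B0 : 0 <= D%:R * `|v| by rewrite mulr_ge0.
rewrite -[leRHS](ger0_norm B0) -sqrtr_sqr /enorm; apply: ler_wsqrtr.
apply: (@le_trans _ _ (\sum_(i < D) `|v| ^+ 2)).
  apply: ler_sum => i _; rewrite -(real_normK (num_real (v i 0))).
  by apply: lerXn2r; rewrite ?nnegrE// coord_le.
rewrite sumr_const card_ord -[_ *+ D]mulr_natl exprMn; apply: ler_wpM2r; first exact: sqr_ge0.
case: (D) => [|n]; first by rewrite expr0n.
by rewrite expr2 ler_peMl// ler1n.
Qed.

Lemma hessE phi y k l : hess phi y k l = pd (pd phi l) k y.
Proof. by rewrite mxE. Qed.

Lemma zyg_derive_coord phi L K d y : zyg a phi L K -> 'D_d phi y = \sum_k d k 0 * pd phi k y.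
Proof.
move=> zp; have := zyg_derive_sum a01 y (index_enum 'I_D) (fun k => d k 0) (@ecoord R D) zp.
by rewrite -coord_sum.
Qed.

Lemma derive_dif phi y e v : derivable phi (y + v) e -> derivable phi y e ->
  derivable (dif v phi) y e /\ 'D_e (dif v phi) y = dif v ('D_e phi) y.
Proof.
move=> d1 d2.
have E : (fun h : R => h^-1 *: (((transl v phi) \o shift y) (h *: e) - transl v phi y)) =
         (fun h : R => h^-1 *: ((phi \o shift (y + v)) (h *: e) - phi (y + v))).
  by apply/funext => h /=; rewrite /transl addrA.
have i1 : is_derive y e (transl v phi) ('D_e phi (y + v)).
  by apply: DeriveDef; rewrite /derivable /derive E.
have i2 : is_derive y e phi ('D_e phi y) by exact: DeriveDef.
have i3 : is_derive y e (dif v phi) ('D_e phi (y + v) - 'D_e phi y).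
  exact: (is_deriveB i1 i2).
by split; [exact: (@ex_derive _ _ _ _ _ _ _ i3)|rewrite derive_val].
Qed.

Lemma lip_of_pd phi M : 0 <= M -> (forall k y, derivable phi y (ecoord R k)) ->
  (forall k y, `|pd phi k y| <= M) -> forall w, bnd (dif w phi) (D%:R * M * `|w|).
Proof.
move=> M0 hd hM w y; rewrite {1}[w]coord_sum.
apply: le_trans (@bnd_dif_sum _ _ _ _ _ (fun k => M * `|w k 0|) phi _ y) _.
  by move=> k; apply: dif_le_derive => // x; exact: hM.
apply: (@le_trans _ _ (\sum_(k < D) M * `|w|)).
  by apply: ler_sum => k _; rewrite ler_wpM2l// coord_le.
by rewrite sumr_const card_ord -[_ *+ D]mulr_natl mulrA.
Qed.

Lemma dif2_of_hess phi B : 0 <= B -> (forall k y, derivable phi y (ecoord R k)) ->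
  (forall k l y, derivable (pd phi l) y (ecoord R k)) ->
  (forall k l y, `|hess phi y k l| <= B) ->
  forall v w, bnd (dif w (dif v phi)) (D%:R ^+ 2 * B * `|v| * `|w|).
Proof.
move=> B0 h1 h2 hB v w y.
have dv k x := derive_dif (h1 k (x + v)) (h1 k x).
have := @lip_of_pd (dif v phi) (D%:R * B * `|v|) _ (fun k x => proj1 (dv k x)) _ w y.
rewrite (_ : D%:R * _ * `|w| = D%:R ^+ 2 * B * `|v| * `|w|); last by ring.
apply; first by rewrite !mulr_ge0.
move=> k x; rewrite /pd (proj2 (dv k x)).
apply: (@lip_of_pd (pd phi k)) => // l x'.
by have := hB l k x'; rewrite hessE.
Qed.

Lemma c2a_of_hess phi M0 M1 M2 K : 0 <= M0 -> 0 <= M1 -> 0 <= M2 -> 0 <= K ->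
  bnd phi M0 -> (forall k y, derivable phi y (ecoord R k)) ->
  (forall k l y, derivable (pd phi l) y (ecoord R k)) ->
  (forall k y, `|pd phi k y| <= M1) -> (forall k l y, `|hess phi y k l| <= M2) ->
  (forall k l x y, `|hess phi x k l - hess phi y k l| <= K * `|x - y| `^ a) ->
  c2a a phi (M0 + D%:R * M1 + D%:R ^+ 2 * M2 + D%:R ^+ 2 * K).
Proof.
move=> M00 M10 M20 K0 b0 h1 h2 b1 b2 b3.
have d0 : 0 <= D%:R :> R by rewrite ler0n.
have A1 : 0 <= D%:R * M1 by rewrite mulr_ge0.
have A2 : 0 <= D%:R ^+ 2 * M2 by rewrite mulr_ge0 ?exprn_ge0.
have A3 : 0 <= D%:R ^+ 2 * K by rewrite mulr_ge0 ?exprn_ge0.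
have wk (p q x A : R) : 0 <= x -> p <= A * x -> A <= q -> p <= q * x.
  by move=> x0 pA Aq; apply: le_trans pA _; exact: ler_wpM2r.
split; first by rewrite !addr_ge0.
- by move=> y; apply: le_trans (b0 y) _; lra.
- move=> v y; apply: (wk _ _ _ (D%:R * M1)) => //; first exact: lip_of_pd.
  lra.
- move=> v w y; rewrite -mulrA; apply: (wk _ _ _ (D%:R ^+ 2 * M2)); first by rewrite mulr_ge0.
    by rewrite mulrA; exact: dif2_of_hess.
  lra.
- move=> v w z y; rewrite -!mulrA; apply: (wk _ _ _ (D%:R ^+ 2 * K)); first by rewrite !mulr_ge0 ?powR_ge0.
    have dz k x := derive_dif (h1 k (x + z)) (h1 k x).
    have pdE l : pd (dif z phi) l = dif z (pd phi l).
      by apply/funext => x; rewrite /pd (proj2 (dz l x)).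
    have dz2 k l x := derive_dif (h2 k l (x + z)) (h2 k l x).
    have := @dif2_of_hess (dif z phi) (K * `|z| `^ a) _ (fun k x => proj1 (dz k x)) _ _ v w y.
    have -> : dif w (dif v (dif z phi)) y = dif z (dif w (dif v phi)) y.
      rewrite (_ : dif v (dif z phi) = dif z (dif v phi)); last by apply/funext => x; rewrite difC.
      by rewrite difC.
    rewrite (_ : D%:R ^+ 2 * _ * _ * _ = D%:R ^+ 2 * K * (`|v| * (`|w| * `|z| `^ a))); last by ring.
    apply.
    + by rewrite mulr_ge0 ?powR_ge0.
    + by move=> k l x; rewrite pdE; exact: (proj1 (dz2 k l x)).
    + move=> k l x; rewrite hessE pdE /pd (proj2 (dz2 k l x)).
      by have := b3 k l (x + z) x; rewrite !hessE [x + z]addrC addrK [z + x]addrC.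
  lra.
Qed.

Lemma c2a_pd phi K : c2a a phi K ->
  [/\ forall k y, derivable phi y (ecoord R k),
      forall k l y, derivable (pd phi l) y (ecoord R k),
      forall k, bnd (pd phi k) K,
      forall k w, bnd (dif w (pd phi k)) (K * `|w|) &
      forall k l, bnd (fun y => hess phi y k l) K /\
        forall w, bnd (dif w (fun y => hess phi y k l)) (K * `|w| `^ a)].
Proof.
move=> cp; have [K0 _ _ _ _] := cp; have zp := c2a_zyg a01 cp.
have e1 k : K * `|ecoord R k| <= K by rewrite ler_piMr// norm_ecoord.
split.
- by move=> k y; have [i _] := zyg_taylor a01 y (ecoord R k) zp; exact: (@ex_derive _ _ _ _ _ _ _ i).
- move=> k l y; have [i _] := zyg_taylor a01 y (ecoord R k) (c2a_derive_zyg a01 (ecoord R l) cp).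
  exact: (@ex_derive _ _ _ _ _ _ _ i).
- by move=> k y; have [h _] := zyg_derive_le a01 (ecoord R k) zp; exact: le_trans (h y) _.
- move=> k w y; have [_ _ h _] := c2a_derive_zyg a01 (ecoord R k) cp.
  by apply: le_trans (h w y) _; apply: ler_wpM2r.
- move=> k l; have [h1 h2] := zyg_derive_le a01 (ecoord R k) (c2a_derive_zyg a01 (ecoord R l) cp).
  have e2 : K * `|ecoord R l| * `|ecoord R k| <= K.
    by apply: le_trans (e1 l); rewrite ler_piMr ?mulr_ge0 ?norm_ecoord.
  have -> : (fun y => hess phi y k l) = 'D_(ecoord R k) ('D_(ecoord R l) phi).
    by apply/funext => y; rewrite hessE.
  split=> [y|w y]; first exact: le_trans (h1 y) _.
  by apply: le_trans (h2 w y) _; apply: ler_wpM2r; rewrite ?powR_ge0.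
Qed.

Lemma c2a_derive2 phi K d y : c2a a phi K ->
  'D_d ('D_d phi) y = \sum_k \sum_l d k 0 * d l 0 * hess phi y k l.
Proof.
move=> cp; have zp := c2a_zyg a01 cp; have zd := c2a_derive_zyg a01 d cp.
rewrite (zyg_derive_coord d y zd); apply: eq_bigr => k _; rewrite /pd.
have -> : 'D_d phi = \sum_(l < D) (d l 0 *: pd phi l).
  apply/funext => x; rewrite (zyg_derive_coord d x zp).
  by rewrite fct_sumE; apply: eq_bigr => l _.
have [_ h2 _ _ _] := c2a_pd cp.
have is2 l : is_derive y (ecoord R k) (d l 0 *: pd phi l) (d l 0 *: hess phi y k l).
  apply: is_deriveZ; apply: DeriveDef; first exact: h2.
  by rewrite hessE.
have -> : 'D_(ecoord R k) (\sum_(l < D) (d l 0 *: pd phi l)) y = \sum_(l < D) d l 0 *: hess phi y k l.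
  by have i := is_derive_sum is2; rewrite derive_val.
by rewrite mulr_sumr; apply: eq_bigr => l _; rewrite mulrA.
Qed.

End Coordinates.

(** * The evolution family of a Hoelder continuous matrix *)

Section HolderCoefficients.
Context {R : realType} (a : R) (a01 : 0 < a < 1).
Implicit Types (c h : R -> R).

Definition hc01 h := exists2 K : R, 0 <= K &
  forall t s, 0 <= t <= 1 -> 0 <= s <= 1 -> `|h t - h s| <= K * `|t - s| `^ a.

Let a_gt0 : 0 < a. Proof. by case/andP: a01. Qed.

Lemma dist01 (t s : R) : 0 <= t <= 1 -> 0 <= s <= 1 -> `|t - s| <= 1.
Proof.
by move=> /andP[? ?] /andP[? ?]; rewrite ler_norml; apply/andP; split; lra.
Qed.

Lemma hc01_bnd h : hc01 h -> exists2 B : R, 0 <= B & forall t, 0 <= t <= 1 -> `|h t| <= B.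
Proof.
move=> [K K0 hK]; exists (`|h 0| + K) => [|t t01]; first by rewrite addr_ge0.
have z01 : 0 <= (0 : R) <= 1 by rewrite lexx ler01.
have := hK t 0 t01 z01.
have : `|t - 0| `^ a <= 1 by apply: powR_le1; rewrite ?normr_ge0 ?dist01 ?(ltW a_gt0).
move=> p1 h1; have {h1} h1 : `|h t - h 0| <= K by apply: le_trans h1 _; rewrite ler_piMr.
rewrite -[h t](subrK (h 0)) addrC; apply: le_trans (ler_normD _ _) _.
by rewrite lerD2l.
Qed.

Lemma hc01_cst x : hc01 (fun=> x).
Proof. by exists 0 => // t s _ _; rewrite subrr normr0 mul0r. Qed.

Lemma hc01_add h c : hc01 h -> hc01 c -> hc01 (fun t => h t + c t).
Proof.
move=> [K K0 hK] [K' K0' hK']; exists (K + K') => [|t s t01 s01]; first exact: addr_ge0.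
rewrite opprD addrACA mulrDl; apply: le_trans (ler_normD _ _) _.
by apply: lerD; [exact: hK|exact: hK'].
Qed.

Lemma hc01_mul h c : hc01 h -> hc01 c -> hc01 (fun t => h t * c t).
Proof.
move=> hh hc'; have [B B0 hB] := hc01_bnd hh; have [B' B0' hB'] := hc01_bnd hc'.
have [K K0 hK] := hh; have [K' K0' hK'] := hc'.
exists (B * K' + K * B') => [|t s t01 s01]; first by rewrite addr_ge0 ?mulr_ge0.
rewrite (_ : _ - _ = h t * (c t - c s) + (h t - h s) * c s); last by ring.
apply: le_trans (ler_normD _ _) _; rewrite !normrM mulrDl; apply: lerD.
  by rewrite -mulrA; apply: ler_pM => //; [exact: hB|exact: hK'].
by rewrite mulrAC; apply: ler_pM => //; [exact: hK|exact: hB'].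
Qed.

Lemma hc01_sum (I : Type) (r : seq I) (F : I -> R -> R) :
  (forall i, hc01 (F i)) -> hc01 (fun t => \sum_(i <- r) F i t).
Proof.
move=> hF; elim: r => [|i r IH].
  rewrite (_ : (fun t => _) = fun=> 0); first exact: hc01_cst.
  by apply/funext => t; rewrite big_nil.
rewrite (_ : (fun t => _) = fun t => F i t + \sum_(i <- r) F i t); first exact: hc01_add.
by apply/funext => t; rewrite big_cons.
Qed.

Lemma hc01_uniform (I : finType) (F : I -> R -> R) : (forall i, hc01 (F i)) ->
  exists2 K : R, 0 <= K & forall i t s, 0 <= t <= 1 -> 0 <= s <= 1 ->
    `|F i t - F i s| <= K * `|t - s| `^ a.
Proof.
move=> hF.
have /choice[k hk] : forall i, exists K, 0 <= K /\ forall t s, 0 <= t <= 1 -> 0 <= s <= 1 ->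
    `|F i t - F i s| <= K * `|t - s| `^ a.
  by move=> i; have [K K0 h] := hF i; exists K.
have k0 i : 0 <= k i by have [] := hk i.
exists (\sum_i k i) => [|i t s t01 s01]; first by apply: sumr_ge0 => i _.
have [_ h] := hk i; apply: le_trans (h t s t01 s01) _.
apply: ler_wpM2r; first exact: powR_ge0.
by rewrite (bigD1 i)//= lerDl sumr_ge0.
Qed.

Definition clamp (T x : R) := Num.max 0 (Num.min x T).

Lemma clamp_itv T x : 0 <= T -> 0 <= clamp T x <= T.
Proof.
move=> T0; rewrite /clamp le_max lexx /= ge_max T0 /=.
by rewrite ge_min lexx orbT.
Qed.

Lemma clamp_id T x : 0 <= x <= T -> clamp T x = x.
Proof. by move=> /andP[x0 xT]; rewrite /clamp min_l// max_r. Qed.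

Lemma clamp_lip T x y : 0 <= T -> `|clamp T x - clamp T y| <= `|x - y|.
Proof.
move=> T0; rewrite /clamp.
have [|] := leP x T => h1; have [|] := leP y T => h2;
  have [|] := leP 0 x => h3; have [|] := leP 0 y => h4;
  have := ler_norm (x - y); have := ler_norm (- (x - y)); rewrite normrN => h5 h6;
  rewrite ?(max_l T0) ?(max_r T0) ?(max_l (ltW h3)) ?(max_l (ltW h4)) ?(max_r h3) ?(max_r h4);
  rewrite ler_norml; apply/andP; split; lra.
Qed.

Lemma clamp_mono T x y : x <= y -> clamp T x <= clamp T y.
Proof.
move=> xy; rewrite /clamp ge_max !le_max lexx /= ge_min le_min.
have [xT|Tx] := leP x T; last by rewrite lexx (le_trans (ltW Tx) xy) !orbT.
by rewrite xy xT orbT.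
Qed.

Lemma holder_primitive c K : 0 <= K -> (forall t s, `|c t - c s| <= K * `|t - s| `^ a) ->
  exists F : R -> R, forall t s, 0 <= t -> t <= s -> s <= 1 ->
    exists2 x, t <= x <= s & F s - F t = c x * (s - t).
Proof.
move=> K0 hK.
have cc : continuous c.
  move=> x; apply/cvgrPdist_le => e e0; near=> y.
  apply: le_trans (hK x y) _; have K1 : 0 < K + 1 by lra.
  apply: (@le_trans _ _ (K * (e / (K + 1)))); last first.
    by rewrite mulrA ler_pdivrMr// mulrC ler_pM2l//; lra.
  apply: ler_wpM2l => //.
  have -> : e / (K + 1) = ((e / (K + 1)) `^ a^-1) `^ a.
    by rewrite -powRrM mulVf ?gt_eqF// powRr1// divr_ge0 ?ltW.
  apply: ge0_ler_powR; rewrite ?nnegrE ?powR_ge0 ?(ltW a_gt0)//.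
  near: y; apply: cvgr_dist_le; first exact: cvg_id.
  by apply: powR_gt0; apply: divr_gt0 => //; lra.
pose F (x : R) : R := \int[lebesgue_measure]_(t in `[(-1), x]) c t.
exists F => t s t0 ts s1.
have dF x : -1 < x -> x < 2 -> is_derive (x : R) 1 F (c x).
  move=> x1 x2.
  have [d e] : derivable F x 1 /\ derive1 F x = c x.
    apply: (@continuous_FTC1_closed R c (-1) x 2) => //; last exact: cc.
    apply: continuous_compact_integrable; first exact: segment_compact.
    by apply: continuous_subspaceT => y; exact: cc.
  by apply: (DeriveDef d); rewrite -derive1E; exact: e.
have h1 (x : R) : x \in `]t, s[ -> is_derive x 1 F (c x).
  by rewrite in_itv /= => /andP[x1 x2]; apply: dF; lra.
have h2 : {within `[t, s], continuous F}.
  apply: derivable_within_continuous => x; rewrite in_itv /= => /andP[x1 x2].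
  have i : is_derive (x : R) 1 F (c x) by apply: dF; lra.
  exact: (@ex_derive _ _ _ _ _ _ _ i).
have [x] := @MVT_segment R F c t s ts h1 h2.
by rewrite in_itv /= => hx e; exists x.
Unshelve. all: by end_near. Qed.

End HolderCoefficients.

Section Decomposition.
Context {R : realType} {D : nat} (D0 : (0 < D)%N).
Implicit Types (B H Q : 'M[R]_D).

Definition dirs : finType := ('I_D + 'I_D * 'I_D * bool)%type.

Definition dirvec (j : dirs) : 'cV[R]_D :=
  match j with
  | inl k => delta_mx k 0
  | inr (k, l, b) => delta_mx k 0 + (-1) ^+ b *: delta_mx l 0
  end.

(* Weights of rank-one matrices summing up to [(1 + B) / 2]: polarization produces
   the off-diagonal entries, and the surplus [(16 * D)^-1] keeps the weights
   nonnegative as long as [B] is small. *)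
Definition dircoef B (j : dirs) : R :=
  match j with
  | inl k => 4^-1
  | inr (k, l, b) => (16 * D%:R)^-1 + (-1) ^+ b * (8^-1 * B k l)
  end.

Lemma dir_decomposition B : B^T = B ->
  \sum_j dircoef B j *: (dirvec j *m (dirvec j)^T) = 2^-1 *: (1%:M + B).
Proof.
move=> Bs; rewrite big_sumType /=.
pose E k l : 'M[R]_D := delta_mx k l.
have EE k l : delta_mx k 0 *m (delta_mx l 0 : 'cV[R]_D)^T = E k l.
  by rewrite trmx_delta mul_delta_mx.
have outer (x : R) k l : (delta_mx k 0 + x *: delta_mx l 0) *m (delta_mx k 0 + x *: delta_mx l 0 : 'cV[R]_D)^T =
    E k k + x *: E k l + (x *: E l k + (x * x) *: E l l).
  by rewrite raddfD /= linearZ /= mulmxDl !mulmxDr -!scalemxAl -!scalemxAr !EE scalerA.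
have id1 : \sum_k E k k = 1%:M.
  apply/matrixP => i j; rewrite summxE mxE (bigD1 i)//= mxE eqxx /=.
  rewrite big1 ?addr0; first by rewrite eq_sym.
  by move=> k ki; rewrite mxE eq_sym (negPf ki).
have sB : \sum_k \sum_l B k l *: E k l = B by rewrite -matrix_sum_delta.
have sBT : \sum_k \sum_l B k l *: E l k = B.
  rewrite exchange_big /= -[RHS]Bs [RHS]matrix_sum_delta; apply: eq_bigr => k _.
  by apply: eq_bigr => l _; rewrite mxE.
have -> : \sum_(i < D) 4^-1 *: (delta_mx i 0 *m (delta_mx i 0 : 'cV[R]_D)^T) = 4^-1 *: 1%:M.
  by rewrite -id1 scaler_sumr; apply: eq_bigr => i _; rewrite EE.
have -> : \sum_i dircoef B (inr i) *: (dirvec (inr i) *m (dirvec (inr i))^T) =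
  \sum_k \sum_l ((8 * D%:R)^-1 *: (E k k + E l l) + 4^-1 *: (B k l *: E k l) + 4^-1 *: (B k l *: E l k)).
  rewrite (eq_bigr (fun i : 'I_D * 'I_D * bool => (fun k b => dircoef B (inr (k.1, k.2, b)) *: (dirvec (inr (k.1, k.2, b)) *m (dirvec (inr (k.1, k.2, b)))^T)) i.1 i.2)); last by move=> [[k l] b] _.
  rewrite -(pair_bigA _ (fun k b => dircoef B (inr (k.1, k.2, b)) *: (dirvec (inr (k.1, k.2, b)) *m (dirvec (inr (k.1, k.2, b)))^T))) /=.
  rewrite (eq_bigr (fun k : 'I_D * 'I_D => (fun k l => (8 * D%:R)^-1 *: (E k k + E l l) + 4^-1 *: (B k l *: E k l) + 4^-1 *: (B k l *: E l k)) k.1 k.2)).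
    by rewrite -(pair_bigA _ (fun k l => (8 * D%:R)^-1 *: (E k k + E l l) + 4^-1 *: (B k l *: E k l) + 4^-1 *: (B k l *: E l k))).
  move=> [k l] _ /=; rewrite big_bool /= expr0 expr1 !outer.
  apply/matrixP => i j; rewrite !mxE.
  move: ((_ && _)%:R) ((_ && _)%:R) ((_ && _)%:R) ((_ && _)%:R) => x1 x2 x3 x4.
  by field; rewrite pnatr_eq0 -lt0n.
rewrite (eq_bigr (fun k => (8 * D%:R)^-1 *: (D%:R *: E k k + 1%:M) + 4^-1 *: (\sum_l B k l *: E k l) + 4^-1 *: (\sum_l B k l *: E l k))); last first.
  move=> k _; rewrite !big_split /= -!scaler_sumr; congr (_ *: _ + _ + _).
  by rewrite big_split /= id1 sumr_const card_ord scaler_nat.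
rewrite !big_split /= -!scaler_sumr sB sBT big_split /= -scaler_sumr id1 sumr_const card_ord -[1%:M *+ D]scaler_nat.
apply/matrixP => i j; rewrite !mxE.
by move: ((i == j)%:R) (B i j) => x1 x2; field; rewrite pnatr_eq0 -lt0n.
Qed.

Lemma trace_decomposition (I : finType) (c : I -> R) (d : I -> 'cV[R]_D) (A H : 'M[R]_D) :
  \sum_i c i *: (d i *m (d i)^T) = A ->
  \sum_i c i * \sum_k \sum_l d i k 0 * d i l 0 * H k l = \tr (H *m A).
Proof.
move=> <-; rewrite mulmx_sumr raddf_sum /=; apply: eq_bigr => i _.
rewrite -scalemxAr mxtraceZ; congr (_ * _); rewrite /mxtrace; apply: eq_bigr => k _.
by rewrite mxE; apply: eq_bigr => l _; rewrite !mxE big_ord1 !mxE; ring.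
Qed.

End Decomposition.


Section EvolutionExists.
Context {R : realType} {D : nat} (D0 : (0 < D)%N) (a : R) (a01 : 0 < a < 1).
Local Notation V := 'cV[R]_D.

Let a_gt0 : 0 < a. Proof. by case/andP: a01. Qed.

Lemma coercive_unitmx (C : 'M[R]_D) (dlo : R) : 0 < dlo ->
  (forall y : V, dlo * sqnorm y <= scal11 (y^T *m C *m C^T *m y)) -> C \in unitmx.
Proof.
move=> d0 h; rewrite -row_free_unit -kermx_eq0; apply/eqP/row_matrixP => i.
rewrite row0; set r := row i _; have /sub_kermxP rk : (r <= kermx C)%MS by exact: row_sub.
clearbody r; apply/rowP => k; have := h r^T.
rewrite trmxK rk !mul0mx /scal11 !mxE pmulr_rle0// => h0.
have /eqP : sqnorm r^T = 0.
  by apply/eqP; rewrite eq_le h0 /=; apply: sumr_ge0 => l _; exact: sqr_ge0.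
rewrite psumr_eq0 => [/allP/(_ k (mem_index_enum _))|l _]; last exact: sqr_ge0.
by rewrite sqrf_eq0 !mxE => /eqP.
Qed.

Lemma entry_le m n (A : 'M[R]_(m, n)) k l : `|A k l| <= `|A|.
Proof.
rewrite [`|A|]mx_normrE.
by have := le_bigmax 0 (fun ij : 'I_m * 'I_n => `|A ij.1 ij.2|) (k, l).
Qed.

Lemma small_time (K b e : R) : 0 <= K -> 0 < b -> 0 < e ->
  exists2 tau : R, 0 < tau <= 1 & forall t, 0 <= t <= tau -> K * t `^ b <= e.
Proof.
move=> K0 b0 e0; have K1 : 0 < K + 1 by lra.
pose t0 := (e / (K + 1)) `^ b^-1.
have t00 : 0 < t0 by apply: powR_gt0; exact: divr_gt0.
exists (Num.min 1 t0).
  by rewrite lt_min ltr01 t00 ge_min lexx.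
move=> t; rewrite le_min => /and3P[t1 t2 t3].
apply: (@le_trans _ _ (K * (e / (K + 1)))); last first.
  by rewrite mulrA ler_pdivrMr// mulrC ler_pM2l//; lra.
apply: ler_wpM2l => //.
have -> : e / (K + 1) = t0 `^ b.
  by rewrite /t0 -powRrM mulVf ?gt_eqF// powRr1// divr_ge0 ?ltW.
by apply: ge0_ler_powR; rewrite ?nnegrE ?(ltW t00) ?(ltW b0).
Qed.

Section Construction.
Variables (C : R -> 'M[R]_D) (C0u : C 0 \in unitmx).
Hypothesis hC : forall k l, hc01 a (fun t => C t k l).

Let Q := invmx (C 0).
Let A t := C t *m (C t)^T.
Let B t := Q *m A t *m Q^T - 1%:M.

Let B_sym t : (B t)^T = B t.
Proof. by rewrite /B /A raddfB /= trmx1 !trmx_mul !trmxK mulmxA. Qed.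

Let B_hc k l : hc01 a (fun t => B t k l).
Proof.
rewrite (_ : (fun t => _) = fun t => \sum_j (\sum_i Q k i * \sum_m (C t i m * C t j m)) * Q l j + - (k == l)%:R); last first.
  apply/funext => t; rewrite /B /A !mxE; congr (_ - _); apply: eq_bigr => j _.
  rewrite !mxE; congr (_ * _); apply: eq_bigr => i _; congr (_ * _).
  by rewrite mxE; apply: eq_bigr => m _; rewrite mxE.
apply: hc01_add; last exact: hc01_cst.
apply: hc01_sum => j; apply: (hc01_mul a01); last exact: hc01_cst.
apply: hc01_sum => i; apply: (hc01_mul a01); first exact: hc01_cst.
by apply: hc01_sum => m; exact: (hc01_mul a01).
Qed.

Let B0 : B 0 = 0.
Proof.
rewrite /B /A /Q mulmxA mulVmx// mul1mx -trmx_mul mulVmx// trmx1 subrr//.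
Qed.

Let DR : 0 < D%:R :> R. Proof. by rewrite ltr0n. Qed.

(* The directions are those of time 0, so that the heat operators along them
   commute; only their weights depend on time. *)
Lemma frozen_directions : exists (tau K : R) (S : @dirs D -> R -> R) (c : @dirs D -> R -> R),
  [/\ 0 < tau <= 1, 0 <= K,
    forall j t s, t <= s -> 0 <= S j s - S j t <= 1 * (s - t),
    forall k t, S (inl k) t = 4^-1 * t &
    (forall j t s, 0 <= t -> t <= s -> s <= tau ->
      `|S j s - S j t - (s - t) * c j s| <= K * (s - t) `^ (1 + a / 2)) /\
    forall s, 0 <= s <= tau -> \sum_j c j s *: ((C 0 *m @dirvec R D j) *m (C 0 *m @dirvec R D j)^T) =
      2^-1 *: (C s *m (C s)^T)].
Proof.
have [K K0 hK] := @hc01_uniform R a _ (fun kl : 'I_D * 'I_D => fun t => B t kl.1 kl.2) (fun kl => B_hc kl.1 kl.2).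
have [|tau /andP[tau0 tau1] htau] := small_time K0 a_gt0 (_ : 0 < (2 * D%:R)^-1).
  by rewrite invr_gt0 mulr_gt0.
have Bs k l t : 0 <= t <= tau -> `|B t k l| <= (2 * D%:R)^-1.
  move=> tt; have /andP[t0 t1] := tt; apply: le_trans (htau t tt).
  have Bkl : B 0 k l = 0 by rewrite B0 mxE.
  have := hK (k, l) t 0; rewrite /= Bkl !subr0 (ger0_norm t0); apply.
    by rewrite t0 (le_trans t1).
  by rewrite lexx ler01.
have tau00 := ltW tau0.
pose c j t := dircoef (B (clamp tau t)) j.
have c_lip j t s : `|c j t - c j s| <= K * `|t - s| `^ a.
  case: j => [k|[[k l] b]]; first by rewrite /c /= subrr normr0 mulr_ge0 ?powR_ge0.
  rewrite /c /= opprD addrACA subrr add0r -mulrBr -mulrBr normrM normrX normrN1 expr1n mul1r normrM.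
  have [/andP[t0 t1] /andP[s0 s1]] := (clamp_itv t tau00, clamp_itv s tau00).
  have h := hK (k, l) (clamp tau t) (clamp tau s).
  apply: (@le_trans _ _ (`|B (clamp tau t) k l - B (clamp tau s) k l|)).
    by rewrite ler_piMl// ger0_norm; lra.
  apply: le_trans (h _ _) _ => /=; try (by apply/andP; split => //; lra).
  apply: ler_wpM2l => //; apply: ge0_ler_powR; rewrite ?nnegrE ?(ltW a_gt0)//.
  exact: clamp_lip.
have D1 : 1 <= D%:R :> R by rewrite ler1n.
have c01 j t : 0 <= c j t <= 1.
  case: j => [k|[[k l] b]]; rewrite /c /=; first by apply/andP; split; lra.
  have := Bs k l (clamp tau t) (clamp_itv t tau00).
  rewrite ler_norml !invfM => /andP[].
  have : 0 < (D%:R^-1 : R) <= 1 by rewrite invr_gt0 DR invf_le1.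
  by case: b => /=; rewrite ?expr0 ?expr1 => /andP[? ?] ? ?; apply/andP; split; lra.
have /choice[F hF] j : exists F : R -> R, forall t s, 0 <= t -> t <= s -> s <= 1 ->
    exists2 x, t <= x <= s & F s - F t = c j x * (s - t).
  exact: (holder_primitive a01 K0 (c_lip j)).
pose S (j : dirs) t := match j with inl _ => 4^-1 * t | inr _ => F j (clamp 1 t) end.
exists tau, K, S, c; split=> //; first by rewrite tau0.
  move=> [k|j] t s ts /=; first by apply/andP; split; lra.
  have [/andP[t0 t1] /andP[s0 s1]] := (clamp_itv t (@ler01 R), clamp_itv s (@ler01 R)).
  have cts : clamp 1 t <= clamp 1 s by exact: clamp_mono.
  have [x _ ->] := hF (inr j) _ _ t0 cts s1.
  have /andP[c0 c1] := c01 (inr j) x.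
  rewrite mulr_ge0 ?subr_ge0//= ler_pM ?subr_ge0//.
  have := clamp_lip s t (@ler01 R); rewrite !ger0_norm ?subr_ge0//.
split=> [j t s t0 ts stau|s s0].
  have st : 0 <= s - t by rewrite subr_ge0.
  case: j => [k|j] /=.
    by rewrite /c /= (_ : _ - _ = 0) ?normr0 ?mulr_ge0 ?powR_ge0//; ring.
  have s1 : s <= 1 by lra.
  have -> : clamp 1 s = s by apply: clamp_id; rewrite (le_trans t0 ts).
  have -> : clamp 1 t = t by apply: clamp_id; rewrite t0 (le_trans ts).
  have [x /andP[x1 x2] ->] := hF (inr j) _ _ t0 ts s1.
  rewrite mulrC -mulrBr normrM (ger0_norm st).
  have [->|st'] := eqVneq s t; first by rewrite subrr mul0r mulr_ge0 ?powR_ge0.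
  have st0 : 0 < s - t by rewrite lt_neqAle st eq_sym subr_eq0 st'.
  rewrite powR1D// mulrCA ler_pM2l//; apply: le_trans (c_lip _ _ _) _.
  apply: ler_wpM2l => //; rewrite distrC ger0_norm ?subr_ge0//.
  apply: (@le_trans _ _ ((s - t) `^ a)).
    by apply: ge0_ler_powR; rewrite ?nnegrE ?(ltW a_gt0) ?subr_ge0//; lra.
  rewrite {1}[a]splitr powRD; last by rewrite subr_eq0 st' implybT.
  have b20 : 0 <= a / 2 by have := a_gt0; lra.
  by rewrite ler_piMr ?powR_ge0// powR_le1// st; lra.
rewrite (eq_bigr (fun j => C 0 *m (dircoef (B s) j *: (@dirvec R D j *m (@dirvec R D j)^T)) *m (C 0)^T)); last first.
  by move=> j _; rewrite /c clamp_id// trmx_mul -!scalemxAr -!scalemxAl !mulmxA.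
rewrite -mulmx_suml -mulmx_sumr dir_decomposition// -scalemxAr -scalemxAl /B.
rewrite addrC subrK /Q !mulmxA mulmxV// mul1mx -!mulmxA -trmx_mul mulmxV// trmx1 mulmx1//.
Qed.

Lemma evolution_exists : exists (tau : R) (P : R -> R -> (V -> R) -> V -> R) (C1 C2 C4 : R),
  [/\ 0 < tau <= 1, evolution a P C1 C2, 0 <= C4 &
    forall phi G t s, c2a a phi G -> 0 <= t -> t <= s -> s <= tau ->
    bnd (fun y => P t s phi y - phi y - (s - t) * (2^-1 * \tr (hess phi y *m C s *m (C s)^T)))
      (C4 * G * (s - t) `^ (1 + a / 2))].
Proof.
have [tau [K [S [c [tau01 K0 S_incr Sl [Sc decomp]]]]]] := frozen_directions.
pose d j := C 0 *m @dirvec R D j; pose js := index_enum (@dirs D).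
pose P := flow_seq d S js.
have [C2 C20 moment] := flow_moment a01 d ler01 S_incr js.
have [C5 C50 taylor] := flow_taylor a01 d ler01 S_incr js.
pose q := \sum_k \sum_l `|Q k l|.
have q0 : 0 <= q by do 2!apply: sumr_ge0 => ? _.
pose kap := \sum_j (2 * (`|d j| * `|d j| * `|d j| `^ a) + `|d j| * `|d j|).
have kapj j : 2 * (`|d j| * `|d j| * `|d j| `^ a) + `|d j| * `|d j| <= kap.
  rewrite /kap (bigD1 j)//= lerDl; apply: sumr_ge0 => i _.
  by rewrite addr_ge0 ?mulr_ge0 ?powR_ge0.
have kap0 : 0 <= kap by apply: sumr_ge0 => i _; rewrite addr_ge0 ?mulr_ge0 ?powR_ge0.
exists tau, P, (D%:R * (2 * q)), C2, (C5 * kap + \sum_(j : @dirs D) K * (`|d j| * `|d j|)); split=> //.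
- split=> //; first by rewrite !mulr_ge0.
  + by move=> t s phi M rp bM; have [] := flow_bnd a01 d S js t s rp bM.
  + by move=> *; apply: (flow_lin a01).
  + by move=> *; apply: (flow_shift a01).
  + by move=> *; apply: (flow_semi a01 d S_incr).
  + by move=> *; exact: (flow_le d S_incr).
  + move=> t s v phi M ts rp bM; pose x := Q *m v.
    have M0 : 0 <= M by exact: le_trans (normr_ge0 _) (bM 0).
    have vE : v = \sum_k x k 0 *: d (inl k).
      rewrite {1}(_ : v = C 0 *m x); last by rewrite /x /Q mulmxA mulmxV// mul1mx.
      rewrite {1}[x]coord_sum mulmx_sumr; apply: eq_bigr => k _.
      by rewrite -scalemxAr.
    have xk k : `|x k 0| <= q * `|v|.
      rewrite /x mxE; apply: le_trans (ler_norm_sum _ _ _) _.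
      apply: (@le_trans _ _ (\sum_l `|Q k l| * `|v|)).
        by apply: ler_sum => l _; rewrite normrM ler_wpM2l// coord_le.
      rewrite -mulr_suml ler_wpM2r// /q [leRHS](bigD1 k)//= lerDl.
      by do 2!apply: sumr_ge0 => ? _.
    have sm k : bnd (dif (x k 0 *: d (inl k)) (P t s phi)) (M * (q * `|v|) * 2 / Num.sqrt (s - t)).
      have Sst : S (inl k) s - S (inl k) t = 4^-1 * (s - t) by rewrite !Sl -mulrBr.
      have st0 : 0 < s - t by rewrite subr_gt0.
      have := @flow_smooth _ _ a a01 _ d S js (inl k) t s (x k 0) phi M (mem_index_enum _) _ rp bM.
      rewrite Sst mulr_gt0// => /(_ isT) h y; apply: le_trans (h y) _.
      have -> : Num.sqrt (4^-1 * (s - t)) = 2^-1 * Num.sqrt (s - t).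
        rewrite sqrtrM// (_ : 4^-1 = (2^-1) ^+ 2 :> R); last by field.
        by rewrite sqrtr_sqr ger0_norm.
      rewrite invfM invrK mulrA ler_wpM2r ?invr_ge0 ?sqrtr_ge0// ler_wpM2r// ler_wpM2l//.
    have := bnd_dif_sum (index_enum _) sm; rewrite -vE => h y; apply: le_trans (h y) _.
    rewrite sumr_const card_ord -[_ *+ D]mulr_natl le_eqVlt; apply/orP; left; apply/eqP.
    by move: (D%:R) (Num.sqrt _)^-1 => p p'; ring.
- by rewrite addr_ge0 ?mulr_ge0// sumr_ge0// => j _; rewrite !mulr_ge0.
move=> phi G t s cG t0 ts stau y; have [G0 bG _ _ _] := cG.
have z j := zyg_derive_le a01 (d j) (c2a_derive_zyg a01 (d j) cG).
pose h j := 'D_(d j) ('D_(d j) phi).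
have hh : forall y, `|P t s phi y - phi y - \sum_j (S j s - S j t) * h j y| <= C5 * (G * kap) * (s - t) `^ (1 + a / 2).
  apply: (taylor t s phi (fun j => 'D_(d j) phi) h (G * kap)) => //.
  - by exists G, (2 * G); split=> //; [rewrite mulr_ge0|exact: (c2a_hol a01 cG)].
  - exact: mulr_ge0.
  - move=> j z' r; apply: le_trans (c2a_taylor a01 _ _ cG r) _.
    apply: ler_wpM2r; first exact: powR_ge0.
    rewrite -!mulrA mulrCA ler_wpM2l// !mulrA; apply: le_trans (kapj j).
    by rewrite !mulrA lerDl !mulr_ge0.
  - move=> j; have [b1 b2] := z j.
    by eexists; eexists; split; [| |exact: b1|exact: b2]; rewrite !mulr_ge0.
  - move=> j v z'; have [b1 b2] := z j; apply: le_trans (b2 v z') _.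
    apply: ler_wpM2r; first exact: powR_ge0.
    rewrite -mulrA ler_wpM2l//; apply: le_trans (kapj j).
    by rewrite lerDr !mulr_ge0 ?powR_ge0.
have trE : \sum_j c j s * h j y = 2^-1 * \tr (hess phi y *m C s *m (C s)^T).
  rewrite (eq_bigr (fun j => c j s * \sum_k \sum_l d j k 0 * d j l 0 * hess phi y k l)).
    rewrite (@trace_decomposition R D _ (fun j => c j s) d (2^-1 *: (C s *m (C s)^T))).
      by rewrite -scalemxAr mxtraceZ mulmxA.
    by apply: decomp; rewrite (le_trans t0).
  by move=> j _; rewrite /h (c2a_derive2 a01 _ _ cG).
rewrite -trE -(subrKA (\sum_j (S j s - S j t) * h j y)) 2![in leRHS]mulrDl.
apply: le_trans (ler_normD _ _) _; apply: lerD; first by rewrite -[C5 * _ * _]mulrA [kap * _]mulrC; exact: hh.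
rewrite mulr_sumr -sumrB -mulrA mulr_suml; apply: le_trans (ler_norm_sum _ _ _) _.
apply: ler_sum => j _.
rewrite (_ : _ - _ = (S j s - S j t - (s - t) * c j s) * h j y); last by ring.
rewrite normrM.
rewrite [leRHS](_ : _ = K * (s - t) `^ (1 + a / 2) * (G * `|d j| * `|d j|)); last by ring.
by apply: ler_pM => //; [exact: Sc|exact: (proj1 (z j))].
Qed.

End Construction.

End EvolutionExists.

(** * Picard iteration *)

Section GradientBounds.
Context {R : realType} {D : nat} (a : R) (a01 : 0 < a < 1).
Local Notation V := 'cV[R]_D.
Implicit Types (phi psi : V -> R) (v w y : V) (L K M : R).

Let a_gt0 : 0 < a. Proof. by case/andP: a01. Qed.

Definition lip2 phi M := (forall v, bnd (dif v phi) (M * `|v|)) /\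
  forall v w, bnd (dif w (dif v phi)) (M * `|v| * `|w|).

Lemma lip2_zyg phi M : 0 <= M -> lip2 phi M -> zyg a phi M (2 * M).
Proof. by move=> M0 [h1 h2]; exact: (lip_zyg a01). Qed.

Lemma derive_sub_le phi psi L K L' K' M v : zyg a phi L K -> zyg a psi L' K' ->
  (forall w, bnd (fun y => dif w phi y - dif w psi y) (M * `|w|)) ->
  bnd (fun y => 'D_v phi y - 'D_v psi y) (M * `|v|).
Proof.
move=> z z' h y.
have := cvgB (@zyg_derive_seq R _ a a01 phi L K y v z) (@zyg_derive_seq R _ a a01 psi L' K' y v z').
move=> /(_ _)/(@norm_lim_le0 R _ _ (M * `|v|)); apply => n /=.
rewrite !fctE -mulrBr normrM normrX (ger0_norm (ler0n _ 2)).
apply: le_trans (ler_wpM2l _ (h _ y)) _; first by rewrite exprn_ge0.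
rewrite normrZ normrX (ger0_norm (_ : 0 <= 2^-1)) ?invr_ge0// exprVn.
by rewrite le_eqVlt; apply/orP; left; apply/eqP; field; rewrite expf_neq0.
Qed.

Lemma grad_sub_le phi psi L K L' K' M y : zyg a phi L K -> zyg a psi L' K' -> 0 <= M ->
  (forall w, bnd (fun y => dif w phi y - dif w psi y) (M * `|w|)) ->
  `|grad phi y - grad psi y| <= M.
Proof.
move=> z z' M0 h; apply: norm_le_coord => // k; rewrite !mxE.
apply: le_trans (derive_sub_le (ecoord R k) z z' h y) _.
by rewrite ler_piMr// norm_ecoord.
Qed.

Lemma grad_le phi M y : 0 <= M -> lip2 phi M -> `|grad phi y| <= M.
Proof.
move=> M0 h; apply: norm_le_coord => // k; rewrite mxE.
have [b _] := zyg_derive_le a01 (ecoord R k) (lip2_zyg M0 h).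
by apply: le_trans (b y) _; rewrite ler_piMr// norm_ecoord.
Qed.

Lemma lip2_transl w phi M : lip2 phi M -> lip2 (transl w phi) M.
Proof.
move=> [h1 h2]; split=> [v y|v z y].
  by have := h1 v (y + w); rewrite /dif /transl addrAC.
by have := h2 v z (y + w); rewrite /dif /transl !(addrAC _ w).
Qed.

Lemma grad_transl w phi M y : 0 <= M -> lip2 phi M -> grad (transl w phi) y = grad phi (y + w).
Proof.
move=> M0 h; apply/matrixP => k i; rewrite !mxE /pd.
apply: (@cvg_unique _ _ (2 ^+ n * dif (2^-1 ^+ n *: ecoord R k) (transl w phi) y @[n --> \oo])) => //.
  exact: (@zyg_derive_seq R _ a a01 _ _ _ y (ecoord R k) (lip2_zyg M0 (lip2_transl w h))).
rewrite (_ : (fun n => _) = fun n => 2 ^+ n * dif (2^-1 ^+ n *: ecoord R k) phi (y + w)).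
  exact: (@zyg_derive_seq R _ a a01 _ _ _ (y + w) (ecoord R k) (lip2_zyg M0 h)).
by apply/funext => n; rewrite /dif /transl addrAC.
Qed.

Lemma grad_lip phi M w y : 0 <= M -> lip2 phi M -> `|grad phi (y + w) - grad phi y| <= M * `|w|.
Proof.
move=> M0 h; rewrite -(grad_transl w y M0 h).
apply: grad_sub_le; first exact: (lip2_zyg M0 (lip2_transl w h)).
- exact: (lip2_zyg M0 h).
- exact: mulr_ge0.
move=> v z; have [_ h2] := h; have := h2 v w z.
by rewrite mulrAC /dif /transl -(addrAC z v w).
Qed.

Lemma lip_hol phi M L : 0 <= M -> 0 <= L -> bnd phi M -> (forall v, bnd (dif v phi) (L * `|v|)) ->
  hol a phi (L + 2 * M).
Proof.
move=> M0 L0 bM h v y; rewrite mulrDl.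
have [v1|/ltW v1] := leP `|v| 1.
  apply: le_trans (h v y) _; rewrite ler_wpDr ?mulr_ge0 ?powR_ge0//.
  apply: ler_wpM2l => //; apply: le_powR01; rewrite ?normr_ge0//; case/andP: a01 => ? ?.
  by apply/andP; split; lra.
apply: (@le_trans _ _ (2 * M)).
  by apply: le_trans (ler_normB _ _) _; have := bM (y + v); have := bM y; lra.
rewrite ler_wpDl ?mulr_ge0 ?powR_ge0// ler_peMr ?mulr_ge0//.
by apply: powR_ge1 => //; exact: ltW.
Qed.

End GradientBounds.

Lemma cvg_succ {R : realType} (x : nat -> R) (l : R) :
  x n @[n --> \oo] --> l -> x n.+1 @[n --> \oo] --> l.
Proof. by rewrite -(cvg_shiftS x). Qed.

Section Picard.
Context {R : realType} {D : nat} (a : R) (a01 : 0 < a < 1).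
Local Notation V := 'cV[R]_D.
Context (P : R -> R -> (V -> R) -> V -> R) (C1 C2 : R) (ev : evolution a P C1 C2).
Context (C3 : R) (C30 : 0 <= C3).
Hypothesis smooth : forall r s f M K N M', tame a f M K N ->
  0 <= r -> r <= s -> s <= 1 -> 0 <= M' ->
  (forall q, r <= q <= s -> bnd (f q) M') ->
  (forall w, bnd (dif w (duh P r s f)) (C3 * M' * `|w| * Num.sqrt (s - r))) /\
  (forall w z, bnd (dif z (dif w (duh P r s f))) (C3 * M' * `|w| * `|z| `^ a)).
Context {J : finType} (F : J -> R -> (J -> V) -> R) (B : R) (B0 : 0 <= B).
Hypothesis F_lip : forall i t (p q : J -> V) m e, 0 <= t <= 1 -> 0 <= m -> 0 <= e ->
  (forall j, `|p j| <= m) -> (forall j, `|q j| <= m) -> (forall j, `|p j - q j| <= e) ->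
  `|F i t p - F i t q| <= B * m * e.
Hypothesis F_zero : forall i t, F i t (fun=> 0) = 0.
Hypothesis F_time : forall i t s (p : J -> V) m, 0 <= t <= 1 -> 0 <= s <= 1 -> 0 <= m ->
  (forall j, `|p j| <= m) -> `|F i t p - F i s p| <= B * m * m * `|t - s| `^ (a / 2).
Implicit Types (u : J -> R -> V -> R) (g : J -> V -> R) (T M N : R).

Let b20 : 0 <= a / 2. Proof. by case/andP: a01 => ? ?; lra. Qed.

(* Freezing the forcing outside [0, T] keeps it tame on the whole line. *)
Definition forcing u T i s y := F i (clamp T s) (fun j => grad (u j (clamp T s)) y).

Definition ok u T M N := [/\ 0 <= M, 0 <= N, forall i t, 0 <= t <= T -> lip2 (u i t) M &
  forall i s t v, 0 <= s <= T -> 0 <= t <= T ->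
    bnd (fun y => dif v (u i s) y - dif v (u i t) y) (N * `|v| * `|s - t| `^ (a / 2))].

Section Forcing.
Context (T : R) (T0 : 0 <= T) (T1 : T <= 1).

Let cT1 s : 0 <= clamp T s <= 1.
Proof. by have /andP[h1 h2] := clamp_itv s T0; rewrite h1 (le_trans h2). Qed.

Lemma forcing_bnd u M N i s : ok u T M N -> bnd (forcing u T i s) (B * M * M).
Proof.
move=> [M0 N0 h1 _] y; rewrite -[_ y]subr0 -(F_zero i (clamp T s)).
apply: F_lip => // j; rewrite ?subr0 ?normr0//.
all: by apply: (grad_le a01) => //; apply: h1; exact: clamp_itv.
Qed.

Lemma forcing_dif u M N i s v : ok u T M N -> bnd (dif v (forcing u T i s)) (B * M * M * `|v|).
Proof.
move=> [M0 N0 h1 _] y; rewrite -mulrA; apply: F_lip => // [|j|j|j]; first exact: mulr_ge0.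
- by apply: (grad_le a01) => //; apply: h1; exact: clamp_itv.
- by apply: (grad_le a01) => //; apply: h1; exact: clamp_itv.
- by apply: (grad_lip a01) => //; apply: h1; exact: clamp_itv.
Qed.

Lemma forcing_tame u M N i : ok u T M N ->
  tame a (forcing u T i) (B * M * M) (B * M * M + 2 * (B * M * M)) (B * M * M + B * M * N).
Proof.
move=> ou; have [M0 N0 h1 h2] := ou.
have BM : 0 <= B * M by exact: mulr_ge0.
have BMM : 0 <= B * M * M by exact: mulr_ge0.
have BMN : 0 <= B * M * N by exact: mulr_ge0.
split=> //; [lra|lra|move=> s; split|move=> s t y].
- exact: forcing_bnd ou.
- apply: (lip_hol a01) => //; first exact: forcing_bnd ou.
  by move=> v; exact: forcing_dif ou.
have cst : `|clamp T s - clamp T t| `^ (a / 2) <= `|s - t| `^ (a / 2).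
  by apply: ge0_ler_powR; rewrite ?nnegrE//; exact: clamp_lip.
have c0 := powR_ge0 `|clamp T s - clamp T t| (a / 2).
have [cs ct] := (clamp_itv s T0, clamp_itv t T0).
pose p s j := grad (u j (clamp T s)) y.
have pM s' j : `|p s' j| <= M by apply: (grad_le a01) => //; apply: h1; exact: clamp_itv.
rewrite /forcing -(subrKA (F i (clamp T t) (p s))) mulrDl.
apply: le_trans (ler_normD _ _) _; apply: lerD.
  apply: le_trans (F_time i (cT1 s) (cT1 t) M0 (pM s)) _.
  by apply: ler_wpM2l.
apply: (@le_trans _ _ (B * M * (N * `|clamp T s - clamp T t| `^ (a / 2)))); last first.
  by rewrite mulrA; apply: ler_wpM2l.
apply: F_lip => // [|j|j]; [by rewrite mulr_ge0|exact: pM|].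
apply: (grad_sub_le a01 (L := M) (K := 2 * M) (L' := M) (K' := 2 * M)).
- by apply: (lip2_zyg a01) => //; exact: h1.
- by apply: (lip2_zyg a01) => //; exact: h1.
- by rewrite mulr_ge0.
by move=> w z; rewrite mulrAC; exact: h2.
Qed.

Lemma forcing_sub u u' M N N' e i s : ok u T M N -> ok u' T M N' -> 0 <= e ->
  (forall j w, bnd (fun y => dif w (u j (clamp T s)) y - dif w (u' j (clamp T s)) y) (e * `|w|)) ->
  bnd (fun y => forcing u T i s y - forcing u' T i s y) (B * M * e).
Proof.
move=> [M0 N0 h1 _] [_ _ h1' _] e0 h y; have cs := clamp_itv s T0.
apply: F_lip => // j; try by apply: (grad_le a01) => //; first [exact: h1|exact: h1'].
apply: (grad_sub_le a01 (L := M) (K := 2 * M) (L' := M) (K' := 2 * M)) => //.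
- by apply: (lip2_zyg a01) => //; exact: h1.
- by apply: (lip2_zyg a01) => //; exact: h1'.
Qed.

End Forcing.

Definition picard g T u i t := mild P (g i) (forcing u T i) T t.

Section Iteration.
Context (g : J -> V -> R) (G T : R) (T0 : 0 <= T) (T1 : T <= 1).
Hypothesis cg : forall i, c2a a (g i) G.
Hypothesis G0 : 0 <= G.

Let M := G + 1.
Let L := B * M * M.
Let N := 2 * C2 * (M + M) + L.
Hypothesis small1 : L * Num.sqrt T <= 1.
Hypothesis small2 : C3 * L * Num.sqrt T <= 1.
Hypothesis small3 : C3 * (B * M) * Num.sqrt T <= 2^-1.

Let M0 : 0 <= M. Proof. by rewrite /M; have := G0; lra. Qed.
Let BM0 : 0 <= B * M. Proof. exact: mulr_ge0. Qed.
Let L0 : 0 <= L. Proof. exact: mulr_ge0. Qed.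
Let N0 : 0 <= N.
Proof. by rewrite addr_ge0// !mulr_ge0 ?addr_ge0// (ev_C2 ev). Qed.

Let rg i : reg a (g i).
Proof.
by have h := cg i; have [_ b _ _ _] := h; exists G, (2 * G); split=> //; [rewrite mulr_ge0|exact: (c2a_hol a01 h)].
Qed.

Lemma picard_ok u N' : ok u T M N' -> ok (picard g T u) T M N.
Proof.
move=> ou; have tf i := forcing_tame T0 T1 i ou.
have fL i s v : bnd (dif v (forcing u T i s)) (L * `|v|) by exact: (forcing_dif T0 T1 i s v ou).
have sT t : 0 <= t <= T -> 0 <= T - t /\ T - t <= Num.sqrt T /\ Num.sqrt (T - t) <= Num.sqrt T.
  move=> /andP[t0 tT]; have tT' : 0 <= T - t by rewrite subr_ge0.
  have : Num.sqrt (T - t) <= Num.sqrt T by rewrite ler_wsqrtr// gerBl.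
  split=> //; split=> //; rewrite -[leLHS]sqr_sqrtr// expr2.
  apply: le_trans (_ : Num.sqrt T * 1 <= _); last by rewrite mulr1.
  apply: ler_pM; rewrite ?sqrtr_ge0//.
  by rewrite -sqrtr1 ler_wsqrtr//; have := T1; lra.
have l2 i t : 0 <= t <= T -> lip2 (picard g T u i t) M.
  move=> tt; have /andP[t0 tT] := tt; have [_ _ g1 g2 _] := cg i; have [h0 [h1 h2]] := sT t tt.
  split=> [v y|v w y].
    apply: le_trans (mild_dif1 a01 ev T1 (rg i) (tf i) L0 (fL i) t0 tT (g1 v) y) _.
    apply: ler_wpM2r => //; rewrite lerD2l; apply: le_trans small1.
    by rewrite mulrC ler_wpM2l.
  apply: le_trans (mild_dif2 a01 ev smooth T1 (rg i) (tf i) L0 (fL i) t0 tT (g2 v w) y) _.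
  apply: ler_wpM2r => //; apply: ler_wpM2r => //; rewrite lerD2l; apply: le_trans small2.
  by rewrite ler_wpM2l// mulr_ge0.
split=> // i s t v ss tt y.
wlog ts : s t ss tt / t <= s.
  move=> hw; have [ts|/ltW st] := leP t s; first exact: hw.
  by rewrite distrC [`|s - t|]distrC; apply: hw.
rewrite distrC (ger0_norm (_ : 0 <= s - t)) ?subr_ge0//.
have /andP[s0 sT'] := ss; have /andP[t0 tT] := tt; have [l1 l2'] := l2 i s ss.
exact: (mild_time a01 ev T1 (rg i) (tf i) L0 (fL i) t0 ts sT' M0 M0 l1 l2').
Qed.

Lemma picard_sub u u' N1 N2 e i t : ok u T M N1 -> ok u' T M N2 -> 0 <= e -> 0 <= t <= T ->
  (forall j s w, 0 <= s <= T -> bnd (fun y => dif w (u j s) y - dif w (u' j s) y) (e * `|w|)) ->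
  bnd (fun y => picard g T u i t y - picard g T u' i t y) (B * M * e) /\
  forall w, bnd (fun y => dif w (picard g T u i t) y - dif w (picard g T u' i t) y) (2^-1 * e * `|w|).
Proof.
move=> ou ou' e0 /andP[t0 tT] h.
have BMe : 0 <= B * M * e by exact: mulr_ge0.
have [] := @mild_sub _ _ a a01 P C1 C2 ev C3 smooth (g i) _ _ T _ _ _ _ _ _ t (B * M * e) t0 tT T1
  (forcing_tame T0 T1 i ou) (forcing_tame T0 T1 i ou') BMe.
  move=> q _; apply: (forcing_sub T0 T1 i ou ou' e0) => j w; apply: h; exact: clamp_itv.
move=> h1 h2; split=> [y|w y].
  apply: le_trans (h1 y) _; rewrite ler_piMl//; have := T1; lra.
apply: le_trans (h2 w y) _; have sT : Num.sqrt (T - t) <= Num.sqrt T by rewrite ler_wsqrtr// gerBl.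
apply: (@le_trans _ _ (C3 * (B * M) * Num.sqrt T * e * `|w|)); last first.
  by apply: ler_wpM2r => //; apply: ler_wpM2r.
rewrite [leRHS](_ : _ = C3 * (B * M * e) * `|w| * Num.sqrt T); last by ring.
by apply: ler_wpM2l => //; rewrite !mulr_ge0.
Qed.

Let it n := iter n (picard g T) (fun i _ => g i).

Let it_ok n : ok (it n) T M N.
Proof.
elim: n => [|n IH]; last exact: picard_ok IH.
split=> // [i t tt|i s t v _ _ y]; last by rewrite subrr normr0 !mulr_ge0 ?powR_ge0.
have [_ _ g1 g2 _] := cg i; split=> [v y|v w y].
  by apply: le_trans (g1 v y) _; apply: ler_wpM2r => //; rewrite lerDl.
by apply: le_trans (g2 v w y) _; do 2!apply: ler_wpM2r => //; rewrite lerDl.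
Qed.

Let it_step n i t w : 0 <= t <= T ->
  bnd (fun y => dif w (it n.+1 i t) y - dif w (it n i t) y) (2 * M * 2^-1 ^+ n * `|w|).
Proof.
elim: n i t w => [|n IH] i t w tt y.
  rewrite expr0 mulr1; have [_ _ h1 _] := it_ok 1; have [_ _ h0 _] := it_ok 0.
  apply: le_trans (ler_normB _ _) _; rewrite -mulrA mulr2n mulrDl mul1r.
  by apply: lerD; [exact: (proj1 (h1 i t tt))|exact: (proj1 (h0 i t tt))].
have e0 : 0 <= 2 * M * 2^-1 ^+ n by rewrite !mulr_ge0 ?exprn_ge0 ?invr_ge0.
have [_ /(_ w y)] := picard_sub i (it_ok n.+1) (it_ok n) e0 tt IH.
by rewrite exprS mulrCA.
Qed.

Let it_step0 n i t : 0 <= t <= T ->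
  bnd (fun y => it n.+2 i t y - it n.+1 i t y) (B * M * (2 * M) * 2^-1 ^+ n).
Proof.
move=> tt; have e0 : 0 <= 2 * M * 2^-1 ^+ n by rewrite !mulr_ge0 ?exprn_ge0 ?invr_ge0.
have [h _] := picard_sub i (it_ok n.+1) (it_ok n) e0 tt (fun j s w => @it_step n j s w).
by move=> y; rewrite -mulrA; exact: h.
Qed.

Lemma picard_fixpoint : exists2 u, ok u T M N &
  forall i t y, 0 <= t <= T -> u i t y = picard g T u i t y.
Proof.
have half01 : 0 <= (2^-1 : R) < 1 by apply/andP; split; lra.
pose u i t y := limn (fun n => it n.+1 i t y).
have c0 i t y (tt : 0 <= t <= T) := @geo_cvg R (fun n => it n.+1 i t y) _ _ half01 (fun n => it_step0 n i tt y).
have u_cvg i t y : 0 <= t <= T -> it n.+1 i t y @[n --> \oo] --> u i t y.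
  by move=> tt; have [] := c0 i t y tt.
have du_cvg i t y w : 0 <= t <= T -> dif w (it n.+1 i t) y @[n --> \oo] --> dif w (u i t) y.
  by move=> tt; apply: cvgB; exact: u_cvg.
have ddu_cvg i t y w v : 0 <= t <= T -> dif v (dif w (it n.+1 i t)) y @[n --> \oo] --> dif v (dif w (u i t)) y.
  by move=> tt; apply: cvgB; exact: du_cvg.
have ou : ok u T M N.
  split=> // [i t tt|i s t v ss tt y].
    have h n : lip2 (it n.+1 i t) M by have [_ _ h _] := it_ok n.+1; exact: h.
    split=> [v y|v w y].
      by apply: (norm_lim_le0 (du_cvg i t y v tt)) => n; exact: (proj1 (h n)).
    by apply: (norm_lim_le0 (ddu_cvg i t y v w tt)) => n; exact: (proj2 (h n)).
  apply: (norm_lim_le0 (cvgB (du_cvg i s y v ss) (du_cvg i t y v tt))) => n.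
  by have [_ _ _ h] := it_ok n.+1; exact: h.
exists u => // i t y tt.
pose c := 2 * M * 2^-1 / (1 - 2^-1).
have M20 : 0 <= c by rewrite /c !mulr_ge0 ?invr_ge0//; lra.
have rate n j s w : 0 <= s <= T ->
    bnd (fun y => dif w (u j s) y - dif w (it n.+1 j s) y) (c * 2^-1 ^+ n * `|w|).
  move=> ss z; rewrite distrC.
  have st k : `|dif w (it k.+2 j s) z - dif w (it k.+1 j s) z| <= 2 * M * 2^-1 * `|w| * 2^-1 ^+ k.
    by apply: le_trans (it_step k.+1 j w ss z) _; rewrite exprS le_eqVlt; apply/orP; left; apply/eqP; ring.
  have [cv /(_ n)] := @geo_cvg R (fun n => dif w (it n.+1 j s) z) _ _ half01 st.
  rewrite (cvg_lim _ (du_cvg j s z w ss))// => h; apply: le_trans h _.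
  by rewrite /c le_eqVlt; apply/orP; left; apply/eqP; ring.
apply: (@cvg_unique _ _ (it n.+2 i t y @[n --> \oo])) => //.
  by have := cvg_succ (u_cvg i t y tt).
have e0 : (fun n => B * M * c * 2^-1 ^+ n) @ \oo --> 0 by exact: cvg_geo.
apply: (cvg_norm_le e0) => n; rewrite distrC -mulrA.
have ce : 0 <= c * 2^-1 ^+ n by rewrite mulr_ge0// exprn_ge0// invr_ge0.
by have [h _] := picard_sub i ou (it_ok n.+1) ce tt (rate n); exact: h.
Qed.

End Iteration.

End Picard.

(** * Regularity *)

Section Strip.
Context {R : realType} {D : nat} (a : R) (a01 : 0 < a < 1).
Local Notation V := 'cV[R]_D.
Implicit Types (h u : R -> V -> R) (y x : V) (T K t s : R).

Let a_gt0 : 0 < a. Proof. by case/andP: a01. Qed.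

Lemma par_holder_split h T K : 0 <= K ->
  (forall t x y, 0 <= t <= T -> `|h t x - h t y| <= K * `|x - y| `^ a) ->
  (forall t s y, 0 <= t <= T -> 0 <= s <= T -> `|h t y - h s y| <= K * `|t - s| `^ (a / 2)) ->
  par_holder a T h.
Proof.
move=> K0 hx ht; exists (K + K) => t s x y tt ss; rewrite -(subrKA (h t y)) mulrDl.
have s0 := sqrtr_ge0 `|t - s|; have e0 : 0 <= enorm (x - y) by exact: sqrtr_ge0.
apply: le_trans (ler_normD _ _) _; apply: lerD.
  apply: le_trans (hx t x y tt) _; apply: ler_wpM2l => //.
  apply: ge0_ler_powR; rewrite ?nnegrE ?addr_ge0 ?(ltW a_gt0)//.
  by apply: le_trans (norm_le_enorm _) _; rewrite lerDr.
apply: le_trans (ht t s y tt ss) _; apply: ler_wpM2l => //.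
rewrite -{1}[`|t - s|]sqr_sqrtr// powR_half_sq//.
by apply: ge0_ler_powR; rewrite ?nnegrE ?addr_ge0 ?(ltW a_gt0)// lerDl.
Qed.

Lemma par_holder_space h T : par_holder a T h -> exists2 K, 0 <= K &
  (forall t x y, 0 <= t <= T -> `|h t x - h t y| <= K * `|x - y| `^ a) /\
  (forall t s y, 0 <= t <= T -> 0 <= s <= T -> `|h t y - h s y| <= K * `|t - s| `^ (a / 2)).
Proof.
move=> [K hK]; exists (`|K| * D%:R `^ a + `|K|); first by rewrite addr_ge0// mulr_ge0// powR_ge0.
have Kb t s x y : 0 <= t <= T -> 0 <= s <= T ->
    `|h t x - h s y| <= `|K| * (Num.sqrt `|t - s| + enorm (x - y)) `^ a.
  move=> tt ss; apply: le_trans (hK t s x y tt ss) _.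
  by apply: ler_wpM2r; [exact: powR_ge0|exact: ler_norm].
split=> [t x y tt|t s y tt ss].
  apply: le_trans (Kb t t x y tt tt) _; rewrite subrr normr0 sqrtr0 add0r.
  rewrite mulrDl -mulrA -powRM//; apply: ler_wpDr; first by rewrite mulr_ge0// powR_ge0.
  apply: ler_wpM2l => //; apply: ge0_ler_powR; rewrite ?nnegrE ?sqrtr_ge0 ?mulr_ge0 ?(ltW a_gt0)//.
  exact: enorm_le_norm.
apply: le_trans (Kb t s y y tt ss) _; rewrite subrr.
have -> : enorm (0 : V) = 0.
  apply/eqP; rewrite eq_le sqrtr_ge0 andbT.
  by have := enorm_le_norm (0 : V); rewrite normr0 mulr0.
rewrite addr0 mulrDl; apply: ler_wpDl; first by rewrite !mulr_ge0// powR_ge0.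
by rewrite -{2}[`|t - s|]sqr_sqrtr// powR_half_sq// sqrtr_ge0.
Qed.

Lemma par_holder_cont h T : par_holder a T h -> cont_on_strip T h.
Proof.
move=> /par_holder_space[K K0 [hx ht]]; apply/subspace_continuousP => p Ap.
apply/cvgrPdist_le => e e0; have e20 : 0 < e / 2 by rewrite divr_gt0.
have b0 : 0 < a / 2 by rewrite divr_gt0.
have [d1 /andP[d10 _] h1] := small_time K0 b0 e20.
have [d2 /andP[d20 _] h2] := small_time K0 a_gt0 e20.
change (\forall q \near nbhs p, strip T q -> `|h p.1 p.2 - h q.1 q.2| <= e).
near=> q => Aq; rewrite -(subrKA (h p.1 q.2)) [leRHS]splitr.
apply: le_trans (ler_normD _ _) _; apply: lerD.
  apply: le_trans (hx _ _ _ Ap) _; apply: h2; rewrite normr_ge0 /=; near: q.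
  by apply: cvgr_dist_le => //; exact: cvg_snd.
apply: le_trans (ht _ _ _ Ap Aq) _; apply: h1; rewrite normr_ge0 /=; near: q.
by apply: cvgr_dist_le => //; exact: cvg_fst.
Unshelve. all: by end_near. Qed.

Lemma tfilter_proper T t : 0 < T -> 0 <= t <= T -> ProperFilter (tfilter T t).
Proof.
move=> T0 /andP[t0 tT]; apply: within_nbhs_proper => A /nbhs_ballP[e /= e0 hA].
pose d := Num.min (e / 2) (T / 2).
have d0 : 0 < d by rewrite lt_min !divr_gt0.
have [d1 d2] : d <= e / 2 /\ d <= T / 2 by split; rewrite ge_min lexx ?orbT.
have [tT2|/ltW tT2] := leP t (T / 2).
  exists d; split.
    by split; [rewrite gt_eqF|apply/andP; split; lra].
  by apply: hA; rewrite /ball /= sub0r normrN gtr0_norm//; lra.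
exists (- d); split.
  by split; [rewrite oppr_eq0 gt_eqF|apply/andP; split; lra].
by apply: hA; rewrite /ball /= sub0r opprK gtr0_norm//; lra.
Qed.

Lemma dt_cvg u T t y (q c b : R) : 0 < T -> 0 <= t <= T -> 0 < b -> 0 <= c ->
  (forall h : R, 0 <= t + h <= T -> `|u (t + h) y - u t y - h * q| <= c * `|h| `^ (1 + b)) ->
  tquot u t y @ tfilter T t --> q /\ dt T u t y = q.
Proof.
move=> T0 tt b0 c0 hq; have pf := tfilter_proper T0 tt.
suff cv : tquot u t y @ tfilter T t --> q by split=> //; exact: cvg_lim.
apply/cvgrPdist_le => e e0; have [d /andP[d0 _] hd] := small_time c0 b0 e0.
change (\forall h \near (0 : R), (h != 0 /\ 0 <= t + h <= T) -> `|q - tquot u t y h| <= e).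
near=> h => -[h0 th].
rewrite /tquot (_ : _ - _ = - (h^-1 * (u (t + h) y - u t y - h * q))); last by field.
rewrite normrN normrM normfV mulrC ler_pdivrMr ?normr_gt0//.
apply: le_trans (hq h th) _; rewrite powR1D ?normr_gt0// mulrCA mulrC ler_wpM2r//.
apply: hd; rewrite normr_ge0 /=; near: h.
by exists d => //= x; rewrite /ball_ /= sub0r normrN => /ltW.
Unshelve. all: by end_near. Qed.

Lemma hess_sub_le (phi psi : V -> R) G G' c y k l : c2a a phi G -> c2a a psi G' -> 0 <= c ->
  (forall v w, bnd (fun y => dif w (dif v phi) y - dif w (dif v psi) y) (c * `|v| * `|w|)) ->
  `|hess phi y k l - hess psi y k l| <= c.
Proof.
move=> cp cq c0 h; rewrite !hessE.
have zp := c2a_zyg a01 cp; have zq := c2a_zyg a01 cq.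
have hd w : bnd (fun y => dif w (pd phi l) y - dif w (pd psi l) y) (c * `|w|).
  move=> z; have := cvgB (@zyg_derive_seq_dif R _ a a01 _ _ _ z (ecoord R l) w zp)
    (@zyg_derive_seq_dif R _ a a01 _ _ _ z (ecoord R l) w zq).
  move=> /(_ _)/(@norm_lim_le0 R _ _ (c * `|w|)); apply => n /=.
  rewrite !fctE -mulrBr normrM normrX (ger0_norm (ler0n _ 2)).
  apply: le_trans (ler_wpM2l _ (h _ w z)) _; first by rewrite exprn_ge0.
  rewrite normrZ normrX (ger0_norm (_ : 0 <= 2^-1)) ?invr_ge0// exprVn.
  rewrite [leLHS](_ : _ = c * `|w| * `|ecoord R l|); last by field; rewrite expf_neq0.
  by rewrite ler_piMr ?mulr_ge0// norm_ecoord.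
have := derive_sub_le a01 (ecoord R k) (c2a_derive_zyg a01 (ecoord R l) cp) (c2a_derive_zyg a01 (ecoord R l) cq) hd y.
by move=> h1; apply: le_trans h1 _; rewrite ler_piMr// norm_ecoord.
Qed.

Lemma c2a_weaken (phi : V -> R) G G' : c2a a phi G -> G <= G' -> c2a a phi G'.
Proof.
move=> [G0 h0 h1 h2 h3] GG; split; first exact: le_trans GG.
- by move=> y; exact: le_trans (h0 y) GG.
- by move=> v y; apply: le_trans (h1 v y) _; rewrite ler_wpM2r.
- by move=> v w y; apply: le_trans (h2 v w y) _; do 2!(rewrite ler_wpM2r//).
- by move=> v w z y; apply: le_trans (h3 v w z y) _; do 3!(rewrite ler_wpM2r ?powR_ge0//).
Qed.

Lemma trace_le (H A : 'M[R]_D) (h b : R) : 0 <= h -> 0 <= b ->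
  (forall k l, `|H k l| <= h) -> (forall k l, `|A k l| <= b) ->
  `|\tr (H *m A)| <= D%:R ^+ 2 * (h * b).
Proof.
move=> h0 b0 hH hA; rewrite /mxtrace; apply: le_trans (ler_norm_sum _ _ _) _.
apply: (@le_trans _ _ (\sum_(k < D) D%:R * (h * b))); last first.
  by rewrite sumr_const card_ord -[_ *+ D]mulr_natl mulrA.
apply: ler_sum => k _; rewrite mxE; apply: le_trans (ler_norm_sum _ _ _) _.
apply: (@le_trans _ _ (\sum_(l < D) h * b)); last by rewrite sumr_const card_ord -[_ *+ D]mulr_natl.
by apply: ler_sum => l _; rewrite normrM; apply: ler_pM.
Qed.

End Strip.

Section Regularity.
Context {R : realType} {D : nat} (a : R) (a01 : 0 < a < 1).
Local Notation V := 'cV[R]_D.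
Context (P : R -> R -> (V -> R) -> V -> R) (C1 C2 : R) (ev : evolution a P C1 C2).
Context (C3 : R) (C30 : 0 <= C3).
Hypothesis smooth : forall r s f M K N M', tame a f M K N ->
  0 <= r -> r <= s -> s <= 1 -> 0 <= M' ->
  (forall q, r <= q <= s -> bnd (f q) M') ->
  (forall w, bnd (dif w (duh P r s f)) (C3 * M' * `|w| * Num.sqrt (s - r))) /\
  (forall w z, bnd (dif z (dif w (duh P r s f))) (C3 * M' * `|w| * `|z| `^ a)).
Context (A : R -> 'M[R]_D) (A0 tau C4 : R) (A00 : 0 <= A0) (tau1 : tau <= 1) (C40 : 0 <= C4).
Hypothesis A_bnd : forall t k l, 0 <= t <= 1 -> `|A t k l| <= A0.
Hypothesis A_time : forall t s k l, 0 <= t <= 1 -> 0 <= s <= 1 ->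
  `|A t k l - A s k l| <= A0 * `|t - s| `^ (a / 2).
Hypothesis gen : forall phi G t s, c2a a phi G -> 0 <= t -> t <= s -> s <= tau ->
  bnd (fun y => P t s phi y - phi y - (s - t) * (2^-1 * \tr (hess phi y *m A s)))
    (C4 * G * (s - t) `^ (1 + a / 2)).

Let b20 : 0 < a / 2. Proof. by case/andP: a01 => ? ?; lra. Qed.
Let a_gt0 : 0 < a. Proof. by case/andP: a01. Qed.

Definition diffusion (u : R -> V -> R) t y := 2^-1 * \tr (hess (u t) y *m A t).

Definition uniform_c2a (u : R -> V -> R) T G := [/\ 0 <= G,
  forall t, 0 <= t <= T -> c2a a (u t) G &
  forall t s k l y, 0 <= t <= T -> 0 <= s <= T ->
    `|hess (u t) y k l - hess (u s) y k l| <= G * `|t - s| `^ (a / 2)].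

Lemma diffusion_bounds u T G : T <= 1 -> uniform_c2a u T G ->
  [/\ forall t y, 0 <= t <= T -> `|diffusion u t y| <= D%:R ^+ 2 * (G * A0),
    forall t x y, 0 <= t <= T -> `|diffusion u t x - diffusion u t y| <=
      D%:R ^+ 2 * (G * A0) * `|x - y| `^ a &
    forall t s y, 0 <= t <= T -> 0 <= s <= T -> `|diffusion u t y - diffusion u s y| <=
      2 * (D%:R ^+ 2 * (G * A0)) * `|t - s| `^ (a / 2)].
Proof.
move=> T1 [G0 cu hu].
have le1 t : 0 <= t <= T -> 0 <= t <= 1 by move=> /andP[-> h]; rewrite (le_trans h).
have half (x b : R) : 0 <= b -> `|x| <= b -> `|2^-1 * x| <= b.
  by move=> b0 xb; rewrite normrM ger0_norm//; lra.
have D20 : 0 <= D%:R ^+ 2 :> R by rewrite exprn_ge0.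
have Hb t k l y : 0 <= t <= T -> `|hess (u t) y k l| <= G.
  by move=> tt; have [_ _ _ _ h] := c2a_pd a01 (cu t tt); exact: (proj1 (h k l)).
split=> [t y tt|t x y tt|t s y tt ss].
- apply: half; first by rewrite !mulr_ge0.
  by apply: trace_le => // k l; [exact: Hb|exact: A_bnd (le1 t tt)].
- rewrite -mulrBr -raddfB /= -mulmxBl; apply: half; first by rewrite !mulr_ge0 ?powR_ge0.
  rewrite -mulrA [_ * A0 * _]mulrAC; apply: trace_le => // [|k l|k l]; first by rewrite mulr_ge0 ?powR_ge0.
    have [_ _ _ _ h] := c2a_pd a01 (cu t tt); have := proj2 (h k l) (x - y) y.
    rewrite /dif [y + _]addrC subrK.
    by rewrite (_ : (hess (u t) x - hess (u t) y) k l = hess (u t) x k l - hess (u t) y k l)//; rewrite !mxE.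
  exact: A_bnd (le1 t tt).
- rewrite -mulrBr -raddfB /= (_ : _ - _ = (hess (u t) y - hess (u s) y) *m A t + hess (u s) y *m (A t - A s)); last first.
    by move: (hess (u t) y) (hess (u s) y) (A t) (A s) => x1 x2 x3 x4; rewrite mulmxBl mulmxBr addrA subrK.
  rewrite raddfD /= mulr2n mulrDl mul1r mulrDl; have p0 := powR_ge0 `|t - s| (a / 2).
  apply: half; first by rewrite addr_ge0 ?mulr_ge0.
  apply: le_trans (ler_normD _ _) _; apply: lerD.
    rewrite -mulrA [_ * A0 * _]mulrAC; apply: trace_le => // [|k l|k l]; first by rewrite mulr_ge0.
      by rewrite !mxE; have := hu t s k l y tt ss; rewrite !hessE.
    exact: A_bnd (le1 t tt).
  rewrite -[leRHS]mulrA -[G * A0 * _]mulrA; apply: trace_le => // [|k l|k l]; first by rewrite mulr_ge0.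
    exact: Hb.
  by rewrite !mxE; exact: A_time (le1 t tt) (le1 s ss).
Qed.

Section MildSolution.
Context (g : V -> R) (f : R -> V -> R) (u : R -> V -> R) (T M K N L G : R).
Hypotheses (T0 : 0 < T) (Ttau : T <= tau).
Hypothesis cg : c2a a g G.
Hypothesis tf : tame a f M K N.
Hypothesis L0 : 0 <= L.
Hypothesis fL : forall s v, bnd (dif v (f s)) (L * `|v|).
Hypothesis u_mild : forall t y, 0 <= t <= T -> u t y = mild P g f T t y.

Let T1 : T <= 1. Proof. exact: le_trans Ttau tau1. Qed.
Let rg : reg a g.
Proof.
have [G0 b _ _ _] := cg; exists G, (2 * G); split=> //; [by rewrite mulr_ge0|exact: (c2a_hol a01 cg)].
Qed.
Let uE t : 0 <= t <= T -> u t = mild P g f T t.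
Proof. by move=> tt; apply/funext => y; exact: u_mild. Qed.
Let G' := G + M + L + C3 * L.
Let M0 : 0 <= M. Proof. by have [] := tf. Qed.
Let G0' : 0 <= G'.
Proof. by have [G0 _ _ _ _] := cg; rewrite /G' !addr_ge0 ?mulr_ge0. Qed.
Let cu t : 0 <= t <= T -> c2a a (mild P g f T t) G'.
Proof. by move=> /andP[t0 tT]; exact: (mild_c2a a01 ev C30 smooth T1 rg tf L0 fL t0 tT cg). Qed.

Let C2_0 : 0 <= C2. Proof. exact: ev_C2 ev. Qed.
Let H1 := 2 * C2 * (G' + G') + L + (C2 * G' + C3 * L) + (2 * C2 * G' + M) + G' + G'.
Let H1_ge0 : 0 <= H1.
Proof.
have h1 := mulr_ge0 C2_0 G0'; have h2 := mulr_ge0 C30 L0; have h3 := L0; have h4 := M0; have h5 := G0'.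
by rewrite /H1; move: h1 h2 h3 h4 h5; lra.
Qed.

Let sym (Q : R -> R -> R) : (forall t s, Q t s = Q s t) ->
  (forall t s, 0 <= t -> t <= s -> s <= T -> Q t s <= H1 * (s - t) `^ (a / 2)) ->
  forall t s, 0 <= t <= T -> 0 <= s <= T -> Q t s <= H1 * `|t - s| `^ (a / 2).
Proof.
move=> Qs h t s; wlog ts : t s / t <= s.
  move=> hw tt ss; have [ts|/ltW st] := leP t s; first exact: hw.
  by rewrite Qs distrC; exact: hw.
move=> /andP[t0 _] /andP[_ sT]; rewrite distrC ger0_norm ?subr_ge0//; exact: h.
Qed.

Let H1_le x : 0 <= x <= H1 -> forall z t s, z <= x * (s - t) `^ (a / 2) -> z <= H1 * (s - t) `^ (a / 2).
Proof.
move=> /andP[_ xH] z t s h; apply: le_trans h _; apply: ler_wpM2r => //; exact: powR_ge0.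
Qed.

Let parts : [/\ 0 <= 2 * C2 * (G' + G') + L <= H1, 0 <= C2 * G' + C3 * L <= H1,
  0 <= 2 * C2 * G' + M <= H1, 0 <= G' <= H1 & 3 * G' <= 3 * H1].
Proof.
have h1 := mulr_ge0 C2_0 G0'; have h2 := mulr_ge0 C30 L0; have h3 := L0; have h4 := M0; have h5 := G0'.
rewrite /H1; move: h1 h2 h3 h4 h5; split; try (apply/andP; split); lra.
Qed.

Let it t s : 0 <= t -> t <= s -> s <= T -> 0 <= t <= T /\ 0 <= s <= T.
Proof. by move=> t0 ts sT; rewrite t0 sT (le_trans ts sT) (le_trans t0 ts). Qed.

Lemma mild_uniform_c2a : uniform_c2a u T H1.
Proof.
have [_ p2 _ p4 _] := parts; split=> // [t tt|t s k l y].
  by rewrite uE//; apply: (c2a_weaken (cu tt)); case/andP: p4.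
apply: (sym (Q := fun t s => `|hess (u t) y k l - hess (u s) y k l|)) => {t s} [t s|t s t0 ts sT]; first exact: distrC.
have [tt ss] := it t0 ts sT; apply: (H1_le p2); rewrite !uE//.
apply: (hess_sub_le a01 y k l (cu tt) (cu ss)); first by rewrite mulr_ge0 ?powR_ge0//; case/andP: p2.
move=> v w z; have := mild_time2 a01 ev C30 smooth T1 rg tf L0 fL t0 ts sT (cu ss) v w z.
by congr (_ <= _); ring.
Qed.

Lemma mild_pd_time k : forall t s y, 0 <= t <= T -> 0 <= s <= T ->
  `|pd (u t) k y - pd (u s) k y| <= H1 * `|t - s| `^ (a / 2).
Proof.
move=> t s y; apply: (sym (Q := fun t s => `|pd (u t) k y - pd (u s) k y|)) => {t s} [t s|t s t0 ts sT]; first exact: distrC.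
have [p1 _ _ _ _] := parts; have [tt ss] := it t0 ts sT; apply: (H1_le p1); rewrite !uE//.
have [_ _ d1 d2 _] := cu ss.
have h := mild_time a01 ev T1 rg tf L0 fL t0 ts sT G0' G0' d1 d2.
have := @derive_sub_le R D a a01 _ _ _ _ _ _ ((2 * C2 * (G' + G') + L) * (s - t) `^ (a / 2)) (ecoord R k)
  (c2a_zyg a01 (cu tt)) (c2a_zyg a01 (cu ss)) _ y.
move=> h1; apply: le_trans (h1 _) _.
  by move=> w z; rewrite mulrAC; exact: h.
by rewrite ler_piMr ?norm_ecoord// mulr_ge0 ?powR_ge0//; case/andP: p1.
Qed.

Lemma mild_val_time : forall t s y, 0 <= t <= T -> 0 <= s <= T ->
  `|u t y - u s y| <= H1 * `|t - s| `^ (a / 2).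
Proof.
move=> t s y; apply: (sym (Q := fun t s => `|u t y - u s y|)) => {t s} [t s|t s t0 ts sT]; first exact: distrC.
have [_ _ p3 _ _] := parts; have [tt ss] := it t0 ts sT; apply: (H1_le p3); rewrite !uE//.
exact: (mild_time0 a01 ev T1 rg tf t0 ts sT (cu ss) y).
Qed.

Lemma mild_generator t y h : 0 <= t <= T -> 0 <= t + h <= T ->
  `|u (t + h) y - u t y - h * - (diffusion u t y + f t y)| <=
  (2 * (C2 * K + N) + C4 * G' + (2 * (D%:R ^+ 2 * (H1 * A0)) + N)) * `|h| `^ (1 + a / 2).
Proof.
have [_ K0 N0 _ f_time] := tf; have C20 := C2_0; have DH : 0 <= D%:R ^+ 2 * (H1 * A0) by rewrite !mulr_ge0 ?exprn_ge0.
have base r s : 0 <= r -> r <= s -> s <= T ->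
    `|u r y - u s y - (s - r) * (diffusion u s y + f s y)| <= (2 * (C2 * K + N) + C4 * G') * (s - r) `^ (1 + a / 2).
  move=> r0 rs sT; have [rr ss] := it r0 rs sT.
  have := mild_expand a01 ev T1 rg tf r0 rs sT y.
  have := gen (cu ss) r0 rs (le_trans sT Ttau) y.
  rewrite /diffusion !uE//; set x := P r s _ y => h1 h2.
  rewrite [in leLHS](_ : _ - _ = (mild P g f T r y - x - (s - r) * f s y) +
    (x - mild P g f T s y - (s - r) * (2^-1 * \tr (hess (mild P g f T s) y *m A s)))); last by ring.
  by apply: le_trans (ler_normD _ _) _; rewrite [leRHS]mulrDl; apply: lerD.
move=> tt th; have [h0|/ltW h0] := leP 0 h; last first.
  have := base (t + h) t; rewrite (_ : t - (t + h) = - h); last by ring.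
  move=> b1.
  have /andP[th0 _] := th; have /andP[_ tT] := tt.
  have {b1} := b1 th0 _ tT; rewrite gerDl h0 => /(_ isT).
  have mN (x e : R) : x * - e = - x * e by rewrite mulrN mulNr.
  rewrite (ler0_norm h0) mN.
  move=> b1; apply: le_trans b1 _.
  by apply: ler_wpM2r; [exact: powR_ge0|lra].
have /andP[t0 _] := tt; have /andP[_ thT] := th.
have := base t (t + h) t0 _ thT; rewrite lerDl h0 => /(_ isT).
rewrite (_ : t + h - t = h); last by ring.
rewrite (ger0_norm h0) => b1.
have [_ _ dt] := diffusion_bounds T1 mild_uniform_c2a.
have alg (p q d e d' e' : R) : p - q - h * - (d + e) =
    - (q - p - h * (d' + e')) - h * ((d' - d) + (e' - e)) by ring.
rewrite (alg _ _ _ _ (diffusion u (t + h) y) (f (t + h) y)).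
rewrite mulrDl; apply: le_trans (ler_normB _ _) _; rewrite normrN; apply: lerD => //.
rewrite normrM (ger0_norm h0).
have [->|hn0] := eqVneq h 0; first by rewrite mul0r mulr_ge0 ?powR_ge0// addr_ge0// mulr_ge0.
rewrite powR1D ?lt_neqAle 1?eq_sym ?hn0// mulrCA ler_wpM2l// mulrDl.
have ah : `|t + h - t| = h by rewrite addrAC subrr add0r ger0_norm.
apply: le_trans (ler_normD _ _) _; apply: lerD.
  by have := dt (t + h) t y th tt; rewrite ah.
by have := f_time (t + h) t y; rewrite ah.
Qed.

Lemma mild_dt t y : 0 <= t <= T ->
  tderivable T u t y /\ dt T u t y = - (diffusion u t y + f t y).
Proof.
move=> tt; have [_ K0 N0 _ _] := tf.
have [|c d] := @dt_cvg R D u T t y _ _ (a / 2) T0 tt b20 _ (fun h hh => mild_generator y tt hh).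
  have h1 := mulr_ge0 C2_0 K0; have h2 := mulr_ge0 C40 G0'.
  have h3 : 0 <= D%:R ^+ 2 * (H1 * A0) by rewrite !mulr_ge0 ?exprn_ge0.
  by move: N0 h1 h2 h3; lra.
by split=> //; eexists; exact: c.
Qed.

Lemma mild_C2alpha_par : C2alpha_par a T u.
Proof.
have uu := mild_uniform_c2a; have [_ cu' hu'] := uu.
have [_ _ _ _ f_time] := tf; have [_ K0 N0 fb _] := tf.
have [db dx dt'] := diffusion_bounds T1 uu.
have DH : 0 <= D%:R ^+ 2 * (H1 * A0) by rewrite !mulr_ge0 ?exprn_ge0.
have hol_xy (phi : V -> R) k : hol a phi k -> forall x y, `|phi x - phi y| <= k * `|x - y| `^ a.
  by move=> h x y; have := h (x - y) y; rewrite /dif [y + _]addrC subrK.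
have ph_u : par_holder a T u.
  apply: (@par_holder_split R D a a01 _ _ (2 * H1)); first by rewrite mulr_ge0.
    by move=> t x y tt; apply: hol_xy; exact: (c2a_hol a01 (cu' t tt)).
  move=> t s y tt ss; apply: le_trans (mild_val_time y tt ss) _.
  by apply: ler_wpM2r; [exact: powR_ge0|have := H1_ge0; lra].
have ph_pd k : par_holder a T (fun t y => pd (u t) k y).
  apply: (@par_holder_split R D a a01 _ _ (H1 + 2 * H1)); first by have := H1_ge0; lra.
    move=> t x y tt; apply: hol_xy; have [_ _ p1 p2 _] := c2a_pd a01 (cu' t tt).
    by apply: (lip_hol a01).
  move=> t s y tt ss; apply: le_trans (mild_pd_time k y tt ss) _.
  by apply: ler_wpM2r; [exact: powR_ge0|have := H1_ge0; lra].
have ph_h k l : par_holder a T (fun t y => hess (u t) y k l).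
  apply: (@par_holder_split R D a a01 _ _ H1) => // [t x y tt|t s y tt ss]; last exact: hu'.
  have [_ _ _ _ p] := c2a_pd a01 (cu' t tt).
  by apply: (hol_xy (fun y => hess (u t) y k l)) => v; exact: (proj2 (p k l)).
have neg_sub (p q r s : R) : - (p + q) - - (r + s) = - ((p - r) + (q - s)) by ring.
have ph_dt : par_holder a T (dt T u).
  apply: (@par_holder_split R D a a01 _ _ (2 * (D%:R ^+ 2 * (H1 * A0)) + K + N)).
  - by rewrite !addr_ge0// mulr_ge0.
  - move=> t x y tt; rewrite (proj2 (mild_dt x tt)) (proj2 (mild_dt y tt)).
    rewrite neg_sub normrN; apply: le_trans (ler_normD _ _) _.
    apply: (@le_trans _ _ ((D%:R ^+ 2 * (H1 * A0) + K) * `|x - y| `^ a)).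
      by rewrite mulrDl; apply: lerD; [exact: dx|apply: hol_xy; exact: (proj2 (fb t))].
    by apply: ler_wpM2r; [exact: powR_ge0|lra].
  - move=> t s y tt ss; rewrite (proj2 (mild_dt y tt)) (proj2 (mild_dt y ss)).
    rewrite neg_sub normrN; apply: le_trans (ler_normD _ _) _.
    apply: (@le_trans _ _ ((2 * (D%:R ^+ 2 * (H1 * A0)) + N) * `|t - s| `^ (a / 2))).
      by rewrite mulrDl; apply: lerD; [exact: dt'|exact: f_time].
    by apply: ler_wpM2r; [exact: powR_ge0|lra].
split.
- split.
  + by move=> t y tt; exact: (proj1 (mild_dt y tt)).
  + by move=> t k y tt; have [h _ _ _ _] := c2a_pd a01 (cu' t tt); exact: h.
  + by move=> t k l y tt; have [_ h _ _ _] := c2a_pd a01 (cu' t tt); exact: h.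
  + by split; apply: (par_holder_cont a01).
  + by split=> *; apply: (par_holder_cont a01).
- split=> //; exists (D%:R ^+ 2 * (H1 * A0) + M) => -[t y] /= tt.
  rewrite (proj2 (mild_dt y tt)) normrN; apply: le_trans (ler_normD _ _) _.
  by apply: lerD; [exact: db|exact: (proj1 (fb t))].
- by exists H1 => -[t y] /= tt; have [_ h _ _ _] := cu' t tt; exact: h.
- by move=> k; exists H1 => -[t y] /= tt; have [_ _ h _ _] := c2a_pd a01 (cu' t tt); exact: h.
- move=> k l; split=> //; exists H1 => -[t y] /= tt.
  by have [_ _ _ _ h] := c2a_pd a01 (cu' t tt); exact: (proj1 (h k l)).
Qed.

End MildSolution.

End Regularity.

(** * Uniqueness *)

Section Telescoping.
Context {R : realType} {V : normedModType R} (a : R) (a01 : 0 < a < 1).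
Context (P : R -> R -> (V -> R) -> V -> R) (C1 C2 : R) (ev : evolution a P C1 C2).
Implicit Types (v f : R -> V -> R).

Let b20 : 0 < a / 2. Proof. by case/andP: a01 => ? ?; lra. Qed.

(* Errors of order [1 + a/2] on each of the [2 ^ n] subintervals sum up to a
   quantity that tends to zero. *)
Lemma almost_mild_unique v f g T M K N c : T <= 1 -> 0 <= c -> reg a g -> tame a f M K N ->
  (forall t, 0 <= t <= T -> reg a (v t)) -> v T = g ->
  (forall t s, 0 <= t -> t <= s -> s <= T ->
    bnd (fun y => v t y - P t s (v s) y - duh P t s f y) (c * (s - t) `^ (1 + a / 2))) ->
  forall t y, 0 <= t <= T -> v t y = mild P g f T t y.
Proof.
move=> T1 c0 rg tf rv vT hv.
pose w t y := v t y - mild P g f T t y.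
have rm t : 0 <= t <= T -> reg a (mild P g f T t).
  by move=> /andP[t0 tT]; exact: (mild_reg a01 ev T1 rg tf t0 tT).
have step t s b : 0 <= t -> t <= s -> s <= T -> bnd (w s) b ->
    bnd (w t) (b + c * (s - t) `^ (1 + a / 2)).
  move=> t0 ts sT wb y; have ss : 0 <= s <= T by rewrite sT (le_trans t0).
  have e1 : bnd (fun y => P t s (v s) y - P t s (mild P g f T s) y) b.
    by apply: (ev_nonexp ev); [exact: rv|exact: rm|].
  have := hv t s t0 ts sT y; have := e1 y.
  rewrite /w (mild_flow a01 ev T1 rg tf y t0 ts sT).
  move: (P t s (v s) y) (P t s (mild P g f T s) y) (duh P t s f y) => p q d h1 h2.
  rewrite (_ : _ - _ = (p - q) + (v t y - p - d)); last by ring.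
  by apply: le_trans (ler_normD _ _) _; exact: lerD.
have dyadic n : forall t s b, 0 <= t -> t <= s -> s <= T -> bnd (w s) b ->
    bnd (w t) (b + c * (s - t) * ((s - t) / 2 ^+ n) `^ (a / 2)).
  elim: n => [|n IH] t s b t0 ts sT wb.
    move=> y; have := step t s b t0 ts sT wb y; rewrite expr0 divr1.
    have [->|st] := eqVneq s t.
      by rewrite subrr powR0 ?mulr0 ?mul0r// gt_eqF// ltr_wpDr// ltW.
    by rewrite powR1D ?mulrA// subr_gt0 lt_neqAle eq_sym st.
  pose m := (t + s) / 2.
  have [tm ms] : t <= m /\ m <= s by rewrite /m; split; lra.
  have h1 := IH m s b (le_trans t0 tm) ms sT wb.
  have := IH t m _ t0 tm (le_trans ms sT) h1.
  have [-> ->] : s - m = (s - t) / 2 /\ m - t = (s - t) / 2 by rewrite /m; split; field.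
  have -> : (s - t) / 2 / 2 ^+ n = (s - t) / 2 ^+ n.+1 by rewrite exprS invfM mulrA.
  move=> h2 y; apply: le_trans (h2 y) _.
  by rewrite le_eqVlt; apply/orP; left; apply/eqP; field.
move=> t y tt; have /andP[t0 tT] := tt; apply/eqP; rewrite -subr_eq0; apply/eqP.
have wT : bnd (w T) 0 by move=> z; rewrite /w vT (mild_end a01 ev g (le_trans t0 tT) T1 tf) subrr normr0.
have rho : 0 <= (2^-1 : R) `^ (a / 2) < 1.
  by rewrite powR_ge0 powR_lt1//; apply/andP; split; lra.
apply: (@norm_eq0P R _ (fun n => c * (T - t) * (T - t) `^ (a / 2) * (2^-1 `^ (a / 2)) ^+ n)).
  exact: cvg_geo.
move=> n; have := dyadic n t T 0 t0 tT (lexx _) wT y; rewrite add0r => h; apply: le_trans h _.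
have tT' : 0 <= T - t by rewrite subr_ge0.
rewrite powRM ?invr_ge0 ?exprn_ge0// -exprVn powR_exprn ?invr_ge0// mulrA lexx//.
Qed.

End Telescoping.

Section ClassicalSolutions.
Context {R : realType} {D : nat} (a : R) (a01 : 0 < a < 1).
Local Notation V := 'cV[R]_D.
Implicit Types (v : R -> V -> R) (T t s : R).

Let b20 : 0 < a / 2. Proof. by case/andP: a01 => ? ?; lra. Qed.
Let a_gt0 : 0 < a. Proof. by case/andP: a01. Qed.

Lemma time_mvt v T y : 0 < T -> cont_on_strip T v ->
  (forall t, 0 <= t <= T -> tderivable T v t y) ->
  forall t s, 0 <= t -> t <= s -> s <= T ->
  exists2 x, t <= x <= s & v s y - v t y = dt T v x y * (s - t).
Proof.
move=> T0 cv dv t s t0 ts sT.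
have h1 (x : R) : x \in `]t, s[ -> is_derive x 1 (fun r => v r y) (dt T v x y).
  rewrite in_itv /= => /andP[tx xs]; have xx : 0 <= x <= T by apply/andP; split; lra.
  have pf := tfilter_proper T0 xx.
  have [l hl] := dv x xx; have -> : dt T v x y = l by exact: cvg_lim.
  have cq : (fun h : R => h^-1 *: (v (h *: 1 + x) y - v x y)) @ 0^' --> l.
    apply/cvgrPdist_le => e e0; move/cvgrPdist_le: hl => /(_ e e0) hl.
    have {}hl : \forall h \near (0 : R), (h != 0 /\ 0 <= x + h <= T) -> `|l - tquot v x y h| <= e by [].
    change (\forall h \near (0 : R), h != 0 -> `|l - h^-1 *: (v (h *: 1 + x) y - v x y)| <= e).
    near=> h => h0; rewrite /GRing.scale /= mulr1 [h + x]addrC.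
    have hm : `|h| <= Num.min x (T - x).
      near: h; have d0 : 0 < Num.min x (T - x) by rewrite lt_min; apply/andP; split; lra.
      by exists (Num.min x (T - x)) => //= r; rewrite /ball_ /= sub0r normrN => /ltW.
    have th : 0 <= x + h <= T.
      move: hm; rewrite le_min !ler_norml => /andP[/andP[? ?] /andP[? ?]].
      by apply/andP; split; lra.
    have : (h != 0 /\ 0 <= x + h <= T) -> `|l - tquot v x y h| <= e by near: h.
    by apply; split.
  have dx : derivable (fun r => v r y) x 1 by apply/cvg_ex; exists l; exact: cq.
  by apply: (DeriveDef dx); exact: cvg_lim.
have h2 : {within `[t, s], continuous (fun r => v r y)}.
  apply/subspace_continuousP => x; rewrite /= in_itv /= => /andP[tx xs].
  have xx : strip T (x, y) by rewrite /strip /=; apply/andP; split; lra.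
  move/subspace_continuousP: cv => /(_ (x, y) xx)/cvgrPdist_le cv.
  apply/cvgrPdist_le => e e0; have {}cv : \forall q \near (x, y), strip T q -> `|v x y - v q.1 q.2| <= e.
    exact: cv.
  change (\forall r \near x, `[t, s]%classic r -> `|v x y - v r y| <= e).
  have [[A B] /= [nA nB] AB] := cv.
  apply: filterS nA => r Ar; rewrite /= in_itv /= => /andP[tr rs].
  by apply: (AB (r, y)); [split=> //=; exact: nbhs_singleton nB|]; rewrite /strip /=; apply/andP; split; lra.
have [x] := @MVT_segment R (fun r => v r y) (fun r => dt T v r y) t s ts h1 h2.
by rewrite in_itv /= => hx e; exists x.
Unshelve. all: by end_near. Qed.

Lemma C2alpha_par_uniform v T : 0 < T -> T <= 1 -> C2alpha_par a T v ->
  exists G : R, [/\ uniform_c2a a v T G,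
    forall t s y, 0 <= t <= T -> 0 <= s <= T -> `|v t y - v s y| <= G * `|t - s| &
    forall t s y, 0 <= t <= T -> 0 <= s <= T ->
      `|dt T v t y - dt T v s y| <= G * `|t - s| `^ (a / 2)].
Proof.
move=> T0 T1 [[td d1 d2 [cv _] _] [[Bt hBt] ht] [B0 hB0] /choice[B1 hB1] hh].
have /choice[B2 hB2] : forall kl : 'I_D * 'I_D, exists b, 0 <= b /\
    ((forall p, strip T p -> `|hess (v p.1) p.2 kl.1 kl.2| <= b) /\
    (forall t x y, 0 <= t <= T -> `|hess (v t) x kl.1 kl.2 - hess (v t) y kl.1 kl.2| <= b * `|x - y| `^ a) /\
    (forall t s y, 0 <= t <= T -> 0 <= s <= T ->
      `|hess (v t) y kl.1 kl.2 - hess (v s) y kl.1 kl.2| <= b * `|t - s| `^ (a / 2))).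
  move=> [k l] /=; have [[b hb] ph] := hh k l; have [K K0 [h1 h2]] := par_holder_space a01 ph.
  exists (`|b| + K); split; first by rewrite addr_ge0.
  split; last split.
  - by move=> p sp; apply: le_trans (hb p sp) _; have := ler_norm b; lra.
  - move=> t x y tt; apply: le_trans (h1 t x y tt) _; apply: ler_wpM2r; first exact: powR_ge0.
    by rewrite lerDr.
  - move=> t s y tt ss; apply: le_trans (h2 t s y tt ss) _; apply: ler_wpM2r; first exact: powR_ge0.
    by rewrite lerDr.
have [Kt Kt0 [_ hKt]] := par_holder_space a01 ht.
pose M1 := \sum_k `|B1 k|; pose M2 := \sum_kl B2 kl.
have M10 : 0 <= M1 by apply: sumr_ge0.
have M20 : 0 <= M2 by apply: sumr_ge0 => kl _; have [] := hB2 kl.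
have B1M k : B1 k <= M1.
  by apply: le_trans (ler_norm _) _; rewrite /M1 (bigD1 k)//= lerDl sumr_ge0.
have B2M kl : B2 kl <= M2.
  by rewrite /M2 (bigD1 kl)//= lerDl sumr_ge0// => i _; have [] := hB2 i.
pose G0 := `|B0| + D%:R * M1 + D%:R ^+ 2 * M2 + D%:R ^+ 2 * M2.
have D20 : 0 <= D%:R ^+ 2 * M2 by rewrite mulr_ge0 ?exprn_ge0.
have D10 : 0 <= D%:R * M1 by rewrite mulr_ge0.
have G00 : 0 <= G0 by rewrite !addr_ge0.
pose G := G0 + M2 + `|Bt| + Kt.
have Bt0 := normr_ge0 Bt.
exists G; split.
- split; first by rewrite !addr_ge0.
    move=> t tt; apply: (@c2a_weaken R D a _ G0); last by rewrite /G; lra.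
    rewrite /G0; apply: c2a_of_hess => // [y|k y|k l y|k y|k l y|k l x y].
    + by apply: le_trans (hB0 (t, y) tt) _; exact: ler_norm.
    + exact: d1.
    + exact: d2.
    + exact: le_trans (hB1 k (t, y) tt) (B1M k).
    + by have [_ [h _]] := hB2 (k, l); exact: le_trans (h (t, y) tt) (B2M _).
    + have [_ [_ [h _]]] := hB2 (k, l); apply: le_trans (h t x y tt) _.
      by apply: ler_wpM2r; [exact: powR_ge0|exact: B2M].
  move=> t s k l y tt ss; have [_ [_ [_ h]]] := hB2 (k, l); apply: le_trans (h t s y tt ss) _.
  by apply: ler_wpM2r; [exact: powR_ge0|apply: le_trans (B2M _) _; rewrite /G; lra].
- move=> t s y; wlog ts : t s / t <= s.
    move=> hw tt ss; have [ts|/ltW st] := leP t s; first exact: hw.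
    by rewrite distrC [`|t - s|]distrC; exact: hw.
  move=> tt ss; have /andP[t0 _] := tt; have /andP[_ sT] := ss.
  have [x /andP[tx xs] e] := time_mvt T0 cv (fun r => @td r y) t0 ts sT.
  rewrite distrC e normrM [`|t - s|]distrC; apply: ler_wpM2r => //.
  have : `|dt T v x y| <= Bt by apply: (hBt (x, y)); rewrite /strip /=; apply/andP; split; lra.
  by have := ler_norm Bt; rewrite /G; lra.
- move=> t s y tt ss; apply: le_trans (hKt t s y tt ss) _.
  by apply: ler_wpM2r; [exact: powR_ge0|rewrite /G; lra].
Qed.

(* Compares the gradient with the difference quotient of step [sqrt `|t - s|]. *)
Lemma uniform_lip_time v T G : T <= 1 -> uniform_c2a a v T G ->
  (forall t s y, 0 <= t <= T -> 0 <= s <= T -> `|v t y - v s y| <= G * `|t - s|) ->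
  forall t s w, 0 <= t <= T -> 0 <= s <= T ->
    bnd (fun y => dif w (v t) y - dif w (v s) y) (D%:R * (10 * G) * `|w| * `|t - s| `^ (a / 2)).
Proof.
move=> T1 [G0 cv _] vt t s w tt ss.
have p0 := powR_ge0 `|t - s| (a / 2).
have [d _ _ _ _] := c2a_pd a01 (cv t tt); have [d' _ _ _ _] := c2a_pd a01 (cv s ss).
have hpd k y : `|pd (v t) k y - pd (v s) k y| <= 10 * G * `|t - s| `^ (a / 2).
  have [->|ts] := eqVneq t s.
    by rewrite subrr normr0 !mulr_ge0// powR_ge0.
  have d0 : 0 < `|t - s| by rewrite normr_gt0 subr_eq0.
  have d1 : `|t - s| <= 1.
    by apply: dist01; [move: tt => /andP[-> ?]|move: ss => /andP[-> ?]]; rewrite /=; lra.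
  pose h := Num.sqrt `|t - s|; have h0 : 0 < h by rewrite sqrtr_gt0.
  have hh : h * h = `|t - s| by rewrite -expr2 sqr_sqrtr.
  have h1 : h <= 1 by rewrite -sqrtr1 ler_wsqrtr.
  have ha : h `^ a = `|t - s| `^ (a / 2) by rewrite -hh -expr2 powR_half_sq// ltW.
  have e1 : `|ecoord R k| * `|ecoord R k| `^ a <= 1.
    by rewrite mulr_ile1 ?powR_ge0 ?norm_ecoord// powR_le1 ?norm_ecoord ?normr_ge0// ltW.
  have tay r : c2a a (v r) G -> `|v r (y + h *: ecoord R k) - v r y - h * pd (v r) k y| <= 4 * G * (h * h `^ a).
    move=> cr; have [_ /(_ h)] := zyg_taylor a01 y (ecoord R k) (c2a_zyg a01 cr).
    rewrite (gtr0_norm h0) powR1D// => hz; apply: le_trans hz _.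
    apply: ler_wpM2r; first by rewrite mulr_ge0 ?powR_ge0 ?ltW.
    have : G * (`|ecoord R k| * `|ecoord R k| `^ a) <= G by rewrite ler_piMr.
    by lra.
  have t1 := tay t (cv t tt); have t2 := tay s (cv s ss).
  have v1 := vt t s y tt ss; have v2 := vt t s (y + h *: ecoord R k) tt ss.
  rewrite -ha -(ler_pM2l h0) -(gtr0_norm h0) -normrM (gtr0_norm h0).
  move: t1 t2 v1 v2; move: (v t (y + _)) (v t y) (pd (v t) k y) (v s (y + _)) (v s y) (pd (v s) k y).
  move=> p1 q1 r1 p2 q2 r2 t1 t2 v1 v2.
  rewrite (_ : h * (r1 - r2) = - (p1 - q1 - h * r1) + (p2 - q2 - h * r2) + (p1 - p2) - (q1 - q2)); last by ring.
  apply: le_trans (ler_normB _ _) _; have := ler_normD (- (p1 - q1 - h * r1) + (p2 - q2 - h * r2)) (p1 - p2).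
  have := ler_normD (- (p1 - q1 - h * r1)) (p2 - q2 - h * r2); rewrite normrN.
  have : h * h <= h * h `^ a.
    rewrite ler_pM2l//; apply: le_powR01; rewrite ?(ltW h0) ?h1//; case/andP: a01 => ? ?.
    by apply/andP; split; lra.
  move=> hh2; have : G * `|t - s| <= G * (h * h `^ a) by rewrite -hh ler_wpM2l.
  rewrite (_ : h * (10 * G * h `^ a) = 10 * (G * (h * h `^ a))); last by ring.
  by move: t1 t2; rewrite -!mulrA; lra.
move=> y; have db k z : derivable (fun y => v t y - v s y) z (ecoord R k).
  by apply: derivableB; [exact: d|exact: d'].
have := @lip_of_pd R D (fun y => v t y - v s y) (10 * G * `|t - s| `^ (a / 2)) _ db _ w y.
rewrite (_ : dif _ _ _ = dif w (v t) y - dif w (v s) y); last by rewrite /dif; ring.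
rewrite !mulr_ge0// => /(_ isT) h; rewrite mulrAC -[D%:R * _ * _]mulrA; apply: h => k z.
rewrite /pd deriveB; [exact: hpd|exact: d|exact: d'].
Qed.

End ClassicalSolutions.

Section ClassicalIsMild.
Context {R : realType} {D : nat} (a : R) (a01 : 0 < a < 1).
Local Notation V := 'cV[R]_D.
Context (P : R -> R -> (V -> R) -> V -> R) (C1 C2 : R) (ev : evolution a P C1 C2).
Context (A : R -> 'M[R]_D) (tau C4 : R) (tau1 : tau <= 1) (C40 : 0 <= C4).
Hypothesis gen : forall phi G t s, c2a a phi G -> 0 <= t -> t <= s -> s <= tau ->
  bnd (fun y => P t s phi y - phi y - (s - t) * (2^-1 * \tr (hess phi y *m A s)))
    (C4 * G * (s - t) `^ (1 + a / 2)).

Lemma classical_mild (v f : R -> V -> R) (g : V -> R) T M K N : 0 < T -> T <= tau ->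
  C2alpha_par a T v -> tame a f M K N -> v T = g ->
  (forall t y, 0 <= t <= T -> dt T v t y = - (diffusion A v t y + f t y)) ->
  forall t y, 0 <= t <= T -> v t y = mild P g f T t y.
Proof.
move=> T0 Ttau cv tf vT pde; have T1 := le_trans Ttau tau1.
have [_ K0 N0 _ _] := tf; have C20 := ev_C2 ev.
have [G [[G0 cG _] _ dG]] := C2alpha_par_uniform a01 T0 T1 cv.
have rv t : 0 <= t <= T -> reg a (v t).
  move=> tt; have [_ b _ _ _] := cG t tt; exists G, (2 * G).
  by split=> //; [rewrite mulr_ge0|exact: (c2a_hol a01 (cG t tt))].
have c0 : 0 <= G + C4 * G + 2 * (C2 * K + N).
  by have := mulr_ge0 C20 K0; have := mulr_ge0 C40 G0; move: G0 N0; lra.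
have rg : reg a g by rewrite -vT; apply: rv; rewrite lexx ltW.
apply: (almost_mild_unique a01 ev T1 c0 rg tf rv vT) => t s t0 ts sT y.
have ss : 0 <= s <= T by rewrite sT (le_trans t0).
have [[td _ _ [cont _] _] _ _ _ _] := cv.
have [x /andP[tx xs] e] := time_mvt T0 cont (fun r => @td r y) t0 ts sT.
have xx : 0 <= x <= T by apply/andP; split; lra.
have st : 0 <= s - t by rewrite subr_ge0.
have e1 : `|(s - t) * (dt T v s y - dt T v x y)| <= G * (s - t) `^ (1 + a / 2).
  rewrite normrM (ger0_norm st); have [->|st'] := eqVneq s t.
    by rewrite subrr mul0r mulr_ge0 ?powR_ge0.
  have st0 : 0 < s - t by rewrite lt_neqAle st eq_sym subr_eq0 st'.
  rewrite powR1D// mulrCA ler_pM2l//; apply: le_trans (dG s x y ss xx) _.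
  rewrite ger0_norm ?subr_ge0//; apply: ler_wpM2l => //.
  have /andP[? ?] := a01; apply: ge0_ler_powR; rewrite ?nnegrE; lra.
have e2 := gen (cG s ss) t0 ts (le_trans sT Ttau) y.
have e3 := duh_small a01 ev tf t0 ts (le_trans sT T1) y.
move: e1 e2 e3; rewrite (pde s y ss) -/(diffusion A v s y).
move: (P t s (v s) y) (duh P t s f y) (diffusion A v s y) (f s y) e => p d q r e e1 e2 e3.
rewrite (_ : v t y - p - d = (s - t) * (- (q + r) - dt T v x y) - (p - v s y - (s - t) * q) - (d - (s - t) * r)).
  rewrite [leRHS]mulrDl [X in _ <= X + _]mulrDl.
  apply: le_trans (ler_normB _ _) _; apply: lerD => //.
  by apply: le_trans (ler_normB _ _) _; apply: lerD.
have {}e : v s y = v t y + dt T v x y * (s - t) by rewrite -e addrC subrK.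
by rewrite e; ring.
Qed.

End ClassicalIsMild.

Section PicardUnique.
Context {R : realType} {D : nat} (a : R) (a01 : 0 < a < 1).
Local Notation V := 'cV[R]_D.
Context (P : R -> R -> (V -> R) -> V -> R) (C1 C2 : R) (ev : evolution a P C1 C2).
Context (C3 : R) (C30 : 0 <= C3).
Hypothesis smooth : forall r s f M K N M', tame a f M K N ->
  0 <= r -> r <= s -> s <= 1 -> 0 <= M' ->
  (forall q, r <= q <= s -> bnd (f q) M') ->
  (forall w, bnd (dif w (duh P r s f)) (C3 * M' * `|w| * Num.sqrt (s - r))) /\
  (forall w z, bnd (dif z (dif w (duh P r s f))) (C3 * M' * `|w| * `|z| `^ a)).
Context {J : finType} (F : J -> R -> (J -> V) -> R) (B : R) (B0 : 0 <= B).
Hypothesis F_lip : forall i t (p q : J -> V) m e, 0 <= t <= 1 -> 0 <= m -> 0 <= e ->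
  (forall j, `|p j| <= m) -> (forall j, `|q j| <= m) -> (forall j, `|p j - q j| <= e) ->
  `|F i t p - F i t q| <= B * m * e.
Hypothesis F_zero : forall i t, F i t (fun=> 0) = 0.
Hypothesis F_time : forall i t s (p : J -> V) m, 0 <= t <= 1 -> 0 <= s <= 1 -> 0 <= m ->
  (forall j, `|p j| <= m) -> `|F i t p - F i s p| <= B * m * m * `|t - s| `^ (a / 2).
Context (g : J -> V -> R) (rg : forall i, reg a (g i)) (T : R) (T0 : 0 <= T) (T1 : T <= 1).
Implicit Types (u v : J -> R -> V -> R).

Lemma ok_weaken u M M' N : M <= M' -> ok a u T M N -> ok a u T M' N.
Proof.
move=> MM [M0 N0 h1 h2]; split=> //; first exact: le_trans MM.
move=> i t tt; have [l1 l2] := h1 i t tt; split=> [v y|v w y].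
  by apply: le_trans (l1 v y) _; rewrite ler_wpM2r.
by apply: le_trans (l2 v w y) _; do 2!(rewrite ler_wpM2r//).
Qed.

Lemma picard_unique u v M N M' N' : ok a u T M N -> ok a v T M' N' ->
  (forall i t y, 0 <= t <= T -> u i t y = picard P F g T u i t y) ->
  (forall i t y, 0 <= t <= T -> v i t y = picard P F g T v i t y) ->
  forall i t y, 0 <= t <= T -> u i t y = v i t y.
Proof.
move=> ou' ov' fu fv; have [M0 _ _ _] := ou'; have [M0' _ _ _] := ov'.
pose m := M + M'.
have ou : ok a u T m N by apply: ok_weaken ou'; rewrite lerDl.
have ov : ok a v T m N' by apply: ok_weaken ov'; rewrite lerDr.
have m0 : 0 <= m by exact: addr_ge0.
have Bm0 : 0 <= B * m by exact: mulr_ge0.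
have Cm0 : 0 <= C3 * (B * m) by exact: mulr_ge0.
have half0 : 0 < 2^-1 :> R by [].
have [eta /andP[eta0 _] heta] := small_time Cm0 half0 half0.
have tu i := forcing_tame a01 B0 F_lip F_zero F_time T0 T1 i ou.
have tv i := forcing_tame a01 B0 F_lip F_zero F_time T0 T1 i ov.
have local r : 0 <= r <= T -> (forall i, u i r = v i r) ->
    forall t, 0 <= t <= r -> r - eta <= t -> forall i, u i t = v i t.
  move=> /andP[r0 rT] uvr; have r1 := le_trans rT T1.
  have uE i t : 0 <= t <= r -> u i t = mild P (u i r) (forcing F u T i) r t.
    move=> /andP[t0 tr]; apply/funext => y; rewrite fu ?t0 ?(le_trans tr)//.
    rewrite /picard (mild_flow a01 ev T1 (rg i) (tu i) y t0 tr rT) /mild; congr (P _ _ _ _ + _).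
    by apply/funext => z; rewrite fu ?r0.
  have vE i t : 0 <= t <= r -> v i t = mild P (u i r) (forcing F v T i) r t.
    move=> /andP[t0 tr]; apply/funext => y; rewrite fv ?t0 ?(le_trans tr)//.
    rewrite /picard (mild_flow a01 ev T1 (rg i) (tv i) y t0 tr rT) /mild; congr (P _ _ _ _ + _).
    by apply/funext => z; rewrite uvr fv ?r0.
  have sub e i t : 0 <= e -> 0 <= t <= r ->
      (forall j s w, t <= s <= r -> bnd (fun y => dif w (u j s) y - dif w (v j s) y) (e * `|w|)) ->
      bnd (fun y => u i t y - v i t y) ((r - t) * (B * m * e)) /\
      forall w, bnd (fun y => dif w (u i t) y - dif w (v i t) y) (C3 * (B * m * e) * `|w| * Num.sqrt (r - t)).
    move=> e0 tr h; have /andP[t0 tr'] := tr; rewrite uE// vE//.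
    apply: (mild_sub a01 ev smooth (u i r) t0 tr' r1 (tu i) (tv i)); first exact: mulr_ge0.
    move=> q qr; have /andP[tq qr'] := qr.
    have qT : clamp T q = q by apply: clamp_id; rewrite (le_trans t0 tq) (le_trans qr').
    by apply: (forcing_sub a01 F_lip T0 T1 i ou ov e0) => j w; rewrite qT; exact: h.
  have iter n : forall j s w, 0 <= s <= r -> r - eta <= s ->
      bnd (fun y => dif w (u j s) y - dif w (v j s) y) (2 * m * 2^-1 ^+ n * `|w|).
    elim: n => [|n IH] j s w sr es y.
      have sT : 0 <= s <= T by case/andP: sr => -> sr; rewrite (le_trans sr).
      have [_ _ /(_ j s sT)[h1 _] _] := ou; have [_ _ /(_ j s sT)[h1' _] _] := ov.
      apply: le_trans (ler_normB _ _) _; have := h1 w y; have := h1' w y.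
      by rewrite expr0; lra.
    have e0 : 0 <= 2 * m * 2^-1 ^+ n by rewrite !mulr_ge0 ?exprn_ge0 ?invr_ge0.
    have [|_ h] := @sub (2 * m * 2^-1 ^+ n) j s e0 sr.
      move=> k q z /andP[sq qr]; apply: IH; last exact: le_trans sq.
      by rewrite qr andbT; case/andP: sr => s0 _; exact: le_trans sq.
    apply: le_trans (h w y) _; rewrite exprS.
    have /andP[s0 sr'] := sr; have rs0 : 0 <= r - s by rewrite subr_ge0.
    have := heta (r - s); rewrite rs0 powR12_sqrt//= => hs.
    have {}hs : C3 * (B * m) * Num.sqrt (r - s) <= 2^-1 by apply: hs; lra.
    rewrite [leLHS](_ : _ = C3 * (B * m) * Num.sqrt (r - s) * (2 * m * 2^-1 ^+ n * `|w|)); last by ring.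
    rewrite [leRHS](_ : _ = 2^-1 * (2 * m * 2^-1 ^+ n * `|w|)); last by ring.
    by apply: ler_wpM2r => //; exact: mulr_ge0.
  move=> t tr et i; apply/funext => y; apply/eqP; rewrite -subr_eq0; apply/eqP.
  apply: (@norm_eq0P R _ (fun n => (r - t) * (B * m * (2 * m)) * 2^-1 ^+ n)).
    by apply: cvg_geo; apply/andP; split; lra.
  move=> n; have e0 : 0 <= 2 * m * 2^-1 ^+ n by rewrite !mulr_ge0 ?exprn_ge0 ?invr_ge0.
  have [|h _] := @sub (2 * m * 2^-1 ^+ n) i t e0 tr.
    move=> j s w /andP[ts sr]; apply: iter; last exact: le_trans ts.
    by rewrite sr andbT; case/andP: tr => t0 _; exact: le_trans ts.
  by apply: le_trans (h y) _; rewrite le_eqVlt; apply/orP; left; apply/eqP; ring.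
have steps k : forall t, 0 <= t <= T -> T - k%:R * eta <= t -> forall i, u i t = v i t.
  elim: k => [|k IH] t /andP[t0 tT] kt i.
    have -> : t = T by apply/eqP; rewrite eq_le tT /=; move: kt; rewrite mul0r subr0.
    apply/funext => y; rewrite fu ?fv ?lexx ?andbT// /picard.
    by rewrite (mild_end a01 ev (g i) T0 T1 (tu i)) (mild_end a01 ev (g i) T0 T1 (tv i)).
  have [kt'|kt'] := leP (T - k%:R * eta) t; first by apply: IH => //; rewrite t0.
  have r0 : 0 <= T - k%:R * eta <= T.
    by rewrite gerBl mulr_ge0 ?(ltW eta0)// andbT; lra.
  apply: (local _ r0) => [j||]; first by apply: IH.
    by rewrite t0 ltW.
  by move: kt; rewrite -(natr1 k) mulrDl mul1r; lra.
move=> i t y tt; have te0 : 0 <= T / eta by rewrite divr_ge0// ltW.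
have := archi_boundP te0; rewrite ltr_pdivrMr// => hb.
rewrite (steps (Num.bound (T / eta)))//; case/andP: tt => t0 _.
by apply: le_trans t0; lra.
Qed.

End PicardUnique.

(** * The quadratic system *)

Section QuadraticForms.
Context {R : realType} {D : nat} (a : R) (a01 : 0 < a < 1).
Local Notation V := 'cV[R]_D.
Context {J : finType}.
Implicit Types (F l : R -> (J -> V) -> R) (p q : J -> V) (t s m e : R).

Let a_gt0 : 0 < a. Proof. by case/andP: a01. Qed.
Let b_gt0 : 0 < a / 2. Proof. by have := a_gt0; lra. Qed.

Definition lin_coef l := exists2 b : R, 0 <= b & forall t s p q m e,
  0 <= t <= 1 -> 0 <= s <= 1 -> 0 <= m -> 0 <= e ->
  (forall j, `|p j| <= m) -> (forall j, `|q j| <= m) -> (forall j, `|p j - q j| <= e) ->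
  [/\ `|l t p| <= b * m, `|l t p - l t q| <= b * e &
      `|l t p - l s p| <= b * m * `|t - s| `^ (a / 2)].

Definition quad_coef F := exists2 b : R, 0 <= b & forall t s p q m e,
  0 <= t <= 1 -> 0 <= s <= 1 -> 0 <= m -> 0 <= e ->
  (forall j, `|p j| <= m) -> (forall j, `|q j| <= m) -> (forall j, `|p j - q j| <= e) ->
  `|F t p - F t q| <= b * m * e /\
  `|F t p - F s p| <= b * m * m * `|t - s| `^ (a / 2).

Lemma lin_coord j k : lin_coef (fun _ p => p j k 0).
Proof.
exists 1 => // t s p q m e _ _ m0 e0 pm qm pq; rewrite !mul1r; split.
- by apply: le_trans (coord_le _ _) _.
- apply: le_trans (pq j); apply: le_trans (coord_le _ k).
  by rewrite !mxE.
- by rewrite subrr normr0 mulr_ge0 ?powR_ge0.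
Qed.

Lemma lin_add l l' : lin_coef l -> lin_coef l' -> lin_coef (fun t p => l t p + l' t p).
Proof.
move=> [b b0 h] [b' b0' h']; exists (b + b'); first exact: addr_ge0.
move=> t s p q m e tt ss m0 e0 pm qm pq.
have [h1 h2 h3] := h t s p q m e tt ss m0 e0 pm qm pq.
have [h1' h2' h3'] := h' t s p q m e tt ss m0 e0 pm qm pq.
split.
- by rewrite mulrDl; apply: le_trans (ler_normD _ _) _; apply: lerD.
- by rewrite opprD addrACA mulrDl; apply: le_trans (ler_normD _ _) _; apply: lerD.
- by rewrite opprD addrACA !mulrDl; apply: le_trans (ler_normD _ _) _; apply: lerD.
Qed.

Lemma lin_zero : lin_coef (fun _ _ => 0).
Proof. by exists 0 => // *; rewrite subrr !mul0r normr0. Qed.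

Lemma lin_sum (I : Type) (r : seq I) (l : I -> R -> (J -> V) -> R) :
  (forall i, lin_coef (l i)) -> lin_coef (fun t p => \sum_(i <- r) l i t p).
Proof.
move=> hl; elim: r => [|i r IH].
  rewrite (_ : (fun t p => _) = fun _ _ => 0); first exact: lin_zero.
  by apply/funext => t; apply/funext => p; rewrite big_nil.
rewrite (_ : (fun t p => _) = fun t p => l i t p + \sum_(i <- r) l i t p); first exact: lin_add.
by apply/funext => t; apply/funext => p; rewrite big_cons.
Qed.

Lemma hc01_half h : hc01 a h -> exists2 K : R, 0 <= K & (forall t, 0 <= t <= 1 -> `|h t| <= K) /\
  forall t s, 0 <= t <= 1 -> 0 <= s <= 1 -> `|h t - h s| <= K * `|t - s| `^ (a / 2).
Proof.
move=> hh; have [b b0 hb] := hc01_bnd a01 hh; have [K K0 hK] := hh.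
exists (b + K); first exact: addr_ge0; split=> [t tt|t s tt ss].
  by apply: le_trans (hb t tt) _; rewrite lerDl.
apply: le_trans (hK t s tt ss) _; have d1 := dist01 tt ss.
apply: ler_pM; rewrite ?powR_ge0 ?lerDr//.
have [->|ts] := eqVneq t s; first by rewrite subrr normr0 !powR0 ?gt_eqF.
rewrite {1}[a]splitr powRD; last by rewrite normr_eq0 subr_eq0 ts implybT.
by rewrite ler_piMr ?powR_ge0// powR_le1 ?normr_ge0// ltW.
Qed.

Lemma lin_mul h l : hc01 a h -> lin_coef l -> lin_coef (fun t p => h t * l t p).
Proof.
move=> /hc01_half[K K0 [hb hK]] [b b0 hl]; exists (K * b + K * b); first by rewrite addr_ge0 ?mulr_ge0.
move=> t s p q m e tt ss m0 e0 pm qm pq.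
have Kb : 0 <= K * b by exact: mulr_ge0.
have [h1 h2 h3] := hl t s p q m e tt ss m0 e0 pm qm pq.
have [h1' _ _] := hl s t p q m e ss tt m0 e0 pm qm pq.
have P0 := powR_ge0 `|t - s| (a / 2).
split.
- rewrite normrM mulrDl; apply: ler_wpDr; first by rewrite mulr_ge0.
  by rewrite -mulrA; apply: ler_pM => //; exact: hb.
- rewrite -mulrBr normrM mulrDl; apply: ler_wpDr; first by rewrite mulr_ge0.
  by rewrite -mulrA; apply: ler_pM => //; exact: hb.
- rewrite (_ : _ - _ = h t * (l t p - l s p) + (h t - h s) * l s p); last by ring.
  apply: le_trans (ler_normD _ _) _; rewrite !normrM !mulrDl; apply: lerD.
    by rewrite -!mulrA; apply: ler_pM => //; [exact: hb|rewrite mulrA].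
  rewrite [leRHS](_ : _ = K * `|t - s| `^ (a / 2) * (b * m)); last by ring.
  by apply: ler_pM => //; exact: hK.
Qed.

Lemma quad_mul l l' : lin_coef l -> lin_coef l' -> quad_coef (fun t p => l t p * l' t p).
Proof.
move=> [b b0 h] [b' b0' h']; exists (b * b' + b * b'); first by rewrite addr_ge0 ?mulr_ge0.
move=> t s p q m e tt ss m0 e0 pm qm pq.
have [h1 h2 h3] := h t s p q m e tt ss m0 e0 pm qm pq.
have [h1' h2' h3'] := h' t s p q m e tt ss m0 e0 pm qm pq.
have [_ _ _] := h s t p q m e ss tt m0 e0 pm qm pq.
have qp j : `|q j - p j| <= e by rewrite distrC.
have [k1 _ _] := h' t s q p m e tt ss m0 e0 qm pm qp.
have [k2 _ _] := h' s t p q m e ss tt m0 e0 pm qm pq.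
split.
  rewrite (_ : _ - _ = l t p * (l' t p - l' t q) + (l t p - l t q) * l' t q); last by ring.
  apply: le_trans (ler_normD _ _) _; rewrite !normrM !mulrDl; apply: lerD.
    rewrite [leRHS](_ : _ = (b * m) * (b' * e)); last by ring.
    exact: ler_pM.
  rewrite [leRHS](_ : _ = (b * e) * (b' * m)); last by ring.
  exact: ler_pM.
rewrite (_ : _ - _ = l t p * (l' t p - l' s p) + (l t p - l s p) * l' s p); last by ring.
apply: le_trans (ler_normD _ _) _; rewrite !normrM !mulrDl; apply: lerD.
  rewrite [leRHS](_ : _ = (b * m) * (b' * m * `|t - s| `^ (a / 2))); last by ring.
  exact: ler_pM.
rewrite [leRHS](_ : _ = (b * m * `|t - s| `^ (a / 2)) * (b' * m)); last by ring.
exact: ler_pM.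
Qed.

Lemma quad_add (c c' : R) F F' : quad_coef F -> quad_coef F' ->
  quad_coef (fun t p => c * F t p + c' * F' t p).
Proof.
move=> [b b0 h] [b' b0' h']; exists (`|c| * b + `|c'| * b'); first by rewrite addr_ge0 ?mulr_ge0.
move=> t s p q m e tt ss m0 e0 pm qm pq.
have [h1 h2] := h t s p q m e tt ss m0 e0 pm qm pq.
have [h1' h2'] := h' t s p q m e tt ss m0 e0 pm qm pq.
split; rewrite opprD addrACA -!mulrBr !mulrDl -!mulrA; apply: le_trans (ler_normD _ _) _; rewrite !normrM.
  by apply: lerD; rewrite ler_wpM2l// mulrA.
by apply: lerD; rewrite ler_wpM2l// !mulrA.
Qed.

Lemma quad_sum (I : Type) (r : seq I) (F : I -> R -> (J -> V) -> R) :
  (forall i, quad_coef (F i)) -> quad_coef (fun t p => \sum_(i <- r) F i t p).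
Proof.
move=> hF; elim: r => [|i r IH].
  rewrite (_ : (fun t p => _) = fun _ _ => 0).
    by exists 0 => // *; rewrite subrr normr0 !mul0r.
  by apply/funext => t; apply/funext => p; rewrite big_nil.
rewrite (_ : (fun t p => _) = fun t p => 1 * F i t p + 1 * \sum_(i <- r) F i t p); first exact: quad_add.
by apply/funext => t; apply/funext => p; rewrite big_cons !mul1r.
Qed.

End QuadraticForms.

Section Nonlinearity.
Context {R : realType} {D N I : nat} (hND : (N <= D)%N) (alpha : R) (alpha01 : 0 < alpha < 1).
Local Notation V := 'cV[R]_D.
Context (a : 'I_I -> R) (C : R -> 'M[R]_D).
Hypothesis hC : forall k l, hc01 alpha (fun t => C t k l).

Definition coupling t (p : 'I_I -> V) : 'cV[R]_N :=
  ((\sum_(i < I) (a i)^-1)^-1) *: ((firstcols hND (C t))^T *m (\sum_(j < I) p j)).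

Definition nonlin (i : 'I_I) t (p : 'I_I -> V) : R :=
  (2 * a i)^-1 * sqnorm (coupling t p)
  - scal11 ((coupling t p)^T *m (firstcols hND (C t))^T *m p i)
  + a i / 2 * (sqnorm ((firstcols hND (C t))^T *m p i) - sqnorm ((C t)^T *m p i)).

Lemma nonlin_zero i t : nonlin i t (fun=> 0) = 0.
Proof.
have sq0 m : sqnorm (0 : 'cV[R]_m) = 0.
  by rewrite /sqnorm big1// => k _; rewrite mxE expr0n.
by rewrite /nonlin /coupling sumr_const mul0rn !mulmx0 scaler0 !sq0 /scal11 mxE !subr0 !mulr0 addr0.
Qed.

Lemma nonlin_quad i : quad_coef alpha (nonlin i).
Proof.
have lC (n : 'I_D) : lin_coef alpha (fun t (p : 'I_I -> V) => ((C t)^T *m p i) n 0).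
  rewrite (_ : (fun t p => _) = fun t (p : 'I_I -> V) => \sum_k C t k n * p i k 0).
    by apply: lin_sum => k; apply: (lin_mul alpha01) => //; exact: lin_coord.
  by apply/funext => t; apply/funext => p; rewrite mxE; apply: eq_bigr => k _; rewrite mxE.
have lCb (n : 'I_N) : lin_coef alpha (fun t (p : 'I_I -> V) => ((firstcols hND (C t))^T *m p i) n 0).
  rewrite (_ : (fun t p => _) = fun t (p : 'I_I -> V) => \sum_k C t k (widen_ord hND n) * p i k 0).
    by apply: lin_sum => k; apply: (lin_mul alpha01) => //; exact: lin_coord.
  by apply/funext => t; apply/funext => p; rewrite mxE; apply: eq_bigr => k _; rewrite !mxE.
have ll (n : 'I_N) : lin_coef alpha (fun t (p : 'I_I -> V) => coupling t p n 0).
  rewrite (_ : (fun t p => _) = fun t (p : 'I_I -> V) => (\sum_(i < I) (a i)^-1)^-1 *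
      \sum_k C t k (widen_ord hND n) * \sum_(j < I) p j k 0).
    apply: (lin_mul alpha01); first exact: hc01_cst.
    apply: lin_sum => k; apply: (lin_mul alpha01) => //.
    by apply: lin_sum => j; exact: lin_coord.
  apply/funext => t; apply/funext => p; rewrite !mxE; congr (_ * _); apply: eq_bigr => k _.
  by rewrite !mxE summxE.
rewrite (_ : nonlin i = fun t (p : 'I_I -> V) =>
  1 * ((2 * a i)^-1 * (\sum_n coupling t p n 0 * coupling t p n 0) +
       -1 * (\sum_n coupling t p n 0 * ((firstcols hND (C t))^T *m p i) n 0)) +
  1 * (a i / 2 * (\sum_n ((firstcols hND (C t))^T *m p i) n 0 * ((firstcols hND (C t))^T *m p i) n 0) +
       - (a i / 2) * (\sum_n ((C t)^T *m p i) n 0 * ((C t)^T *m p i) n 0))).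
  by apply: quad_add; apply: quad_add; apply: quad_sum => n; exact: quad_mul.
apply/funext => t; apply/funext => p; rewrite /nonlin !mul1r mulN1r mulNr -mulrBr.
congr (_ - _ + _).
by rewrite /scal11 -mulmxA mxE; apply: eq_bigr => n _; rewrite mxE.
Qed.

Lemma nonlin_bounds : exists2 B : R, 0 <= B &
  (forall i t (p q : 'I_I -> V) m e, 0 <= t <= 1 -> 0 <= m -> 0 <= e ->
  (forall j, `|p j| <= m) -> (forall j, `|q j| <= m) -> (forall j, `|p j - q j| <= e) ->
  `|nonlin i t p - nonlin i t q| <= B * m * e) /\
  (forall i t s (p : 'I_I -> V) m, 0 <= t <= 1 -> 0 <= s <= 1 -> 0 <= m ->
  (forall j, `|p j| <= m) -> `|nonlin i t p - nonlin i s p| <= B * m * m * `|t - s| `^ (alpha / 2)).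
Proof.
have /choice[b hb] : forall i, exists b : R, 0 <= b /\ forall t s p q m e,
    0 <= t <= 1 -> 0 <= s <= 1 -> 0 <= m -> 0 <= e ->
    (forall j, `|p j| <= m) -> (forall j, `|q j| <= m) -> (forall j, `|p j - q j| <= e) ->
    `|nonlin i t p - nonlin i t q| <= b * m * e /\
    `|nonlin i t p - nonlin i s p| <= b * m * m * `|t - s| `^ (alpha / 2).
  by move=> i; have [b b0 h] := nonlin_quad i; exists b.
have b0 i : 0 <= b i by have [] := hb i.
have bB i : b i <= \sum_i b i by rewrite (bigD1 i)//= lerDl sumr_ge0.
exists (\sum_i b i); first exact: sumr_ge0; split.
  move=> i t p q m e tt m0 e0 pm qm pq; have [_ h] := hb i.
  have [h1 _] := h t t p q m e tt tt m0 e0 pm qm pq.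
  by apply: le_trans h1 _; do 2!(rewrite ler_wpM2r//).
move=> i t s p m tt ss m0 pm; have [_ h] := hb i.
have pp j : `|p j - p j| <= 0 by rewrite subrr normr0.
have [_ h1] := h t s p p m 0 tt ss m0 (lexx 0) pm pm pp.
by apply: le_trans h1 _; rewrite ler_wpM2r ?powR_ge0// ler_wpM2r// ler_wpM2r.
Qed.

End Nonlinearity.

Section DataBounds.
Context {R : realType} {D : nat} (a : R) (a01 : 0 < a < 1).
Local Notation V := 'cV[R]_D.

Let a_gt0 : 0 < a. Proof. by case/andP: a01. Qed.

Lemma C2alpha_c2a (g : V -> R) : C2alpha a g -> exists G, c2a a g G.
Proof.
move=> [[_ d1 _ d2 _] [B0 hB0] /choice[B1 hB1] hB2 hK].
have /choice[B2 hB] : forall kl : 'I_D * 'I_D, exists b : R, 0 <= b /\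
    (forall y, `|hess g y kl.1 kl.2| <= b) /\
    forall x y, `|hess g x kl.1 kl.2 - hess g y kl.1 kl.2| <= b * `|x - y| `^ a.
  move=> [k l] /=; have [b hb] := hB2 k l; have [K h] := hK k l.
  have Da : 0 <= D%:R `^ a :> R by exact: powR_ge0.
  exists (`|b| + `|K| * D%:R `^ a); split; first by rewrite addr_ge0 ?mulr_ge0.
  split=> [y|x y].
    apply: le_trans (hb y _) _ => //; apply: ler_wpDr; first by rewrite mulr_ge0.
    exact: ler_norm.
  have e0 : 0 <= enorm (x - y) by exact: sqrtr_ge0.
  have hK' : enorm (x - y) `^ a <= D%:R `^ a * `|x - y| `^ a.
    rewrite -powRM//; apply: ge0_ler_powR; rewrite ?nnegrE ?mulr_ge0 ?(ltW a_gt0)//.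
    exact: enorm_le_norm.
  rewrite mulrDl; apply: ler_wpDl; first by rewrite mulr_ge0 ?powR_ge0.
  apply: le_trans (h x y) _; rewrite -mulrA; apply: (@le_trans _ _ (`|K| * enorm (x - y) `^ a)).
    by rewrite ler_wpM2r ?powR_ge0 ?ler_norm.
  by rewrite ler_wpM2l.
pose M1 := \sum_k `|B1 k|; pose M2 := \sum_kl B2 kl.
have M10 : 0 <= M1 by exact: sumr_ge0.
have M20 : 0 <= M2 by apply: sumr_ge0 => kl _; have [] := hB kl.
have B1M k : B1 k <= M1.
  by apply: le_trans (ler_norm _) _; rewrite /M1 (bigD1 k)//= lerDl sumr_ge0.
have B2M kl : B2 kl <= M2.
  by rewrite /M2 (bigD1 kl)//= lerDl sumr_ge0// => i _; have [] := hB i.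
exists (`|B0| + D%:R * M1 + D%:R ^+ 2 * M2 + D%:R ^+ 2 * M2).
apply: c2a_of_hess => // [y|k y|k l y|k l x y].
- by apply: le_trans (hB0 y _) _; rewrite ?ler_norm.
- exact: le_trans (hB1 k y _) (B1M k).
- by have [_ [h _]] := hB (k, l); exact: le_trans (h y) (B2M _).
- have [_ [_ h]] := hB (k, l); apply: le_trans (h x y) _.
  by apply: ler_wpM2r; [exact: powR_ge0|exact: B2M].
Qed.

Lemma C2alpha_par_ok (J : finType) (v : J -> R -> V -> R) T : 0 < T -> T <= 1 ->
  (forall j, C2alpha_par a T (v j)) -> exists M N, ok a v T M N.
Proof.
move=> T0 T1 hv.
have /choice[G hG] : forall j, exists G, [/\ uniform_c2a a (v j) T G,
    forall t s y, 0 <= t <= T -> 0 <= s <= T -> `|v j t y - v j s y| <= G * `|t - s| &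
    forall t s y, 0 <= t <= T -> 0 <= s <= T ->
      `|dt T (v j) t y - dt T (v j) s y| <= G * `|t - s| `^ (a / 2)].
  by move=> j; exact: (C2alpha_par_uniform a01).
have G0 j : 0 <= G j by have [[]] := hG j.
pose M := \sum_j G j; have GM j : G j <= M by rewrite /M (bigD1 j)//= lerDl sumr_ge0.
have M0 : 0 <= M by exact: sumr_ge0.
exists M, (D%:R * (10 * M)); split=> //; first by rewrite !mulr_ge0.
  move=> j t tt; have [[_ c _] _ _] := hG j; have [_ _ h1 h2 _] := c t tt.
  split=> [w y|w z y]; [apply: le_trans (h1 w y) _|apply: le_trans (h2 w z y) _].
    by rewrite ler_wpM2r.
  by do 2!(rewrite ler_wpM2r//).
move=> j s t w ss tt y; have [uc lt _] := hG j.
apply: le_trans (uniform_lip_time a01 T1 uc lt w ss tt y) _.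
by rewrite ler_wpM2r ?powR_ge0// ler_wpM2r// ler_wpM2l// ler_wpM2l.
Qed.

End DataBounds.

Unset Implicit Arguments.

Theorem theoremA5 (R : realType) (D N I : nat)
  (hN1 : (1 <= N)%N) (hND : (N <= D)%N) (hI : (1 <= I)%N)
  (a : 'I_I -> R) (ha : forall i, 0 < a i)
  (alpha dlo dup : R) (halpha : 0 < alpha < 1)
  (hdlo : 0 < dlo) (hdd : dlo < dup)
  (C : R -> 'M[R]_D)
  (hC : exists K : R, forall t s, 0 <= t <= 1 -> 0 <= s <= 1 ->
          `|C t - C s| <= K * `|t - s| `^ alpha)
  (hell : forall (t : R) (y : 'cV[R]_D), 0 <= t <= 1 ->
          dlo * sqnorm y <= scal11 (y^T *m C t *m (C t)^T *m y) <= dup * sqnorm y)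
  (g : 'I_I -> 'cV[R]_D -> R) (hg : forall i, C2alpha alpha (g i)) :
  exists T0 : R, 0 < T0 <= 1 /\
    forall T : R, 0 < T -> T < T0 ->
      exists u : 'I_I -> R -> 'cV[R]_D -> R,
        is_solution hND a C g alpha T u /\
        forall v : 'I_I -> R -> 'cV[R]_D -> R,
          is_solution hND a C g alpha T v ->
          forall i t y, 0 <= t <= T -> v i t y = u i t y.
Proof.
have D0 : (0 < D)%N by exact: leq_trans hN1 hND.
have z01 : 0 <= (0 : R) <= 1 by rewrite lexx ler01.
have hCe k l : hc01 alpha (fun t => C t k l).
  have [K hK] := hC; exists `|K| => // t s tt ss.
  have := entry_le (C t - C s) k l; rewrite !mxE => h; apply: le_trans h _.
  by apply: le_trans (hK t s tt ss) _; rewrite ler_wpM2r ?powR_ge0// ler_norm.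
have C0u : C 0 \in unitmx.
  by apply: (coercive_unitmx hdlo) => y; case/andP: (hell 0 y z01).
have [tau [P [C1 [C2 [C4 [/andP[tau0 tau1] ev C40 gen]]]]]] := evolution_exists D0 halpha C0u hCe.
have [C3 C30 smooth] := duh_smooth halpha ev.
have [B B0 [F_lip F_time]] := @nonlin_bounds R D N I hND alpha halpha a C hCe.
have F_zero := @nonlin_zero R D N I hND a C.
set F := nonlin hND a C in F_lip F_time F_zero.
pose A t := C t *m (C t)^T.
have {}gen phi G t s : c2a alpha phi G -> 0 <= t -> t <= s -> s <= tau ->
    bnd (fun y => P t s phi y - phi y - (s - t) * (2^-1 * \tr (hess phi y *m A s)))
      (C4 * G * (s - t) `^ (1 + alpha / 2)).
  by move=> cG t0 ts st y; rewrite mulmxA; exact: gen.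
have hA k l : hc01 alpha (fun t => A t k l).
  rewrite (_ : (fun t => _) = fun t => \sum_m C t k m * C t l m).
    by apply: hc01_sum => m; exact: (hc01_mul halpha).
  by apply/funext => t; rewrite mxE; apply: eq_bigr => m _; rewrite mxE.
have [A0 A00 [A_bnd A_time]] : exists2 A0 : R, 0 <= A0 &
    (forall t k l, 0 <= t <= 1 -> `|A t k l| <= A0) /\
    forall t s k l, 0 <= t <= 1 -> 0 <= s <= 1 ->
      `|A t k l - A s k l| <= A0 * `|t - s| `^ (alpha / 2).
  have /choice[b hb] : forall kl : 'I_D * 'I_D, exists b : R, 0 <= b /\
      (forall t, 0 <= t <= 1 -> `|A t kl.1 kl.2| <= b) /\
      forall t s, 0 <= t <= 1 -> 0 <= s <= 1 ->
        `|A t kl.1 kl.2 - A s kl.1 kl.2| <= b * `|t - s| `^ (alpha / 2).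
    by move=> [k l]; have [b b0 h] := hc01_half halpha (hA k l); exists b.
  have b0 kl : 0 <= b kl by have [] := hb kl.
  have bB kl : b kl <= \sum_kl b kl by rewrite (bigD1 kl)//= lerDl sumr_ge0.
  exists (\sum_kl b kl); first exact: sumr_ge0.
  split=> [t k l tt|t s k l tt ss]; have [_ [h1 h2]] := hb (k, l).
    exact: le_trans (h1 t tt) (bB _).
  by apply: le_trans (h2 t s tt ss) _; rewrite ler_wpM2r ?powR_ge0.
have [G G0 cg] : exists2 G, 0 <= G & forall i, c2a alpha (g i) G.
  have /choice[b hb] : forall i, exists b, c2a alpha (g i) b.
    by move=> i; exact: (C2alpha_c2a halpha).
  have b0 i : 0 <= b i by have [] := hb i.
  exists (\sum_i b i) => [|i]; first exact: sumr_ge0.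
  by apply: (c2a_weaken (hb i)); rewrite (bigD1 i)//= lerDl sumr_ge0.
have rg i : reg alpha (g i).
  have [_ b _ _ _] := cg i; exists G, (2 * G).
  by split=> //; [rewrite mulr_ge0|exact: (c2a_hol halpha (cg i))].
pose M := G + 1; pose L := B * M * M.
have M0 : 0 <= M by rewrite addr_ge0.
have L0 : 0 <= L by rewrite !mulr_ge0.
have BM0 : 0 <= C3 * (B * M) by rewrite !mulr_ge0.
have C3L : 0 <= C3 * L by rewrite mulr_ge0.
have kap0 : 0 <= L + C3 * L + 2 * (C3 * (B * M)) by lra.
have half0 : 0 < 2^-1 :> R by [].
have [tau' /andP[tau'0 _] htau'] := small_time kap0 half0 (@ltr01 R).
exists (Num.min tau tau'); split; first by rewrite lt_min tau0 tau'0 ge_min tau1.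
move=> T T0; rewrite lt_min => /andP[/ltW Ttau /ltW Ttau'].
have T1 := le_trans Ttau tau1; have T00 := ltW T0.
have small : (L + C3 * L + 2 * (C3 * (B * M))) * Num.sqrt T <= 1.
  by rewrite -powR12_sqrt//; apply: htau'; rewrite T00.
have s0 := sqrtr_ge0 T.
have p1 := mulr_ge0 L0 s0; have p2 := mulr_ge0 C3L s0; have p3 := mulr_ge0 BM0 s0.
have [|||u ou fu] := picard_fixpoint halpha ev C30 smooth B0 F_lip F_zero F_time T00 T1 cg G0.
- by rewrite -/M -/L; move: small; rewrite !mulrDl; lra.
- by rewrite -/M -/L; move: small; rewrite !mulrDl; lra.
- by rewrite -/M; move: small; rewrite !mulrDl; lra.
have forcingE v i t y : 0 <= t <= T -> forcing F v T i t y = F i t (fun j => grad (v j t) y).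
  by move=> tt; rewrite /forcing clamp_id.
have tu i := forcing_tame halpha B0 F_lip F_zero F_time T00 T1 i ou.
have fL i s v := forcing_dif halpha F_lip T00 T1 i s v ou.
exists u; split.
  split=> [i|i y|i t y tt].
  - exact: (mild_C2alpha_par halpha ev C30 smooth A00 tau1 C40 A_bnd A_time gen T0 Ttau
      (cg i) (tu i) L0 (fL i) (fun t y => @fu i t y)).
  - by rewrite fu ?T00 ?lexx// /picard (mild_end halpha ev (g i) T00 T1 (tu i)).
  - have [_ dtE] := mild_dt halpha ev C30 smooth A00 tau1 C40 A_bnd A_time gen T0 Ttau
      (cg i) (tu i) L0 (fL i) (fun t y => @fu i t y) y tt.
    rewrite /= dtE forcingE// /F /nonlin /diffusion /A mulmxA -/(coupling hND a C t (fun j => grad (u j t) y)).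
    by rewrite /lambda_fun -/(coupling hND a C t (fun j => grad (u j t) y)); ring.
move=> v [hv vT pde] i t y tt.
have [Mv [Nv ov]] := C2alpha_par_ok halpha T0 T1 hv.
have tv j := forcing_tame halpha B0 F_lip F_zero F_time T00 T1 j ov.
have fv j s z : 0 <= s <= T -> v j s z = picard P F g T v j s z.
  move=> ss; apply: (classical_mild halpha ev tau1 C40 gen T0 Ttau (hv j) (tv j)) => //.
    by apply/funext => x; exact: vT.
  move=> r x rr; have := pde j r x rr.
  rewrite forcingE// /F /nonlin /diffusion /A mulmxA /=.
  rewrite /lambda_fun -/(coupling hND a C r (fun j => grad (v j r) x)) => e.
  by apply/eqP; rewrite -addr_eq0 -[X in _ == X]e; apply/eqP; ring.
by apply/esym; apply: (picard_unique halpha ev C30 smooth B0 F_lip F_zero F_time rg T00 T1 ou ov fu fv).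
Qed.
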